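(* For every $\varepsilon>0$ there exists $m_0=m_0(\varepsilon)$ such that for every integer $m\ge m_0$ and every integer $a$ with $\gcd(a,m)=1$ we have $$v_a(m)\le t\, m^{5/12+\varepsilon},\qquad\text{where } t=m/m^*.$$ (That is, $v_a(m)\le t\,m^{5/12+o(1)}$ as $m\to\infty$, uniformly over all $a$ coprime to $m$.)
   Context: For integers $a$ and $m\ge 2$, the modular hyperbola is the set of integral points $\mathcal{H}_a(m)=\{(x,y)\in\mathbb{Z}^2 : xy\equiv a \pmod m,\ 1\le x,y\le m-1\}$. Let $\mathcal{C}(a,m)$ be the convex hull of $\mathcal{H}_a(m)$ in $\mathbb{R}^2$, and let $v_a(m)$ denote the number of vertices of $\mathcal{C}(a,m)$. For a positive integer $m$, its kernel $m^*$ is the product of all distinct prime divisors of $m$. *)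

(* Defs.v *)
From HB Require Import structures.
From mathcomp Require Import all_boot all_order all_algebra.
From mathcomp Require Import finmap.
From mathcomp Require Import all_classical all_reals all_analysis.

Set Implicit Arguments.
Unset Strict Implicit.
Unset Printing Implicit Defensive.

Import Order.TTheory GRing.Theory Num.Theory.

Local Open Scope classical_set_scope.
Local Open Scope ring_scope.
Local Open Scope convex_scope.

Definition modular_hyperbola (a : int) (m : nat) : set (int * int) :=
  [set p | [/\ (p.1 * p.2 = a %[mod m%:Z])%Z,
              1 <= p.1 <= m%:Z - 1 & 1 <= p.2 <= m%:Z - 1]].

(* [R^o] supplies the R-module structure on the factors. *)
Definition plane (R : numDomainType) := convex_lmodType (R^o * R^o)%type.

Definition int_point (R : numDomainType) (p : int * int) : plane R :=
  (p.1%:~R, p.2%:~R).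

Definition convex_hull (R : numDomainType) (M : lmodType R)
    (A : set (convex_lmodType M)) : set (convex_lmodType M) :=
  smallest (@convex_set R M) A.

(* For a convex polygon, possibly degenerate, these are its vertices. *)
Definition extreme_points (R : numDomainType) (M : lmodType R)
    (A : set (convex_lmodType M)) : set (convex_lmodType M) :=
  [set p | A p /\ forall (x y : convex_lmodType M) (t : {i01 R}),
     A x -> A y -> 0 < t%:num < 1 -> p = x <| t |> y -> x = p /\ y = p].

Definition hyperbola_hull (R : numDomainType) (a : int) (m : nat) :
    set (plane R) :=
  convex_hull (int_point R @` modular_hyperbola a m).

Arguments hyperbola_hull R a m : clear implicits.

Definition hull_vertices (R : numDomainType) (a : int) (m : nat) :
    set (plane R) :=
  extreme_points (hyperbola_hull R a m).

Arguments hull_vertices R a m : clear implicits.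

(* [fset_set] sends infinite sets to [fset0]; [finite_hull_vertices] below
   shows that this case does not occur. *)
Definition num_hull_vertices (R : numDomainType) (a : int) (m : nat) : nat :=
  #|` fset_set (hull_vertices R a m)|.

Definition kernel_nat (m : nat) : nat := (\prod_(p <- primes m) p)%N.

Lemma extreme_points_convex_hull (R : numDomainType) (M : lmodType R)
    (A : set (convex_lmodType M)) :
  extreme_points (convex_hull A) `<=` A.
Proof.
move=> p [Hp ext]; apply: contrapT => nAp.
suff : (convex_hull A `\ p) p by case=> _; apply.
apply: (@smallest_sub _ (@convex_set R M) A) Hp; last first.
  move=> q Aq; split; first exact: sub_gen_smallest.
  by move=> qp; apply: nAp; rewrite -qp.
apply/convex_setW => x y /set_mem[hx nx] /set_mem[hy ny] k k0 k1.
apply: mem_set; split.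
  move=> C [cC AC]; apply: set_mem; apply: (cC); apply: mem_set.
    exact: (hx C (conj cC AC)).
  exact: (hy C (conj cC AC)).
move=> /esym e; apply: nx.
by have [] := ext _ _ k hx hy _ e; rewrite ?k0 ?k1.
Qed.

Lemma finite_modular_hyperbola (a : int) (m : nat) :
  finite_set (modular_hyperbola a m).
Proof.
apply: (@sub_finite_set _ _
  ((fun q : nat * nat => (q.1%:Z, q.2%:Z)) @` (`I_m `*` `I_m))); last first.
  by apply: finite_image; apply: finite_setX; exact: finite_II.
case=> [[x|x] [y|y]] [_] //=; rewrite ?andbF // => /andP[_ hx] /andP[_ hy].
exists (x, y) => //; split => /=.
- by move: hx; rewrite lerBrDr -PoszD lez_nat addn1.
- by move: hy; rewrite lerBrDr -PoszD lez_nat addn1.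
Qed.

Lemma finite_hull_vertices (R : numDomainType) (a : int) (m : nat) :
  finite_set (hull_vertices R a m).
Proof.
apply: sub_finite_set (@extreme_points_convex_hull _ _ _) _.
exact/finite_image/finite_modular_hyperbola.
Qed.

(* Main.v *)
(* A vertex P is supported by a linear functional; the signs of its coefficients choose
   a corner of the square, and no point of the hyperbola lies strictly between P and that
   corner.  Kloosterman sums (bounded for prime moduli by Stepanov's method along a tower
   of quadratic extensions, trivially for prime powers) show that a box of area much larger
   than t m^(3/2) contains a point of the hyperbola, so P lies in one of O(log m) rectangles
   of area about t m^(3/2).  Cut such a rectangle into J strips by the abscissa and by the
   slope of the support line: in each of O(J) cells the vertices span triangles of area
   O(t m^(3/2) / J^3), less than (m/t)^(1/4) once J is about t m^(5/12).  The conic through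
   five vertices of a cell then takes values less than m, and divisible by m, at the other
   vertices of the cell, so it contains them; it is not a parabola since otherwise the
   kernel m/t would divide a small nonzero integer.  A divisor bound for Pell equations
   leaves m^o(1) points on it. *)

(* The exponent comes from two sizes: areas of about [m ^ (3/2) / J ^ 3] must fit under [m ^ (1/4)],
   so [J] is about [m ^ (5/12)]. The fourth root appears because the equation of the conic is a
   difference of two products of four brackets. Modulo a composite [m] there are zero divisors, so
   five points do not determine a conic up to a scalar. That [m] divides its values and its square
   coefficients is read off explicit polynomial identities instead. Likewise, when [m] divides the
   square of the cross coefficient, only the kernel of [m] divides the coefficient itself; this is
   how the kernel enters the bound on areas. Stepanov's method alone leaves an error whose constant
   depends on [p], but not on the height of the tower. Each step up the tower squares the normalised
   Frobenius eigenvalues, so an eigenvalue off the unit circle would make the normalised sums grow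
   without bound. The tower thus removes the constant. *)
Require Import Defs.
From HB Require Import structures.
From mathcomp Require Import all_boot all_order all_algebra all_field.
From mathcomp Require Import finmap.
From mathcomp Require Import all_classical all_reals all_analysis.
From mathcomp Require Import zify ring lra.

Set Implicit Arguments.
Unset Strict Implicit.
Unset Printing Implicit Defensive.

Import Order.TTheory GRing.Theory Num.Theory.

Local Open Scope ring_scope.

(** * Stepanov's method for [y ^ p - y = x + a / x - b] *)

Section WeightedPolynomials.
Variables (F : fieldType) (p : nat).
Hypothesis p_gt0 : (0 < p)%N.

(* The weight of [x ^ i z ^ j] is [p i + (p + 1) j], the pole order at infinity of
   [x ^ i z ^ j] on the curve, where [x = t ^ p] and [z = t ^ (p + 1)] to leading order. *)
Definition weight_le (n : nat) (P : {poly {poly F}}) :=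
  forall i j, (n < p * i + p.+1 * j)%N -> P`_j`_i = 0.

(** The substitution [x = t ^ p], [z = t ^ (p + 1)]. For [P] of weight at most [n], the coefficient
    of [t ^ n] is the leading coefficient of [P] at infinity. *)
Definition weight_subst (P : {poly {poly F}}) : {poly F} :=
  (map_poly (comp_poly 'X^p) P).['X^(p.+1)].

Lemma weight_leW n m P : (n <= m)%N -> weight_le n P -> weight_le m P.
Proof. by move=> nm H i j h; apply: H; apply: leq_ltn_trans h. Qed.

Lemma weight_le0 n : weight_le n 0.
Proof. by move=> i j _; rewrite !coef0. Qed.

Lemma weight_leB n P Q : weight_le n P -> weight_le n Q -> weight_le n (P - Q).
Proof. by move=> HP HQ i j h; rewrite !coefB HP ?HQ ?subrr. Qed.

Lemma weight_le_sum n (I : finType) (f : I -> {poly {poly F}}) :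
  (forall i, weight_le n (f i)) -> weight_le n (\sum_i f i).
Proof.
move=> H i j h; rewrite coef_sum coef_sum big1 // => u _; exact: H.
Qed.

Lemma weight_leZ n (c : F) P : weight_le n P -> weight_le n (c%:P *: P).
Proof. by move=> H i j h; rewrite coefZ coefCM H ?mulr0. Qed.

Lemma weight_leM n m P Q :
  weight_le n P -> weight_le m Q -> weight_le (n + m) (P * Q).
Proof.
move=> HP HQ i j h; rewrite coefM coef_sum big1 // => [[a /= ha] _].
rewrite coefM big1 // => [[b /= hb] _].
have [h1|h1] := ltnP n (p * b + p.+1 * a); first by rewrite HP ?mul0r.
rewrite (HQ (i - b)%N (j - a)%N) ?mulr0 //.
have e1 : (p * i = p * b + p * (i - b))%N by rewrite -mulnDr subnKC.
have e2 : (p.+1 * j = p.+1 * a + p.+1 * (j - a))%N by rewrite -mulnDr subnKC.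
by lia.
Qed.

Lemma weight_le_exp n P k : weight_le n P -> weight_le (n * k) (P ^+ k).
Proof.
move=> HP; elim: k => [|k IH]; last by rewrite mulnS exprS; apply: weight_leM.
rewrite muln0 expr0 => i j h; rewrite coef1; case: j h => [|j] h /=; last by rewrite coef0.
by rewrite coef1; case: i h => // h; lia.
Qed.

Lemma weight_le_mono i j : weight_le (p * i + p.+1 * j) (('X^i)%:P * 'X^j).
Proof.
move=> i' j' h; rewrite coefCM coefXn.
have [ej|_] := eqVneq j' j; last by rewrite mulr0 coef0.
rewrite mulr1 coefXn; have [ei|//] := eqVneq i' i; by rewrite ej ei ltnn in h.
Qed.

Lemma weight_substM P Q : weight_subst (P * Q) = weight_subst P * weight_subst Q.
Proof. by rewrite /weight_subst rmorphM hornerM. Qed.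

Lemma weight_substB P Q : weight_subst (P - Q) = weight_subst P - weight_subst Q.
Proof. by rewrite /weight_subst rmorphB hornerD hornerN. Qed.

Lemma weight_substXn P k : weight_subst (P ^+ k) = weight_subst P ^+ k.
Proof. by rewrite /weight_subst rmorphXn horner_exp. Qed.

Lemma weight_substZ c P : weight_subst (c%:P *: P) = c *: weight_subst P.
Proof.
rewrite -(mul_polyC c%:P P) weight_substM {1}/weight_subst map_polyC hornerC /= comp_polyC.
by rewrite mul_polyC.
Qed.

Lemma weight_subst_sum (I : finType) (f : I -> {poly {poly F}}) :
  weight_subst (\sum_i f i) = \sum_i weight_subst (f i).
Proof. by rewrite /weight_subst rmorph_sum /= horner_sum. Qed.

Lemma weight_subst_mono i j :
  weight_subst (('X^i)%:P * 'X^j) = 'X^(p * i + p.+1 * j).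
Proof.
rewrite weight_substM /weight_subst map_polyC hornerC map_polyXn hornerXn /=.
by rewrite comp_Xn_poly -!exprM exprD mulnC.
Qed.

Lemma size_weight_subst n P : weight_le n P -> (size (weight_subst P) <= n.+1)%N.
Proof.
move=> H; rewrite /weight_subst horner_coef.
apply: (leq_trans (size_sum _ _ _)); apply/bigmax_leqP => j _.
rewrite coef_map /= comp_polyE mulr_suml.
apply: (leq_trans (size_sum _ _ _)); apply/bigmax_leqP => i _.
have [h|h] := ltnP n (p * i + p.+1 * j); first by rewrite H // scale0r mul0r size_poly0.
rewrite -scalerAl -!exprM -exprD; apply: leq_trans (size_scale_leq _ _) _.
by rewrite size_polyXn ltnS.
Qed.

Lemma coef_mul_top n m (P Q : {poly F}) : (size P <= n.+1)%N -> (size Q <= m.+1)%N ->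
  (P * Q)`_(n + m) = P`_n * Q`_m.
Proof.
move=> HP HQ; rewrite coefM.
have hn : (n < (n + m).+1)%N by lia.
rewrite (bigD1 (Ordinal hn)) //= big1 ?addr0 ?addKn // => [[i /= hi]] ne.
have {}ne : i != n by [].
have [h|h] := ltnP n i; first by rewrite nth_default ?mul0r //; apply: leq_trans HP _.
by rewrite [X in _ * X]nth_default ?mulr0 //; apply: leq_trans HQ _; lia.
Qed.

(** Division by [mu] in [z] preserves the pole order and the leading coefficient at infinity: the
    top terms of [mu] cancel under the substitution, so a multiple of [mu] of weight at most [n]
    contributes nothing to [t ^ n]. *)
Lemma weight_reduction (mu : {poly {poly F}}) n P :
    weight_le (p * p.+1) mu -> mu \is monic -> size mu = p.+1 ->
    (weight_subst mu)`_(p * p.+1) = 0 -> weight_le n P ->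
  exists R G, [/\ P = G * mu + R, weight_le n R, (size R <= p)%N &
     (weight_subst R)`_n = (weight_subst P)`_n].
Proof.
move=> wmu mon smu tmu; have [k] := ubnP (size P).
elim: k P => // k IH P sP wP.
have [hs|hs] := leqP (size P) p.
  by exists P, 0; rewrite mul0r add0r.
set d := (size P).-1.
have hd : (p <= d)%N by rewrite /d; lia.
have Pd0 : P`_d != 0 by rewrite -[P`_d]/(lead_coef P) lead_coef_eq0 -size_poly_gt0; lia.
have pp : (p.+1 * d = p * p.+1 + p.+1 * (d - p))%N.
  by rewrite -{1}(subnKC hd) mulnDr mulnC.
have [i0 Pi0] : exists i0, P`_d`_i0 != 0.
  by exists (size P`_d).-1; rewrite -[_`__]/(lead_coef _) lead_coef_eq0.
have hn : (p * p.+1 <= n)%N.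
  rewrite leqNgt; apply: contra Pi0 => hn; apply/eqP/wP; rewrite pp.
  exact: leq_trans hn (leq_trans (leq_addr _ _) (leq_addl _ _)).
pose G := (P`_d)%:P * 'X^(d - p) : {poly {poly F}}.
have wG : weight_le (n - p * p.+1) G.
  move=> i j h; rewrite coefCM coefXn.
  have [ej|_] := eqVneq j (d - p)%N; last by rewrite mulr0 coef0.
  by rewrite mulr1 wP //; rewrite ej in h; lia.
have wGm : weight_le n (G * mu) by rewrite -(subnK hn); apply: weight_leM.
have sG : size G = (d - p).+1.
  by rewrite /G mul_polyC size_scale // size_polyXn.
have sGm : size (G * mu) = size P.
  by rewrite size_Mmonic -?size_poly_gt0 ?sG // smu /d; lia.
have lGm : lead_coef (G * mu) = lead_coef P.
  by rewrite lead_coef_Mmonic // /G mul_polyC lead_coefZ lead_coefXn mulr1.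
have sP' : (size (P - G * mu)%R < k)%N.
  suff : (size (P - G * mu)%R < size P)%N by lia.
  have [->|nz] := eqVneq (P - G * mu) 0; first by rewrite size_poly0; lia.
  rewrite -ltnS -[X in (X < _)%N]prednK ?size_poly_gt0 // ltnS.
  have hle : (size (P - G * mu)%R <= size P)%N.
    by apply: leq_trans (size_polyD _ _) _; rewrite size_polyN sGm maxnn.
  rewrite prednK ?size_poly_gt0 // ltn_neqAle hle andbT.
  apply: contra nz => /eqP es; rewrite -lead_coef_eq0 lead_coefE es coefB.
  by rewrite -{2}sGm -!lead_coefE lGm subrr.
have [R [G' [e wR sR tR]]] := IH _ sP' (weight_leB wP wGm).
exists R, (G + G'); split => //; first by rewrite mulrDl -addrA -e addrC subrK.
rewrite tR weight_substB weight_substM coefB -{2}(subnK hn).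
by rewrite coef_mul_top ?tmu ?mulr0 ?subr0 //; apply: size_weight_subst.
Qed.

(** The weight [p i + (p + 1) j] is congruent to [j] modulo [p], so [j < p] forces [j = s %% p]. The
    subtraction is not truncated as soon as [p * p <= s]. *)
Definition weight_mono (s : nat) : {poly {poly F}} :=
  ('X^((s - p.+1 * (s %% p)) %/ p))%:P * 'X^(s %% p).

Lemma weight_mono_eq s : (p * p <= s)%N ->
  (p * ((s - p.+1 * (s %% p)) %/ p) + p.+1 * (s %% p) = s)%N.
Proof.
move=> hs; have h := ltn_pmod s p_gt0.
have h2 : (p.+1 * (s %% p) <= s)%N.
  apply: leq_trans hs; have : (p.+1 * (s %% p) <= p.+1 * p.-1)%N by rewrite leq_mul2l; lia.
  by move=> H; apply: leq_trans H _; case: (p) p_gt0 => // q _ /=; nia.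
rewrite mulnC divnK ?subnK //.
have e := divn_eq s p.
rewrite {1}e mulSnr subnDr.
by apply: dvdn_sub; [apply: dvdn_mull | apply: dvdn_mulr].
Qed.

Lemma weight_le_wmono s : (p * p <= s)%N -> weight_le s (weight_mono s).
Proof. by move=> hs; rewrite -{1}(weight_mono_eq hs); apply: weight_le_mono. Qed.

Lemma weight_subst_wmono s : (p * p <= s)%N -> weight_subst (weight_mono s) = 'X^s.
Proof. by move=> hs; rewrite weight_subst_mono weight_mono_eq. Qed.

End WeightedPolynomials.

(** * The auxiliary function and the point count on the Artin-Schreier curve *)

Section Stepanov.
Variables (E : finFieldType) (p k : nat) (a b : E).
Hypothesis char_p : p \in [pchar E].
Hypothesis card_E : #|E| = ((p ^ k) ^ 2)%N.

Let Q := (p ^ k)%N.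
Let p_pr : prime p := pcharf_prime char_p.
Let p_gt1 : (1 < p)%N := prime_gt1 p_pr.
Let p_gt0 : (0 < p)%N := prime_gt0 p_pr.

Let c0 : {poly E} := 'X^(p.+1) - b *: 'X^p + a *: 'X^(p.-1).
(* The equation satisfied by [z = x y] when [y ^ p - y = x + a / x - b]. *)
Let mu : {poly {poly E}} := 'X^p - (('X^(p.-1))%:P * 'X + c0%:P).

Lemma Q_gt1 : (1 < Q)%N.
Proof.
have : (1 < #|E|)%N by rewrite (cardD1 0) (cardD1 1) !inE oner_eq0.
by rewrite card_E -/Q; case: (Q) => [|[|n]].
Qed.

Lemma expQ_sum (I : finType) (f : I -> E) : (\sum_i f i) ^+ Q = \sum_i f i ^+ Q.
Proof.
have natQ : [pchar E].-nat Q by rewrite (eq_pnat _ (pcharf_eq char_p)) pnatX pnat_id.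
elim/big_rec2: _ => [|i y1 y2 _ IH]; first by rewrite expr0n; have := Q_gt1; case: (Q).
by rewrite exprDn_pchar // IH.
Qed.

Lemma expQQ (x : E) : x ^+ Q ^+ Q = x.
Proof. by rewrite -exprM -[RHS]expf_card card_E -/Q mulnn. Qed.

Lemma size_mu_tail : (size (('X^(p.-1))%:P * 'X + c0%:P : {poly {poly E}})%R <= 2)%N.
Proof.
apply: leq_trans (size_polyD _ _) _; rewrite geq_max.
rewrite mul_polyC (leq_trans (size_scale_leq _ _)) ?size_polyX //.
by apply: leq_trans (size_polyC_leq1 _) _.
Qed.

Lemma size_mu : size mu = p.+1.
Proof.
rewrite /mu size_polyDl ?size_polyXn // size_polyN.
by apply: leq_ltn_trans size_mu_tail _.
Qed.

Lemma monic_mu : mu \is monic.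
Proof.
rewrite monicE /mu lead_coefDl ?lead_coefXn // size_polyXn size_polyN.
by apply: leq_ltn_trans size_mu_tail _.
Qed.

Lemma weight_le_mu : weight_le p (p * p.+1) mu.
Proof.
apply: weight_leB.
  have := @weight_le_mono E p 0 p; rewrite expr0 mul1r muln0 add0n mulnC; exact.
have pm : (p.+1 * 1 <= p * p.+1)%N by rewrite mulnC leq_mul2r p_gt0 orbT.
move=> i j h; rewrite coefD coefCM coefX coefC.
have [j1|j1] := eqVneq j 1%N.
  rewrite j1 /= mulr1 addr0 coefXn; case: eqP => // ei; exfalso.
  by move: h; rewrite j1 ei; move: p_gt1; case: (p) => [//|q] hq /=; lia.
rewrite mulr0 add0r; have [j0|//] := eqVneq j 0%N; last by rewrite coef0.
move: h; rewrite j0 muln0 addn0 ltn_pmul2l // => h.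
rewrite /c0 coefD coefB !coefZ !coefXn.
by rewrite !gtn_eqF ?mulr0 ?subr0 ?addr0 //; lia.
Qed.

Lemma weight_subst_mu : (weight_subst p mu)`_(p * p.+1) = 0.
Proof.
have e0 : 'X^p = ('X^0)%:P * 'X^p :> {poly {poly E}} by rewrite expr0 mul1r.
have e1 : ('X^(p.-1))%:P * 'X = ('X^(p.-1))%:P * 'X^1 :> {poly {poly E}} by [].
have e2 : weight_subst p (c0%:P) = 'X^(p * p.+1) - b *: 'X^(p * p) + a *: 'X^(p * p.-1).
  rewrite /weight_subst map_polyC hornerC /= /c0 comp_polyD comp_polyB !comp_polyZ.
  by rewrite !comp_Xn_poly -!exprM.
have e3 P R : weight_subst p (P + R) = weight_subst p P + weight_subst p R.
  by rewrite /weight_subst rmorphD hornerD.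
rewrite /mu weight_substB e3 e2 e1 {1}e0 !weight_subst_mono.
have q1 : (p * p.+1 == p * p.-1 + p.+1 * 1)%N = false.
  by apply/eqP; move: p_gt1; case: (p) => [//|q] hq /=; nia.
have q2 : (p * p.+1 == p * p)%N = false by rewrite eqn_pmul2l //; apply/eqP; lia.
have q3 : (p * p.+1 == p * p.-1)%N = false by rewrite eqn_pmul2l //; apply/eqP; lia.
rewrite !(coefB, coefN, coefD, coefZ, coefXn) q1 q2 q3 muln0 add0n mulnC eqxx.
by rewrite !mulr0 subr0 addr0 add0r subrr.
Qed.

(** [N] bounds the weight of the functions [G u] below, [p * N'] counts the coefficients of a
    reduced function of that weight, and [M * Q] is the number of unknowns. The excess
    [3 * p ^ 2 + p + 3] makes the unknowns win already for [Q = 2]. From the weight [g] on, every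
    weight is attained by a monomial. *)
Let M := (Q + (3 * p ^ 2 + p + 3))%N.
Let g := (p * p)%N.
Let N := ((g + Q) * Q + (g + M))%N.
Let N' := (N %/ p).+1.

Lemma unknowns_gt : (p * N' < M * Q)%N.
Proof.
have h : (p * (N %/ p) <= N)%N by rewrite mulnC leq_trunc_div.
rewrite /N' mulnS; apply: leq_ltn_trans (leq_add (leqnn _) h) _.
rewrite /N /M /g; have := Q_gt1; have := p_gt1; nia.
Qed.

Definition ev (x z : E) (P : {poly {poly E}}) := P.[z%:P].[x].

Lemma evD x z P R : ev x z (P + R) = ev x z P + ev x z R.
Proof. by rewrite /ev !hornerD. Qed.

Lemma evM x z P R : ev x z (P * R) = ev x z P * ev x z R.
Proof. by rewrite /ev !hornerM. Qed.

Lemma evXn x z P n : ev x z (P ^+ n) = ev x z P ^+ n.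
Proof. by rewrite /ev !horner_exp. Qed.

Lemma evZ x z (c : E) P : ev x z (c%:P *: P) = c * ev x z P.
Proof. by rewrite /ev !hornerZ hornerM hornerC. Qed.

Lemma ev_sum x z (I : finType) (f : I -> {poly {poly E}}) :
  ev x z (\sum_i f i) = \sum_i ev x z (f i).
Proof. by rewrite /ev !horner_sum. Qed.

Lemma ev_mu x y : x != 0 -> y ^+ p - y = x + a / x - b -> ev x (x * y) mu = 0.
Proof.
move=> x0 hy; rewrite /ev /mu /c0 !hornerE.
have {}hy : y ^+ p = y + x + a / x - b.
  by rewrite -[LHS](subrK y) hy; ring.
rewrite exprMn hy; have := p_gt0; case: (p) => // n _; rewrite !exprS /=.
by field.
Qed.

(* The family [lo (g + s) * lo (g + r) ^ Q], indexed by [u = r Q + s], has the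
   pairwise distinct weights [g + g Q + u]. *)
Let lo := @weight_mono E p.
Let prod_s (u : 'I_(M * Q)) := (g + u %% Q)%N.
Let prod_r (u : 'I_(M * Q)) := (g + u %/ Q)%N.
Let H (u : 'I_(M * Q)) := lo (prod_s u) * lo (prod_r u) ^+ Q.
Let G (u : 'I_(M * Q)) := lo (prod_s u) ^+ Q * lo (prod_r u).

Lemma G_reduction : exists R : 'I_(M * Q) -> {poly {poly E}},
  forall u, [/\ exists T, G u = T * mu + R u, weight_le p N (R u) & (size (R u) <= p)%N].
Proof.
have Q0 : (0 < Q)%N := ltnW Q_gt1.

have K u : exists R, [/\ exists T, G u = T * mu + R, weight_le p N R & (size R <= p)%N].
  have wG : weight_le p N (G u).
    apply: (@weight_leW _ _ (prod_s u * Q + prod_r u)).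
      rewrite /N leq_add //; first by rewrite leq_mul2r leq_add2l (ltnW (ltn_pmod _ _)) ?orbT.
      by rewrite leq_add2l ltnW // ltn_divLR.
    apply: (weight_leM p_gt0); last by apply: (weight_le_wmono E p_gt0); rewrite ?leq_addr.
    by apply: (weight_le_exp p_gt0); apply: (weight_le_wmono E p_gt0); rewrite ?leq_addr.
  have [R [T [e wR sR _]]] := weight_reduction p_gt0 weight_le_mu monic_mu size_mu weight_subst_mu wG.
  by exists R; split=> //; exists T.
have [f Hf] := fin_all_exists K.
by exists f.
Qed.

(** There are more unknowns than coefficients. The solution is written with [Q]-th powers, which is
    possible because [x ^ Q ^ Q = x] on [E]; it then reads as the [Q]-th power of a combination of
    the [H u] at rational points. *)
Lemma stepanov_relation : exists c : 'I_(M * Q) -> E, (exists u, c u != 0) /\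
  exists T, \sum_u (c u ^+ Q)%:P *: G u = T * mu.
Proof.
have [R HR] := G_reduction.
pose A := \matrix_(u < M * Q) mxvec (\matrix_(j < p, i < N') (R u)`_j`_i).
have : kermx A != 0.
  rewrite kermx_eq0; apply: contraL unknowns_gt; rewrite -leqNgt => /eqP <-.
  exact: rank_leq_col.
case/rowV0Pn => d /sub_kermxP dA /rV0Pn[u0 du0].
exists (fun u => d 0 u ^+ Q); split; first by exists u0; rewrite expf_neq0.
have -> : \sum_u ((d 0 u ^+ Q) ^+ Q)%:P *: G u = \sum_u (d 0 u)%:P *: G u.
  by apply: eq_bigr => u _; rewrite expQQ.
have R0 : \sum_u (d 0 u)%:P *: R u = 0.
  apply/polyP => j; apply/polyP => i; rewrite !coef0.
  have [jp|jp] := ltnP j p; last first.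
    rewrite coef_sum coef_sum big1 // => u _; have [_ _ sR] := HR u.
    by rewrite coefZ coefCM [(R u)`_j]nth_default ?coef0 ?mulr0 // (leq_trans sR).
  have [iN|iN] := ltnP i N'; last first.
    rewrite coef_sum coef_sum big1 // => u _; have [_ wR _] := HR u.
    rewrite coefZ coefCM wR ?mulr0 //; apply: leq_trans (leq_addr _ _).
    by rewrite mulnC -ltn_divLR.
  have /matrixP/(_ 0 (mxvec_index (Ordinal jp) (Ordinal iN))) := dA.
  rewrite !mxE => dA_ij; rewrite -[RHS]dA_ij coef_sum coef_sum; apply: eq_bigr => u _.
  by rewrite coefZ coefCM mxE mxvecE mxE.
have K u : exists T, G u = T * mu + R u by case: (HR u).
have [T HT] := fin_all_exists K.
exists (\sum_u (d 0 u)%:P *: T u).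
transitivity (\sum_u ((d 0 u)%:P *: T u * mu + (d 0 u)%:P *: R u)).
  by apply: eq_bigr => u _; rewrite HT scalerDr scalerAl.
by rewrite big_split /= R0 addr0 mulr_suml.
Qed.

(** At a rational point [H u ^ Q = G u], so the combination [h] of the [H u] vanishes there. It is
    not zero on the curve, since the [H u] have distinct pole orders, and its weight, about [Q ^ 2],
    bounds its zeros. *)
Lemma stepanov_bound :
  (p * #|[set x : E | (x != 0%R) && [exists y : E, (y ^+ p - y == x + a / x - b)%R]]|
     <= Q ^ 2 + (5 * p ^ 2 + p + 3) * Q)%N.
Proof.
have Q0 : (0 < Q)%N := ltnW Q_gt1.
have [c [[u1 cu1] [T HT]]] := stepanov_relation.
pose h := \sum_u (c u)%:P *: H u.
have [u0 cu0 max_u0] : exists2 u0, c u0 != 0 & forall u, c u != 0 -> (u <= u0)%N.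
  exists [arg max_(u > u1 | c u != 0) (u : nat)]; case: arg_maxnP => //.
pose n0 := (g + g * Q + u0)%N.
have wH (u : 'I_(M * Q)) : weight_le p (g + g * Q + u) (H u).
  have -> : (g + g * Q + u = prod_s u + prod_r u * Q)%N.
    by rewrite {1}(divn_eq u Q) /prod_s /prod_r mulnDl; lia.
  apply: (weight_leM p_gt0); first by apply: (weight_le_wmono E p_gt0); rewrite ?leq_addr.
  by apply: (weight_le_exp p_gt0); apply: (weight_le_wmono E p_gt0); rewrite ?leq_addr.
have tH (u : 'I_(M * Q)) : weight_subst p (H u) = 'X^(g + g * Q + u).
  rewrite weight_substM weight_substXn !(weight_subst_wmono E p_gt0) ?leq_addr // -exprM -exprD.
  by congr ('X^ _); rewrite [in RHS](divn_eq u Q) /prod_s /prod_r mulnDl; lia.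
have wh : weight_le p n0 h.
  apply: weight_le_sum => u; have [->|cu] := eqVneq (c u) 0.
    by rewrite scale0r; apply: weight_le0.
  by apply: weight_leZ; apply: weight_leW (wH u); rewrite leq_add2l max_u0.
(* [u0] is the largest index in use, so no other term reaches [t ^ n0]. *)
have th : (weight_subst p h)`_n0 != 0.
  rewrite weight_subst_sum coef_sum (bigD1 u0) //= big1 ?addr0.
    by rewrite weight_substZ tH coefZ coefXn eqxx mulr1.
  move=> u ne; rewrite weight_substZ tH coefZ coefXn /n0 eqn_add2l.
  by rewrite (inj_eq val_inj) eq_sym (negPf ne) mulr0.
have [R [T' [e wR sR tR]]] := weight_reduction p_gt0 weight_le_mu monic_mu size_mu weight_subst_mu wh.
have R0 : R != 0.
  by apply: contraNneq th => R0; rewrite -tR R0 /weight_subst rmorph0 horner0 coef0.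
have [j Rj0] : exists j, R`_j != 0.
  by exists (size R).-1; rewrite -[_`__]/(lead_coef _) lead_coef_eq0.
set S := [set x | _].
have root_S x : x \in S -> root R`_j x.
  rewrite inE => /andP[x0 /existsP[y /eqP hy]].
  have zero_y y' : y' ^+ p - y' = x + a / x - b -> ev x (x * y') R = 0.
    move=> hy'; have mu0 := ev_mu x0 hy'; set z := x * y' in mu0 *.
    have -> : ev x z R = ev x z h by rewrite e evD evM mu0 mulr0 add0r.
    apply/eqP; have : (ev x z h) ^+ Q == 0; last by rewrite expf_eq0 Q0.
    have -> : (ev x z h) ^+ Q = ev x z (\sum_u (c u ^+ Q)%:P *: G u).
      rewrite !ev_sum expQ_sum; apply: eq_bigr => u _.
      rewrite !evZ /H /G; move: (lo (prod_s u)) (lo (prod_r u)) => l1 l2.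
      by rewrite !evM !evXn !exprMn expQQ.
    by rewrite HT evM mu0 mulr0.
  (* Above [x] lie the points [y + i] with [i] in the prime field: [p] roots for a polynomial of
     degree below [p] in [z], so all its coefficients vanish at [x]. *)
  pose Rx := map_poly (horner_eval x) R.
  have Rx0 : Rx = 0.
    apply: (@roots_geq_poly_eq0 _ _ [seq x * (y + i%:R) | i <- iota 0 p]).
    - apply/allP => _ /mapP[i _ ->]; rewrite /root /Rx.
      have -> : (map_poly (horner_eval x) R).[x * (y + i%:R)] = ev x (x * (y + i%:R)) R.
        rewrite /ev -[in LHS](hornerC (x * (y + i%:R)) x) -[(_%:P).[x]]/(horner_eval x _).
        by rewrite horner_map.
      rewrite zero_y // -hy.
      have := @pFrobenius_autD_comm E p char_p y i%:R (mulrC _ _).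
      rewrite !pFrobenius_autE => ->; rewrite -!pFrobenius_autE rmorph_nat.
      by rewrite opprD addrACA subrr addr0.
    - rewrite map_inj_in_uniq ?iota_uniq // => i i'.
      rewrite !mem_iota !add0n /= => hi hi' /(mulfI x0) /addrI.
      have wlog_le (u v : nat) : (u <= v)%N -> (v < p)%N -> u%:R = v%:R :> E -> u = v.
        move=> uv vp /eqP; rewrite eq_sym -subr_eq0 -natrB // -(dvdn_pcharf char_p).
        move=> dv; apply/eqP; rewrite eqn_leq uv -subn_eq0 /=.
        by apply: contraTT dv; rewrite -lt0n => d0; rewrite gtnNdvd //; lia.
      case/orP: (leq_total i i') => ii E1; first exact: wlog_le.
      by apply/esym; apply: wlog_le.
    - by rewrite size_map size_iota; apply: leq_trans (size_poly _ _) sR.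
  have := coef_map (horner_eval x) R j; rewrite -/Rx Rx0 coef0 => /esym hx.
  by rewrite /root -[_.[x]]/(horner_eval x _) hx.
have cS : (#|S| < size (R`_j)%R)%N.
  have -> : #|S| = size (enum S) by rewrite cardE.
  apply: max_poly_roots => //; last by rewrite enum_uniq.
  by apply/allP => x; rewrite mem_enum; apply: root_S.
(* In weight, [x] counts for [p]; this is the source of the factor [p] in the bound. *)
have dR : (p * (size (R`_j)%R).-1 <= n0)%N.
  rewrite leqNgt; apply/negP => hlt.
  have : R`_j`_((size (R`_j)%R).-1) = 0 by apply: wR; apply: leq_trans hlt (leq_addr _ _).
  by apply/eqP; rewrite -[_`__]/(lead_coef _) lead_coef_eq0.
have : (p * #|S| <= n0)%N by apply: leq_trans dR; rewrite leq_mul2l; apply/orP; right; lia.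
move/leq_trans; apply; rewrite /n0 /g; have := ltn_ord u0; rewrite /M.
have : (p * p <= p * p * Q)%N by rewrite leq_pmulr.
move: (nat_of_ord u0) (p * p)%N (mulnn p) => u pp epp h1 h2; rewrite -epp in h1 *.
by rewrite -!mulnn in h1 *; lia.
Qed.

End Stepanov.

Lemma partition_big_count (T U : finType) (C : pzSemiRingType) (P : pred T) (D : pred U)
    (h : T -> U) (G : U -> C) : (forall t, P t -> D (h t)) ->
  \sum_(t | P t) G (h t) = \sum_(u | D u) (#|[pred t | P t & h t == u]|)%:R * G u.
Proof.
move=> PD; rewrite (partition_big h D) //; apply: eq_bigr => u _.
rewrite (eq_bigr (fun=> G u)); last by move=> t /andP[_ /eqP->].
by rewrite sumr_const mulr_natl.
Qed.

(** * Kloosterman sums *)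

Section FrobeniusTower.
Variables (E : finFieldType) (p K : nat).
Hypothesis char_p : p \in [pchar E].
Hypothesis card_E : #|E| = (p ^ (2 ^ K))%N.

Let p_pr : prime p := pcharf_prime char_p.
Let p_gt1 : (1 < p)%N := prime_gt1 p_pr.
Let p_gt0 : (0 < p)%N := prime_gt0 p_pr.

(** For [k <= K], [level k] is the subfield with [p ^ 2 ^ k] elements and [ltrace k] its trace to
    the prime field. *)
Definition level (k : nat) (x : E) : bool := x ^+ (p ^ 2 ^ k) == x.
Definition ltrace (k : nat) (x : E) : E := \sum_(i < 2 ^ k) x ^+ (p ^ i).

Lemma frobD n (x y : E) : (x + y) ^+ (p ^ n) = x ^+ (p ^ n) + y ^+ (p ^ n).
Proof.
apply: exprDn_pchar; by rewrite (eq_pnat _ (pcharf_eq char_p)) pnatX pnat_id.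
Qed.

Lemma frob0 n : (0 : E) ^+ (p ^ n) = 0.
Proof. by rewrite expr0n expn_eq0 -leqn0 leqNgt p_gt0. Qed.

Lemma frobN n (x : E) : (- x) ^+ (p ^ n) = - x ^+ (p ^ n).
Proof. by apply/eqP; rewrite -subr_eq0 opprK -frobD addNr frob0. Qed.

Lemma frob_sum n (I : Type) (r : seq I) (P : pred I) (f : I -> E) :
  (\sum_(i <- r | P i) f i) ^+ (p ^ n) = \sum_(i <- r | P i) f i ^+ (p ^ n).
Proof. by elim/big_rec2: _ => [|i y1 y2 _ <-]; rewrite ?frob0 ?frobD. Qed.

Lemma level0 k : level k 0. Proof. by rewrite /level frob0. Qed.
Lemma level1 k : level k 1. Proof. by rewrite /level expr1n. Qed.
Lemma levelD k x y : level k x -> level k y -> level k (x + y).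
Proof. by rewrite /level frobD => /eqP-> /eqP->. Qed.
Lemma levelN k x : level k x -> level k (- x).
Proof. by rewrite /level frobN => /eqP->. Qed.
Lemma levelM k x y : level k x -> level k y -> level k (x * y).
Proof. by rewrite /level exprMn => /eqP-> /eqP->. Qed.
Lemma levelV k x : level k x -> level k x^-1.
Proof. by rewrite /level exprVn => /eqP->. Qed.
Lemma level_nat k n : level k n%:R.
Proof. by elim: n => [|n IH]; rewrite ?level0 // -natr1 levelD ?level1. Qed.

Lemma levelS k x : level k x -> level k.+1 x.
Proof.
by rewrite /level expnS mul2n -addnn expnD exprM => /eqP H; rewrite !H.
Qed.

Lemma level_le k l x : (k <= l)%N -> level k x -> level l x.
Proof. by move=> /subnK <-; elim: (l - k)%N => // n IH /IH; apply: levelS. Qed.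

Lemma level_frobK k x : level k.+1 x -> (x ^+ (p ^ 2 ^ k)) ^+ (p ^ 2 ^ k) = x.
Proof. by rewrite /level -exprM -expnD addnn -mul2n -expnS => /eqP. Qed.

Lemma ltraceD k x y : ltrace k (x + y) = ltrace k x + ltrace k y.
Proof. by rewrite -big_split; apply: eq_bigr => i _; rewrite frobD. Qed.

Lemma ltrace0 k : ltrace k 0 = 0.
Proof. by rewrite /ltrace big1 // => i _; rewrite frob0. Qed.

Lemma ltraceN k x : ltrace k (- x) = - ltrace k x.
Proof. by apply/eqP; rewrite -subr_eq0 opprK -ltraceD addNr ltrace0. Qed.

(** Transitivity of the trace: the argument on the right is the relative trace from [level k.+1]. *)
Lemma ltraceS k x : ltrace k.+1 x = ltrace k (x + x ^+ (p ^ 2 ^ k)).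
Proof.
rewrite ltraceD /ltrace expnS mul2n -addnn big_split_ord /=; congr (_ + _).
by apply: eq_bigr => i _; rewrite -exprM -expnD.
Qed.

Lemma ltrace_level0 k x : level k x -> level 0 (ltrace k x).
Proof.
move=> /eqP hx; rewrite /level expn0 expn1.
have -> : ltrace k x ^+ p = \sum_(i < 2 ^ k) x ^+ (p ^ i.+1).
  have e1 (y : E) : y ^+ p = y ^+ (p ^ 1) by rewrite expn1.
  rewrite e1 frob_sum.
  by apply: eq_bigr => i _; rewrite -exprM -expnD addn1.
have h : (0 < 2 ^ k)%N by rewrite expn_gt0.
move: hx; rewrite /ltrace; case: (2 ^ k)%N h => // n _ hx.
by apply/eqP; rewrite [LHS]big_ord_recr [RHS]big_ord_recl /= hx expn0 expr1 [RHS]addrC.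
Qed.

Lemma level0_frob l n : level 0 l -> l ^+ (p ^ n) = l.
Proof.
rewrite /level expn0 expn1 => /eqP H; elim: n => [|n IH]; first by rewrite expn0 expr1.
by rewrite expnS exprM H.
Qed.

Lemma ltraceZ k l x : level 0 l -> ltrace k (l * x) = l * ltrace k x.
Proof.
by move=> hl; rewrite mulr_sumr; apply: eq_bigr => i _; rewrite exprMn (level0_frob _ hl).
Qed.

Lemma card_roots_le (P : {poly E}) (A : pred E) n : P != 0 -> (size P <= n.+1)%N ->
  (forall x, A x -> P.[x] = 0) -> (#|A| <= n)%N.
Proof.
move=> P0 sP H; rewrite -ltnS; apply: leq_trans sP; rewrite cardE.
apply: max_poly_roots => //; last exact: enum_uniq.
by apply/allP => x; rewrite mem_enum => /H h; apply/rootP.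
Qed.

Lemma card_frob_fiber_le n (e y : E) (A : pred E) : (0 < n)%N ->
  (forall x, A x -> x ^+ (p ^ n) + e * x = y) -> (#|A| <= p ^ n)%N.
Proof.
move=> n0 H; have pn : (1 < p ^ n)%N by rewrite -(expn0 p) ltn_exp2l.
have s2 : (size (e *: 'X - y%:P : {poly E})%R <= 2)%N.
  apply: leq_trans (size_polyD _ _) _; rewrite size_polyN geq_max.
  rewrite (leq_trans (size_scale_leq _ _)) ?size_polyX //.
  by apply: leq_trans (size_polyC_leq1 _) _.
have sz : size ('X^(p ^ n) + (e *: 'X - y%:P) : {poly E}) = (p ^ n).+1.
  by rewrite size_polyDl size_polyXn //; apply: leq_ltn_trans s2 _.
apply: (@card_roots_le ('X^(p ^ n) + (e *: 'X - y%:P))); rewrite -?size_poly_gt0 ?sz //.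
by move=> x /H h; rewrite hornerD hornerXn hornerD hornerZ hornerX hornerN hornerC addrA h subrr.
Qed.

Lemma card_level_le k : (#|level k| <= p ^ 2 ^ k)%N.
Proof.
apply: (@card_frob_fiber_le _ (-1) 0); rewrite ?expn_gt0 // => x /eqP->.
by rewrite mulN1r subrr.
Qed.

Lemma card_fibers_le (T U : finType) (f : T -> U) (A : pred T) (B : pred U) n :
  (forall x, A x -> B (f x)) -> (forall y, (#|[pred x | A x & f x == y]| <= n)%N) ->
  (#|A| <= #|B| * n)%N.
Proof.
move=> AB H; rewrite -sum1_card (partition_big f B) //= -sum_nat_const.
apply: leq_sum => y _; apply: leq_trans (H y); rewrite sum1_card.
by apply: eq_leq; apply: eq_card => x; rewrite !inE.
Qed.

(** Descent from the top. With [q = p ^ 2 ^ l], the map [x ^ q - x] on [level l.+1] has fibres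
    inside cosets of [level l] and takes values among the at most [q] roots of [y ^ q + y]; so
    [level l] has at least [q] elements. *)
Lemma card_level k : (k <= K)%N -> #|level k| = (p ^ 2 ^ k)%N.
Proof.
move=> kK; apply/eqP; rewrite eqn_leq card_level_le /=.
have -> : k = (K - (K - k))%N by rewrite subKn.
have : (K - k <= K)%N by lia.
elim: (K - k)%N => [|n IH] hn.
  rewrite subn0 -card_E; apply: subset_leq_card; apply/fintype.subsetP => x _.
  by rewrite unfold_in /level -card_E expf_card.
have {}IH := IH (ltnW hn); set l := (K - n.+1)%N.
have el : (K - n = l.+1)%N by rewrite /l; lia.
rewrite {}el in IH.
have q0 : (0 < p ^ 2 ^ l)%N by rewrite expn_gt0 p_gt0.
rewrite -(leq_pmul2l q0).
apply: (@leq_trans (#|[pred y : E | y ^+ (p ^ 2 ^ l) + 1 * y == 0%R]| * #|level l|)); last first.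
  by rewrite leq_mul2r (@card_frob_fiber_le _ 1 0) ?orbT ?expn_gt0 // => x /eqP.
apply: leq_trans (_ : #|level l.+1| <= _)%N.
  by apply: leq_trans IH; rewrite expnS mul2n -addnn expnD.
apply: (@card_fibers_le _ _ (fun x => x ^+ (p ^ 2 ^ l) - x)) => [x hx|y].
  by rewrite inE frobD frobN level_frobK //; apply/eqP; ring.
have [x0 /andP[_ /eqP y0]|none] := pickP [pred x | level l.+1 x & x ^+ (p ^ 2 ^ l) - x == y]; last first.
  by rewrite (fintype.eq_card0 none).
rewrite -(card_imset _ (addrI (- x0))); apply: subset_leq_card; apply/fintype.subsetP => z /imsetP[x].
rewrite inE => /andP[hx /eqP hy] ->; rewrite unfold_in /level frobD frobN.
by rewrite -subr_eq0; apply/eqP; rewrite -[RHS](subrr y) -{1}hy -y0; ring.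
Qed.

(** The trace is a polynomial of degree at most [p ^ (2 ^ k).-1] with linear coefficient 1, too
    small to vanish on [p ^ 2 ^ k] elements. *)
Lemma ltrace_neq0 k : (k <= K)%N -> exists2 x, level k x & ltrace k x != 0.
Proof.
move=> kK; have [x /andP[hx tx]|H] := pickP [pred x | level k x & ltrace k x != 0].
  by exists x.
exfalso.
have h2 : (0 < 2 ^ k)%N by rewrite expn_gt0.
pose P : {poly E} := \sum_(i < 2 ^ k) 'X^(p ^ i).
have cP : P`_1 = 1.
  rewrite /P coef_sum (bigD1 (Ordinal h2)) //= coefXn eqxx big1 ?addr0 // => i ne.
  rewrite coefXn -{1}(expn0 p) eqn_exp2l // (_ : (0 == i)%N = false) //.
  by apply: contraNF ne => /eqP e; apply/eqP/val_inj.
have P0 : P != 0 by apply: contra_eq_neq cP => ->; rewrite coef0 eq_sym oner_neq0.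
have sP : (size P <= (p ^ (2 ^ k).-1).+1)%N.
  apply: leq_trans (size_sum _ _ _) _; apply/bigmax_leqP => i _.
  by rewrite size_polyXn ltnS leq_exp2l // -ltnS prednK.
have := @card_roots_le P (level k) _ P0 sP _; rewrite card_level // => HH.
have : (p ^ 2 ^ k <= p ^ (2 ^ k).-1)%N.
  apply: HH => x hx; rewrite /P horner_sum.
  have /negbT := H x; rewrite /= hx negbK => /eqP tx; rewrite -[RHS]tx.
  by apply: eq_bigr => i _; rewrite hornerXn.
by rewrite leq_exp2l //; lia.
Qed.

Lemma ltrace_onto k u : (k <= K)%N -> level 0 u -> exists2 x, level k x & ltrace k x = u.
Proof.
move=> kK hu; have [x hx nz] := ltrace_neq0 kK.
exists (u / ltrace k x * x).
  by rewrite !levelM ?levelV // (@level_le 0) // ltrace_level0.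
by rewrite ltraceZ ?divfK // levelM ?levelV ?ltrace_level0.
Qed.

(** By counting: the image of [y ^ p - y] lies in the kernel of the trace and has at least
    [p ^ (2 ^ K).-1] elements, its fibres having at most [p]; the kernel has at most that many. *)
Lemma artin_schreier_ltrace u : ltrace K u = 0 -> exists y, y ^+ p - y = u.
Proof.
have allK x : level K x by rewrite /level -card_E expf_card.
move=> tu; apply/exists_eqP; move: tu => /eqP tu.
pose im := [set y ^+ p - y | y in E].
have e1 (y : E) : y ^+ p = y ^+ (p ^ 1) by rewrite expn1.
have im_ker : im \subset [pred x | ltrace K x == 0].
  apply/fintype.subsetP => _ /imsetP[y _ ->]; rewrite inE ltraceD ltraceN subr_eq0.
  have : ltrace K (y ^+ p) = ltrace K y ^+ p.
    rewrite [RHS]e1 frob_sum; apply: eq_bigr => i _.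
    by rewrite -!exprM expn1 mulnC.
  by have := ltrace_level0 (allK y); rewrite /level expn0 expn1 => /eqP-> ->.
have h2 : (0 < 2 ^ K)%N by rewrite expn_gt0.
have card_im : (p ^ (2 ^ K).-1 <= #|im|)%N.
  rewrite -(leq_pmul2r p_gt0) -expnSr prednK // -card_E.
  apply: (@card_fibers_le _ _ (fun y => y ^+ p - y)) => [y _|z]; first exact: imset_f.
  rewrite -[X in (_ <= X)%N]expn1; apply: (@card_frob_fiber_le _ (-1) z) => // y.
  by move=> /andP[_ /eqP <-]; rewrite expn1 mulN1r.
have card_ker : (#|[pred x | ltrace K x == 0%R]| <= p ^ (2 ^ K).-1)%N.
  have [x1 _ /eqP t1] := ltrace_onto (leqnn K) (level1 0).
  rewrite -(leq_pmul2r p_gt0) -expnSr prednK // -card_E.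
  have p_le : (p <= #|level 0|)%N by rewrite card_level // expn0 expn1.
  apply: leq_trans (_ : #|[pred x | ltrace K x == 0%R]| * #|level 0| <= _)%N.
    by rewrite leq_mul2l p_le orbT.
  rewrite -cardX -(@card_in_imset _ _ (fun u => u.1 + u.2 * x1)) ?max_card //.
  move=> [a b] [c d] /andP[/= /eqP ha hb] /andP[/= /eqP hc hd] e.
  have : ltrace K (a + b * x1) = ltrace K (c + d * x1) by rewrite e.
  rewrite !ltraceD !ltraceZ // ha hc (eqP t1) !add0r !mulr1 => bd.
  by move: e; rewrite bd => /addIr ->.
have : im =i [pred x | ltrace K x == 0].
  apply/subset_cardP => //; apply/eqP; rewrite eqn_leq subset_leq_card //=.
  exact: leq_trans card_im.
move/(_ u); rewrite inE tu => /imsetP[y _ ->]; by apply/existsP; exists y.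
Qed.

End FrobeniusTower.

(** * The recursion for Kloosterman sums along the tower *)

Section KloostermanDoubling.
Variables (E : finFieldType) (p K : nat).
Hypothesis char_p : p \in [pchar E].
Hypothesis card_E : #|E| = (p ^ (2 ^ K))%N.
Variables (psi : E -> algC) (a : E).
Hypothesis psiD : forall x y, level p 0 x -> level p 0 y -> psi (x + y) = psi x * psi y.
Hypothesis psi_norm : forall x, `|psi x| = 1.
Hypothesis a_level : level p 0 a.
Hypothesis a_neq0 : a != 0.

Definition ksum k : algC := \sum_(x | level p k x && (x != 0)) psi (ltrace p k (x + a / x)).

Lemma psi0 : psi 0 = 1.
Proof.
have nz : psi 0 != 0 by rewrite -normr_eq0 psi_norm oner_neq0.
apply: (mulfI nz); rewrite mulr1 -psiD ?addr0 //; exact: level0.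
Qed.

Lemma psi_conj x : level p 0 x -> (psi x)^* = psi (- x).
Proof.
move=> hx; have nz : psi x != 0 by rewrite -normr_eq0 psi_norm oner_neq0.
apply: (mulfI nz); rewrite -normCK psi_norm expr1n -psiD ?subrr ?psi0 //.
exact: levelN.
Qed.

Lemma a_levelk k : level p k a.
Proof. exact: (level_le (leq0n k) a_level). Qed.

(** Replacing [x] by [- x] conjugates every term. *)
Lemma ksum_real k : ksum k \is Num.real.
Proof.
apply/CrealP; rewrite /ksum rmorph_sum /=.
rewrite (reindex_inj (@oppr_inj E)) /=; apply: eq_big => [x|x].
  rewrite oppr_eq0; congr (_ && _); apply/idP/idP; last exact: levelN.
  by rewrite -{2}(opprK x); apply: levelN.
move=> /andP[hx x0]; rewrite psi_conj; last first.
  apply: ltrace_level0 => //; rewrite levelD // levelM ?levelV ?a_levelk //.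
by rewrite -ltraceN // invrN mulrN -opprD opprK.
Qed.

Lemma sum_psi_ltrace k c : (k <= K)%N -> level p k c -> (exists2 u, level p 0 u & psi u != 1) ->
  \sum_(s | level p k s) psi (ltrace p k (s * c)) = (if c == 0 then (p ^ 2 ^ k)%:R else 0).
Proof.
move=> kK hc [u hu psiu].
have [->|c0] := eqVneq c 0.
  rewrite (eq_bigr (fun=> 1)); last by move=> s _; rewrite mulr0 ltrace0 // psi0.
  by rewrite sumr_const (card_level char_p card_E kK).
have [x hx tx] := ltrace_onto char_p card_E kK hu.
set S := \sum_(s | _) _.
have hxc : level p k (x / c) by rewrite levelM ?levelV.
have : S = psi u * S.
  rewrite {1}/S (reindex_inj (addrI (x / c))) mulr_sumr /=.
  apply: eq_big => [s|s hs].
    apply/idP/idP => h; last exact: levelD.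
    by rewrite -[s](addKr (x / c)) levelD ?levelN.
  have hs' : level p k s.
    by rewrite -[s](addKr (x / c)) levelD ?levelN.
  rewrite mulrDl divfK // ltraceD // tx psiD //.
  by apply: ltrace_level0 => //; apply: levelM.
move=> /eqP; rewrite -subr_eq0 -{1}[S]mul1r -mulrBl mulf_eq0 subr_eq0 eq_sym.
by rewrite (negPf psiu) => /eqP.
Qed.

(* A prescribed sum and product in level [k] belong to the roots of one quadratic
   polynomial, which lie in level [k] or are conjugate over it in level [k + 1]. *)
Let pairs k (u : E * E) := [set t : E * E | [&& level p k t.1, level p k t.2 & (t.1 + t.2, t.1 * t.2) == u]].
Let conjs k (u : E * E) := [set x : E | level p k.+1 x & (x + x ^+ (p ^ 2 ^ k), x * x ^+ (p ^ 2 ^ k)) == u].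

Lemma quadratic_root_le (s n : E) (A : {set E}) :
  (forall x, x \in A -> x * (s - x) = n) -> (#|A| <= 2)%N.
Proof.
move=> H; have [->|[x0 hx0]] := set_0Vmem A; first by rewrite cards0.
apply: leq_trans (subset_leq_card (_ : A \subset [set x0; s - x0])) _; last first.
  by rewrite cards2; case: eqP.
apply/fintype.subsetP => x /H hx; rewrite !inE -[x == x0]subr_eq0 -[x == s - x0]subr_eq0 -mulf_eq0.
have -> : (x - x0) * (x - (s - x0)) = x0 * (s - x0) - x * (s - x) by ring.
by rewrite hx H // subrr.
Qed.

(** Both sets consist of roots of [T * (s - T) = n]. A root counted in both is double and then the
    only one, in characteristic 2 as well. *)
Lemma card_pairs_conjs_le k u : (#|pairs k u| + #|conjs k u| <= 2)%N.
Proof.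
case: u => s n.
pose A := [set t.1 | t in pairs k (s, n)].
have cA : #|pairs k (s, n)| = #|A|.
  rewrite card_in_imset // => -[x y] [x' y']; rewrite !inE /= !xpair_eqE.
  move=> /and3P[_ _ /andP[/eqP e1 _]] /and3P[_ _ /andP[/eqP e2 _]] ex.
  by rewrite ex in e1 *; congr (_, _); apply: (addrI x'); rewrite e1 e2.
have hA x : x \in A -> level p k x /\ x * (s - x) = n.
  case/imsetP => -[x' y]; rewrite inE /= xpair_eqE => /and3P[hx _ /andP[/eqP<- /eqP<-]] ->.
  by split=> //; rewrite addrC addKr.
have hC x : x \in conjs k (s, n) -> x ^+ (p ^ 2 ^ k) = s - x /\ x * (s - x) = n.
  rewrite inE xpair_eqE => /andP[_ /andP[/eqP<- /eqP<-]].
  by rewrite addrC addKr.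
rewrite cA -cardsUI.
have [->|[x0]] := set_0Vmem (A :&: conjs k (s, n)).
  rewrite cards0 addn0; apply: (@quadratic_root_le s n) => x.
  by rewrite inE => /orP[/hA[]|/hC[]].
rewrite inE => /andP[/hA[lx0 n0] /hC[f0 _]].
have sx0 : s - x0 = x0 by rewrite -f0; apply/eqP.
suff HU : A :|: conjs k (s, n) \subset [set x0].
  have HI : A :&: conjs k (s, n) \subset [set x0].
    by apply: fintype.subset_trans HU; apply: fintype.subset_trans (finset.subsetIl _ _) (finset.subsetUl _ _).
  have := leq_add (subset_leq_card HU) (subset_leq_card HI); by rewrite !cards1.
apply/fintype.subsetP => x hx; have {hx} : x * (s - x) = n.
  by move: hx; rewrite inE => /orP[/hA[]|/hC[]].
move=> hx; rewrite inE -subr_eq0 -sqrf_eq0.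
have -> : (x - x0) ^+ 2 = x0 * (s - x0) - x * (s - x) by rewrite (_ : s = x0 + x0); [ring | rewrite -{2}sx0 addrC subrK].
by rewrite hx n0 subrr.
Qed.

Lemma frob_mul_fix k (x : E) : level p k.+1 x ->
  level p k (x + x ^+ (p ^ 2 ^ k)) /\ level p k (x * x ^+ (p ^ 2 ^ k)).
Proof.
move=> hx; split; rewrite /level ?(frobD char_p) ?exprMn (level_frobK hx).
  by rewrite addrC.
by rewrite mulrC.
Qed.

(** Summed over all [u], pairs and conjugates each total [q ^ 2] with [q = p ^ 2 ^ k], which is also
    the number of [u]. As the two counts add up to at most 2 for each [u], equality holds
    everywhere. *)
Lemma card_pairs_conjs k u : (k < K)%N -> level p k u.1 -> level p k u.2 ->
  (#|pairs k u| + #|conjs k u| = 2)%N.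
Proof.
move=> kK h1 h2.
pose D := [pred v : E * E | level p k v.1 & level p k v.2].
have hD : #|D| = (p ^ 2 ^ k * p ^ 2 ^ k)%N.
  by rewrite -(card_level char_p card_E (ltnW kK)) -cardX; apply: eq_card.
have s1 : (\sum_(v | D v) #|pairs k v| = p ^ 2 ^ k * p ^ 2 ^ k)%N.
  rewrite -hD -sum1_card [RHS](partition_big (fun t : E * E => (t.1 + t.2, t.1 * t.2)) D) /=.
    apply: eq_bigr => v _; rewrite -sum1_card; apply: eq_bigl => t.
    by rewrite !inE /= andbA.
  by move=> t /andP[ha hb]; rewrite /D /= levelD // levelM.
have s2 : (\sum_(v | D v) #|conjs k v| = p ^ 2 ^ k * p ^ 2 ^ k)%N.
  rewrite -expnD addnn -mul2n -expnS -(card_level char_p card_E kK) -sum1_card.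
  rewrite [RHS](partition_big (fun x => (x + x ^+ (p ^ 2 ^ k), x * x ^+ (p ^ 2 ^ k))) D) /=.
    by apply: eq_bigr => v _; rewrite -sum1_card; apply: eq_bigl => t; rewrite !inE.
  by move=> x /frob_mul_fix[ha hb]; rewrite /D /= ha hb.
have le2 v : D v -> (#|pairs k v| + #|conjs k v| <= 2 ?= iff (#|pairs k v| + #|conjs k v| == 2))%N.
  by move=> _; split => //; apply: card_pairs_conjs_le.
have [_] := leqif_sum le2.
rewrite big_split /= s1 s2 sum_nat_const hD addnn -muln2 eqxx => /esym/forall_inP/(_ u) H.
by apply/eqP/H; rewrite /D /= h1 h2.
Qed.

(** [ksum k ^ 2] and [ksum k.+1] sum the same function of [(s, n)], the sum and product of two
    elements, weighted by the numbers of pairs and of conjugates. The weights add up to 2, and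
    orthogonality in [s] leaves only [n = - a]. *)
Lemma ksumS k : (k < K)%N -> (exists2 u, level p 0 u & psi u != 1) ->
  ksum k.+1 = 2%:R * (p ^ 2 ^ k)%:R - ksum k ^+ 2.
Proof.
move=> kK nontriv; apply/eqP; rewrite -subr_eq opprK; apply/eqP.
pose G (u : E * E) := psi (ltrace p k (u.1 + a * u.1 / u.2)).
pose D := [pred u : E * E | [&& level p k u.1, level p k u.2 & u.2 != 0]].
have e1 : ksum k ^+ 2 = \sum_(u | D u) (#|pairs k u|)%:R * G u.
  pose P := [pred t : E * E | [&& level p k t.1, level p k t.2, t.1 != 0 & t.2 != 0]].
  have := @partition_big_count _ _ _ P D (fun t => (t.1 + t.2, t.1 * t.2)) G.
  move=> H; transitivity (\sum_(t | P t) G (t.1 + t.2, t.1 * t.2)); last first.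
    rewrite H; last by move=> [x y] /and4P[/= ? ? ? ?]; rewrite /D /= levelD ?levelM ?mulf_neq0.
    apply: eq_bigr => -[s n] /and3P[_ _ /= n0]; congr (_%:R * _); apply: eq_card => t.
    rewrite !inE /= -!andbA; congr (_ && (_ && _)).
    apply/and3P/idP => [[]//|/eqP hh].
    by split; last exact/eqP; apply: contraNneq n0 => e; move: hh => [_ <-]; rewrite e ?mul0r ?mulr0.
  rewrite expr2 /ksum big_distrlr /= pair_big /=; apply: eq_big => [[x y]|[x y] /=].
    by rewrite /P /= andbACA -!andbA.
  move=> /andP[/andP[hx x0] /andP[hy y0]].
  rewrite -psiD; try by apply: ltrace_level0 => //; rewrite levelD // levelM ?levelV ?a_levelk.
  by rewrite /G /= -ltraceD //; congr (psi (ltrace p k _)); field; rewrite x0 y0.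
have e2 : ksum k.+1 = \sum_(u | D u) (#|conjs k u|)%:R * G u.
  pose P := [pred x : E | level p k.+1 x & x != 0].
  have := @partition_big_count _ _ _ P D (fun x => (x + x ^+ (p ^ 2 ^ k), x * x ^+ (p ^ 2 ^ k))) G.
  have fr0 (x : E) : x != 0 -> x ^+ (p ^ 2 ^ k) != 0 by move=> ?; rewrite expf_neq0.
  move=> H; transitivity (\sum_(x | P x) G (x + x ^+ (p ^ 2 ^ k), x * x ^+ (p ^ 2 ^ k))); last first.
    rewrite H; last first.
      by move=> x /andP[/frob_mul_fix[ha hb] x0]; rewrite /D /= ha hb mulf_neq0 ?fr0.
    apply: eq_bigr => -[s n] /and3P[_ _ /= n0]; congr (_%:R * _); apply: eq_card => x.
    rewrite !inE /= -!andbA; congr (_ && _).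
    apply/andP/idP => [[]//|/eqP hh].
    by split; last exact/eqP; apply: contraNneq n0 => e; move: hh => [_ <-]; rewrite e ?mul0r.
  apply: eq_bigr => x /andP[hx x0]; rewrite /G /= ltraceS //.
  congr (psi (ltrace p k _)); rewrite (frobD char_p) exprMn exprVn (level0_frob _ a_level).
  by field; rewrite x0 fr0.
rewrite e1 e2 -big_split /=.
rewrite (eq_bigr (fun u => 2%:R * G u)); last first.
  move=> u /and3P[h1 h2 _]; rewrite -mulrDl -natrD addnC.
  by rewrite (card_pairs_conjs kK h1 h2).
rewrite -mulr_sumr; congr (_ * _).
transitivity (\sum_(n | level p k n && (n != 0)) \sum_(s | level p k s) psi (ltrace p k (s * (1 + a / n)))).
  rewrite exchange_big pair_big /=; apply: eq_big => [[s n]|[s n] _] //=.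
  by rewrite /G /=; congr (psi (ltrace p k _)); rewrite mulrDr mulr1 mulrA [s * a]mulrC.
have ha : level p k (- a) && (- a != 0) by rewrite levelN ?a_levelk // oppr_eq0.
rewrite (bigD1 (- a)) //=. rewrite [X in _ + X]big1 ?addr0.
  rewrite sum_psi_ltrace ?(ltnW kK) //.
    by rewrite invrN mulrN divff // subrr eqxx.
  by rewrite invrN mulrN divff // subrr level0.
move=> n /andP[/andP[hn n0] na]; rewrite sum_psi_ltrace ?(ltnW kK) //.
  case: eqP => // e; case/eqP: na; apply: (mulfI (invr_neq0 n0)).
  by rewrite mulVf //; move/eqP: e; rewrite addr_eq0 mulrN mulrC => /eqP.
by rewrite levelD ?level1 ?levelM ?levelV ?a_levelk.
Qed.

End KloostermanDoubling.

Definition kloosterman (m : nat) (z : algC) (c h k : nat) : algC :=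
  \sum_(x < m) \sum_(y < m | (x * y == c %[mod m])%N) z ^+ (h * x + k * y).

Lemma norm_prim_root (C : numDomainType) n (z : C) : n.-primitive_root z -> `|z| = 1.
Proof.
move=> hz; apply/eqP; have n0 := prim_order_gt0 hz.
by rewrite -(@pexpr_eq1 _ `|z| n) // -normrX prim_expr_order // normr1.
Qed.

Lemma natr_eq_pchar (F : nzRingType) p (i j : nat) : p \in [pchar F] ->
  (i%:R == j%:R :> F) = (i == j %[mod p]).
Proof.
move=> ch; wlog ij : i j / (i <= j)%N.
  by move=> H; case/orP: (leq_total i j) => /H // e; rewrite eq_sym e eq_sym.
by rewrite eq_sym -subr_eq0 -natrB // -(dvdn_pcharf ch) [RHS]eq_sym eqn_mod_dvd.
Qed.

(** * From the point count to the square-root bound for prime moduli *)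

Section WeilTower.
Variables (E : finFieldType) (p K c : nat) (z : algC).
Hypothesis char_p : p \in [pchar E].
Hypothesis card_E : #|E| = (p ^ (2 ^ K.+1))%N.
Hypothesis zP : p.-primitive_root z.
Hypothesis c_unit : ~~ (p %| c)%N.

Let p_pr : prime p := pcharf_prime char_p.
Let p_gt1 : (1 < p)%N := prime_gt1 p_pr.
Let p_gt0 : (0 < p)%N := prime_gt0 p_pr.
Let Q := (p ^ (2 ^ K))%N.
Let a : E := c%:R.

Lemma a_level0 : level p 0 a. Proof. exact: level_nat. Qed.
Lemma a_nonzero : a != 0.
Proof. by rewrite -(dvdn_pcharf char_p). Qed.

Lemma card_EQ : #|E| = (Q ^ 2)%N.
Proof. by rewrite card_E expnS mulnC expnM. Qed.

Lemma level0_nat (x : E) : level p 0 x -> exists2 i, (i < p)%N & x = i%:R.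
Proof.
move=> hx; pose f (i : 'I_p) : E := i%:R.
have f_inj : injective f.
  move=> i j /eqP; rewrite (natr_eq_pchar _ _ char_p) => /eqP; rewrite !modn_small // => e.
  exact: val_inj.
have : f @: 'I_p =i [pred x | level p 0 x].
  apply/subset_cardP.
    by rewrite card_imset // card_ord (card_level char_p card_E) // expn0 expn1.
  by apply/fintype.subsetP => _ /imsetP[i _ ->]; rewrite inE; apply: level_nat.
by move/(_ x); rewrite inE hx => /imsetP[i _ ->]; exists i.
Qed.

(** The residue representing an element of the prime field; elsewhere [find] returns the default
    [p]. *)
Definition dlog_nat (x : E) := find (fun i => i%:R == x) (iota 0 p).

Lemma dlog_natP x : level p 0 x -> (dlog_nat x)%:R = x.
Proof.
move=> /level0_nat[i ip ->]; rewrite /dlog_nat; set P := fun _ => _.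
have hP : has P (iota 0 p) by apply/hasP; exists i; rewrite ?mem_iota // /P.
have := nth_find 0%N hP; rewrite nth_iota; last by rewrite has_find size_iota in hP.
by rewrite add0n => /eqP.
Qed.

Definition chi (j : nat) (x : E) : algC := z ^+ (j * dlog_nat x).

Lemma chi_nat j n : chi j n%:R = z ^+ (j * n).
Proof.
rewrite /chi mulnC exprM [in RHS]mulnC [in RHS]exprM; congr (_ ^+ _).
apply/eqP; rewrite (eq_prim_root_expr zP) -(natr_eq_pchar _ _ char_p) dlog_natP //.
exact: level_nat.
Qed.

Lemma chiD j x y : level p 0 x -> level p 0 y -> chi j (x + y) = chi j x * chi j y.
Proof.
move=> /level0_nat[i _ ->] /level0_nat[i' _ ->].
by rewrite -natrD !chi_nat mulnDr exprD.
Qed.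

Lemma chi_norm j x : `|chi j x| = 1.
Proof. by rewrite normrX (norm_prim_root zP) expr1n. Qed.

Lemma chi_nontriv j : (0 < j < p)%N -> exists2 u, level p 0 u & chi j u != 1.
Proof.
move=> /andP[j0 jp]; exists (1%:R); first exact: level_nat.
rewrite chi_nat muln1 -(expr0 z) (eq_prim_root_expr zP) modn_small // mod0n.
by rewrite -lt0n.
Qed.

Let S j k := ksum p (chi j) a k.

Lemma chi_sum0 x : level p 0 x -> \sum_(j < p) chi j x = (if x == 0 then p%:R else 0).
Proof.
move=> /level0_nat[i ip ->].
have -> : (i%:R == 0 :> E) = (i == 0)%N.
  by rewrite (natr_eq_pchar i 0 char_p) modn_small // mod0n.
rewrite (eq_bigr (fun j : 'I_p => (z ^+ i) ^+ j)); last first.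
  by move=> j _; rewrite chi_nat mulnC exprM.
case: eqP => [->|/eqP i0].
  rewrite (eq_bigr (fun=> 1)) ?sumr_const ?card_ord // => j _.
  by rewrite expr0 expr1n.
have z1 : z ^+ i - 1 != 0.
  by rewrite subr_eq0 -(expr0 z) (eq_prim_root_expr zP) modn_small // mod0n.
apply: (mulfI z1); rewrite -subrX1 -exprM mulnC exprM (prim_expr_order zP) expr1n.
by rewrite subrr mulr0.
Qed.

Definition trace_count (u : E) := #|[set x : E | (x != 0) && (ltrace p K.+1 (x + a / x) == u)]|.

Lemma trace_count_le u : level p 0 u ->
  (p * trace_count u <= Q ^ 2 + (5 * p ^ 2 + p + 3) * Q)%N.
Proof.
move=> hu; have [b _ tb] := ltrace_onto char_p card_E (leqnn _) hu.
apply: leq_trans (stepanov_bound a b char_p card_EQ).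
rewrite leq_mul2l; apply/orP; right; apply: subset_leq_card; apply/fintype.subsetP => x.
rewrite !inE => /andP[-> /eqP hx] /=; apply/existsP.
have [|y hy] := @artin_schreier_ltrace _ _ _ char_p card_E (x + a / x - b).
  by rewrite ltraceD // ltraceN // tb hx subrr.
by exists y; rewrite hy.
Qed.

Lemma level_top (x : E) : level p K.+1 x.
Proof. by rewrite /level -card_E expf_card. Qed.

Lemma sum_trace_count :
  (\sum_(u : E | level p 0 u) trace_count u = Q ^ 2 - 1)%N.
Proof.
have -> : (Q ^ 2 - 1)%N = #|[pred x : E | x != 0]|.
  by rewrite -card_EQ subn1 -(cardC1 (0 : E)).
rewrite -[RHS]sum1_card [RHS](partition_big (fun x => ltrace p K.+1 (x + a / x)) (level p 0)).
  by apply: eq_bigr => u _; rewrite /trace_count -sum1_card; apply: eq_bigl => x; rewrite !inE.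
move=> x _; apply: ltrace_level0 => //; exact: level_top.
Qed.

Lemma sum_ksum : \sum_(j < p) S j K.+1 = (p * trace_count 0%R)%:R.
Proof.
rewrite /S /ksum exchange_big /=.
rewrite (eq_bigr (fun x => if ltrace p K.+1 (x + a / x) == 0 then p%:R else 0)); last first.
  move=> x _; apply: chi_sum0; apply: ltrace_level0 => //; exact: level_top.
rewrite -big_mkcondr sumr_const /trace_count natrM mulr_natr; congr (_ *+ _).
apply: eq_card => x; by rewrite inE unfold_in level_top.
Qed.

Lemma S_real j k : S j k \is Num.real.
Proof. apply: ksum_real => //; [exact: chiD | exact: chi_norm | exact: a_level0]. Qed.

Lemma S_step j k : (0 < j < p)%N -> (k < K.+1)%N ->
  S j k.+1 = 2%:R * (p ^ 2 ^ k)%:R - S j k ^+ 2.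
Proof.
move=> hj hk; apply: (@ksumS E p K.+1) => //.
- exact: chiD.
- exact: chi_norm.
- exact: a_level0.
- exact: a_nonzero.
exact: chi_nontriv.
Qed.

(** The top sum is [2 * Q] minus the square of a real number. *)
Lemma S_top_le j : (0 < j < p)%N -> S j K.+1 <= 2%:R * Q%:R.
Proof.
move=> hj; rewrite S_step // lerBlDr lerDl -realEsqr; exact: S_real.
Qed.

Let C0 := (5 * p ^ 2 + p + 3)%N.

(** Stepanov bounds every trace class from above, and the classes partition the nonzero elements, so
    the class of trace 0 is also bounded from below. This bounds from below the sum over all
    characters; the other nontrivial ones contribute at most [2 * Q] each, so [j = 1] cannot be very
    negative. *)
Lemma S_top_ge : - (p * (3 + C0) * Q)%:R <= S 1 K.+1.
Proof.
have h1p : (0 < 1 < p)%N by rewrite p_gt1.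
have N0 : (Q ^ 2 <= p * trace_count 0%R + p + p.-1 * C0 * Q)%N.
  have := sum_trace_count; rewrite (bigD1 0) /=; last exact: level0.
  move=> e; have : (\sum_(u : E | level p 0%N u && (u != 0%R)) p * trace_count u
     <= \sum_(u : E | level p 0%N u && (u != 0%R)) (Q ^ 2 + C0 * Q))%N.
    by apply: leq_sum => u /andP[hu _]; apply: trace_count_le.
  have c1 : #|[pred u : E | level p 0 u && (u != 0)]| = p.-1.
    have := card_level char_p card_E (leq0n K.+1); rewrite expn0 expn1 (cardD1 0).
    rewrite [X in (X + _)%N](_ : _ = 1%N); last by rewrite -[_ \in _]/(level p 0 0) level0.
    rewrite add1n => ep; apply/eqP; rewrite -eqSS prednK //.
    rewrite -[X in _ == X]ep; apply/eqP; congr _.+1; apply: eq_card => u.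
    by rewrite !inE andbC.
  rewrite sum_nat_const c1 -big_distrr /=.
  move: e; set N := trace_count 0; set T := (\sum_(_ | _) _)%N.
  have Q1 : (0 < Q ^ 2)%N by rewrite !expn_gt0 p_gt0.
  rewrite -(prednK p_gt0); move: (p.-1) (Q ^ 2)%N Q1 => p' q q0 /= e2; nia.
have SS := sum_ksum.
rewrite (bigD1 (Ordinal p_gt0)) //= (bigD1 (Ordinal p_gt1)) //= in SS.
have S0 : S 0 K.+1 = (Q ^ 2)%:R - 1.
  rewrite /S /ksum (eq_bigr (fun=> 1)); last by move=> x _; rewrite /chi mul0n.
  have E0 : #|E| = #|predC1 (0 : E)|.+1.
    by rewrite cardC1 prednK // card_EQ !expn_gt0 p_gt0.
  rewrite sumr_const -card_EQ E0 -natr1 addrK; congr (_%:R).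
  by apply: eq_card => x; rewrite !inE unfold_in level_top.
have Srest : \sum_(j < p | (j != Ordinal p_gt0) && (j != Ordinal p_gt1)) S j K.+1
   <= p%:R * (2%:R * Q%:R).
  apply: (@le_trans _ _ (\sum_(j < p | (j != Ordinal p_gt0) && (j != Ordinal p_gt1)) 2%:R * Q%:R)).
    apply: ler_sum => j /andP[j0 _]; apply: S_top_le; rewrite ltn_ord andbT lt0n.
    by apply: contraNneq j0 => e; apply/eqP/val_inj.
  rewrite sumr_const -[_ *+ _]mulr_natl ler_wpM2r ?mulr_ge0 ?ler0n // ler_nat.
  by apply: leq_trans (max_card _) _; rewrite card_ord.
have -> : S 1 K.+1 = (p * trace_count 0%R)%:R - S 0 K.+1
    - \sum_(j < p | (j != Ordinal p_gt0) && (j != Ordinal p_gt1)) S j K.+1.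
  by rewrite -SS; ring.
rewrite lerBrDr; apply: le_trans (lerD (lexx _) Srest) _.
rewrite S0.
have Q1 : (0 < Q)%N by rewrite expn_gt0 p_gt0.
have H : (Q ^ 2 + p * (2 * Q) <= p * trace_count 0%R + p * (3 + C0) * Q + 1)%N.
  apply: leq_trans (leq_add N0 (leqnn _)) _; rewrite -!addnA leq_add2l.
  have := leq_pmulr p Q1; move: p_gt0; case: (p) => // n _ /=; nia.
move: H; rewrite -(ler_nat algC) -subr_ge0 -[in X in _ -> X]subr_ge0.
move: C0 (trace_count _) => c1 N; congr (_ <= _).
by rewrite !natrD !natrM !natrX !natrD; ring.
Qed.

(* [klo_ratio k] is [alpha ^ (2 ^ k) + alpha ^ (- 2 ^ k)] for the squared normalised Frobenius
   eigenvalue [alpha], so bounding it for all [k] forces [|alpha| = 1]. *)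
Definition klo_ratio k : algC := - S 1 k.+1 / (p ^ 2 ^ k)%:R.

Lemma klo_ratioS k : (k < K)%N -> klo_ratio k.+1 = klo_ratio k ^+ 2 - 2%:R.
Proof.
move=> kK; have h1p : (0 < 1 < p)%N by rewrite p_gt1.
have q0 : (p ^ 2 ^ k)%:R != 0 :> algC by rewrite pnatr_eq0 -lt0n expn_gt0 p_gt0.
rewrite /klo_ratio (S_step (k := k.+1)) ?ltnS // expnS mulnC expnM natrX.
by field.
Qed.

Lemma klo_ratio_iter k : (k <= K)%N ->
  klo_ratio k = iter k (fun x => x ^+ 2 - 2%:R) (klo_ratio 0).
Proof. by elim: k => // k IH kK; rewrite klo_ratioS //= IH // ltnW. Qed.

Lemma dlog_nat_lt x : level p 0 x -> (dlog_nat x < p)%N.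
Proof.
move=> /level0_nat[i ip ->]; rewrite /dlog_nat -[X in (_ < X)%N](size_iota 0) -has_find.
by apply/hasP; exists i; rewrite ?mem_iota.
Qed.

Lemma S0_kloosterman : S 1 0 = kloosterman p z c 1 1.
Proof.
have natE (i j : 'I_p) : (i%:R == j%:R :> E) = (i == j).
  by rewrite (natr_eq_pchar _ _ char_p) !modn_small // (inj_eq val_inj).
pose P := [pred t : 'I_p * 'I_p | (t.1 * t.2 == c %[mod p])%N].
pose D := [pred x : E | level p 0 x && (x != 0)].
pose h (t : 'I_p * 'I_p) : E := (t.1 : nat)%:R.
have Pa t : P t = ((t.1 : nat)%:R * (t.2 : nat)%:R == a).
  by rewrite /P /= -natrM /a (natr_eq_pchar _ _ char_p).
have PD t : P t -> D (h t).
  rewrite Pa /D /= level_nat // => /eqP e; apply: contraNneq a_nonzero => h0.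
  by rewrite -e [_%:R]h0 mul0r.
rewrite /kloosterman pair_big_dep /=.
transitivity (\sum_(t | P t) chi 1 (h t + a / h t)).
  rewrite (partition_big_count (fun x => chi 1 (x + a / x)) PD) /S /ksum.
  apply: eq_bigr => x /andP[hx x0].
  have hy : level p 0 (a / x) by rewrite levelM ?levelV // a_level0.
  rewrite (@fintype.eq_card1 _ (Ordinal (dlog_nat_lt hx), Ordinal (dlog_nat_lt hy))) => [|t].
    by rewrite mul1r /ltrace expn0 big_ord1 expn0 expr1.
  rewrite !inE [X in X && _](_ : _ = ((t.1 : nat)%:R * (t.2 : nat)%:R == a)); last exact: Pa.
  rewrite /h -pair_eqE /pair_eq /= -!natE /= !dlog_natP // andbC.
  have [->|//] := eqVneq ((t.1 : nat)%:R) x.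
  by rewrite (can2_eq (mulKf x0) (mulVKf x0)) [x^-1 * _]mulrC.
apply: eq_bigr => t; rewrite Pa => /eqP e.
have t0 : h t != 0 by apply: contraNneq a_nonzero => h0; rewrite -e [_%:R]h0 mul0r.
rewrite -e mulrC -[(t.1 : nat)%:R]/(h t) mulKf // -natrD chi_nat !mul1n.
by [].
Qed.

Lemma klo_ratio_le : klo_ratio K <= (p * (3 + C0))%:R.
Proof.
rewrite /klo_ratio ler_pdivrMr ?ltr0n ?expn_gt0 ?p_gt0 // lerNl -natrM.
exact: S_top_ge.
Qed.

Lemma iter_ratio_le :
  iter K (fun x => x ^+ 2 - 2%:R) (kloosterman p z c 1 1 ^+ 2 / p%:R - 2%:R)
    <= (p * (3 + C0))%:R.
Proof.
have <- : klo_ratio 0 = kloosterman p z c 1 1 ^+ 2 / p%:R - 2%:R.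
  have p0 : p%:R != 0 :> algC by rewrite pnatr_eq0 -lt0n p_gt0.
  rewrite /klo_ratio (S_step (k := 0)) ?p_gt1 // S0_kloosterman expn0 expn1.
  by field.
by rewrite -klo_ratio_iter // klo_ratio_le.
Qed.

End WeilTower.

(** If the square exceeded [4 * p], then [k ^ 2 / p - 2] would exceed 2 and its iterates under
    [x ^ 2 - 2] would pass every bound, whereas [iter_ratio_le] holds at all heights with one
    constant. *)
Theorem kloosterman_prime11 p z c : prime p -> p.-primitive_root z -> ~~ (p %| c)%N ->
  `|kloosterman p z c 1 1| ^+ 2 <= (4 * p)%:R.
Proof.
move=> pr zP cp; set k := kloosterman _ _ _ _ _.
pose C0 := (p * (3 + (5 * p ^ 2 + p + 3)))%N.
have p0 : (0 < p)%N := prime_gt0 pr.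
have tower K : k \is Num.real /\
    iter K (fun x => x ^+ 2 - 2%:R) (k ^+ 2 / p%:R - 2%:R) <= C0%:R.
  have [E char_p cardE] := @pPrimePowerField p (2 ^ K.+1) pr (expn_gt0 _ _).
  split; last exact: (iter_ratio_le char_p cardE zP cp).
  by rewrite /k -(S0_kloosterman char_p cardE zP cp); exact: (@S_real _ _ _ c _ char_p cardE zP 1 0).
have [kR _] := tower 0%N.
rewrite real_normK //.
have k2R : k ^+ 2 \is Num.real by rewrite realX.
rewrite real_leNgt ?realn //; apply/negP => klt.
have pR : 0 < p%:R :> algC by rewrite ltr0n.
set x0 := k ^+ 2 / p%:R - 2%:R in tower.
pose d := x0 - 2%:R.
have d0 : 0 < d by rewrite /d /x0 -addrA -opprD -natrD subr_gt0 ltr_pdivlMr // -natrM.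
(* Since [x ^ 2 - 4 = (x - 2) * (x + 2)], the distance to 2 at least doubles. *)
have grow K : 2%:R ^+ K * d <= iter K (fun x => x ^+ 2 - 2%:R) x0 - 2%:R.
  elim: K => [|K IH]; first by rewrite expr0 mul1r.
  rewrite iterS; move: IH; set x := iter K _ _ => IH.
  have x2 : 0 <= x - 2%:R by apply: le_trans IH; rewrite mulr_ge0 ?exprn_ge0 ?ler0n ?ltW.
  have -> : x ^+ 2 - 2%:R - 2%:R = (x - 2%:R) * (x - 2%:R + 4%:R) by ring.
  rewrite exprSr mulrAC ler_pM ?mulr_ge0 ?exprn_ge0 ?ler0n ?(ltW d0) //.
  by rewrite -[X in X <= _]add0r lerD // ler_nat.
have bnd : 0 <= C0%:R / d by rewrite divr_ge0 ?ler0n ?ltW.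
have := archi_boundP bnd; set K := Num.bound _; rewrite ltr_pdivrMr // => hK.
have [_ hi] := tower K.
have : C0%:R < iter K (fun x => x ^+ 2 - 2%:R) x0.
  apply: (lt_le_trans hK); apply: le_trans (_ : 2%:R ^+ K * d <= _).
    by rewrite ler_pM2r // -natrX ler_nat ltnW // ltn_expl.
  by apply: le_trans (grow K) _; rewrite lerBlDr lerDl ler0n.
by move/lt_le_trans/(_ hi); rewrite ltxx.
Qed.

(** * Divisors and the kernel *)

Lemma pfactor_ind (P : nat -> Prop) : P 1%N ->
    (forall p e m, prime p -> (0 < e)%N -> ~~ (p %| m)%N -> (0 < m)%N -> P m ->
       P (p ^ e * m)%N) ->
  forall n, (0 < n)%N -> P n.
Proof.
move=> P1 IP n; have [k] := ubnP n; elim: k n => // k IH n nk n0.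
have [n1|n1] := leqP n 1; first by rewrite (_ : n = 1%N) //; lia.
have pr := pdiv_prime n1; have [m cpm e] := pfactor_coprime pr n0.
have l0 : (0 < logn (pdiv n) n)%N by rewrite logn_gt0 mem_primes pr n0 pdiv_dvd.
have m0 : (0 < m)%N by move: n0; rewrite e muln_gt0 => /andP[].
rewrite e mulnC; apply: IP => //; first by rewrite -prime_coprime.
apply: IH => //; apply: (@leq_trans n); last by [].
by rewrite [X in (_ < X)%N]e -[X in (X < _)%N]muln1 ltn_pmul2l // -(expn0 (pdiv n)) ltn_exp2l // prime_gt1.
Qed.

Definition tau (n : nat) := size (divisors n).

Lemma tau_gt0 n : (0 < tau n)%N.
Proof. by have := divisor1 n; rewrite /tau; case: divisors. Qed.

Lemma tau_pfactor_ge p e m : prime p -> (0 < e)%N -> ~~ (p %| m)%N -> (0 < m)%N ->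
  (2 * tau m <= tau (p ^ e * m))%N.
Proof.
move=> pr e0 pm m0; have p0 := prime_gt0 pr.
have n0 : (0 < p ^ e * m)%N by rewrite muln_gt0 expn_gt0 p0.
have -> : (2 * tau m = size (divisors m ++ map (muln p) (divisors m)))%N.
  by rewrite size_cat size_map mul2n addnn.
apply: uniq_leq_size.
  rewrite cat_uniq divisors_uniq map_inj_uniq ?divisors_uniq ?andbT /=; last first.
    by move=> a b /eqP; rewrite eqn_pmul2l // => /eqP.
  apply/hasPn => _ /mapP[d _ ->]; rewrite -dvdn_divisors //.
  by apply: contra pm; apply: dvdn_trans; apply: dvdn_mulr.
move=> d; rewrite mem_cat -dvdn_divisors // => /orP[|/mapP[d']].
  by rewrite -dvdn_divisors // => ?; rewrite dvdn_mull.
rewrite -!dvdn_divisors // => dm ->; case: e e0 {n0} => // e _.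
by rewrite expnS -mulnA dvdn_mul // dvdn_mull.
Qed.

Lemma tau_pfactor_le p e m : prime p -> ~~ (p %| m)%N -> (0 < m)%N ->
  (tau (p ^ e * m) <= e.+1 * tau m)%N.
Proof.
move=> pr pm m0; have p0 := prime_gt0 pr.
have n0 : (0 < p ^ e * m)%N by rewrite muln_gt0 expn_gt0 p0.
apply: (@leq_trans (size [seq (p ^ i * d)%N | i <- iota 0 e.+1, d <- divisors m])); last first.
  by rewrite size_allpairs size_iota.
apply: uniq_leq_size (divisors_uniq _) _ => d; rewrite -dvdn_divisors // => dn.
have d0 : (0 < d)%N := dvdn_gt0 n0 dn.
have [d' cpd ed] := pfactor_coprime pr d0.
apply/allpairsP; exists (logn p d, d'); split; last by rewrite /= mulnC.
  rewrite mem_iota add0n ltnS /=; have := dvdn_leq_log p n0 dn.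
  by rewrite lognM ?expn_gt0 ?p0 // pfactorK // [logn p m]logn_coprime ?addn0 // prime_coprime.
rewrite -dvdn_divisors //.
have : (d' %| p ^ e * m)%N by apply: dvdn_trans dn; rewrite ed dvdn_mulr.
by rewrite Gauss_dvdr // coprimeXr // coprime_sym.
Qed.

Lemma perm_primes_pfactor p e m : prime p -> (0 < e)%N -> ~~ (p %| m)%N -> (0 < m)%N ->
  perm_eq (primes (p ^ e * m)) (p :: primes m).
Proof.
move=> pr e0 pm m0; have p0 := prime_gt0 pr.
apply: uniq_perm; rewrite ?primes_uniq //=.
  by rewrite primes_uniq mem_primes (negPf pm) !andbF.
move=> q; rewrite primesM ?expn_gt0 ?p0 // primesX // primes_prime // inE.
by rewrite inE.
Qed.

Lemma kernel_pfactor p e m : prime p -> (0 < e)%N -> ~~ (p %| m)%N -> (0 < m)%N ->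
  kernel_nat (p ^ e * m) = (p * kernel_nat m)%N.
Proof.
by move=> pr e0 pm m0; rewrite /kernel_nat (perm_big _ (perm_primes_pfactor pr e0 pm m0)) big_cons.
Qed.

Lemma kernel_gt0 m : (0 < kernel_nat m)%N.
Proof.
rewrite /kernel_nat big_seq; apply: prodn_cond_gt0 => p.
by rewrite mem_primes => /and3P[/prime_gt0].
Qed.

Lemma kernel_dvd m : (0 < m)%N -> (kernel_nat m %| m)%N.
Proof.
elim/pfactor_ind: m / => [|p e m pr e0 pm m0 IH]; first by rewrite /kernel_nat big_nil.
by rewrite kernel_pfactor // dvdn_mul // dvdn_exp //.
Qed.

Lemma kernel_dvd_sqr m (b : nat) : (0 < m)%N -> (m %| b ^ 2)%N -> (kernel_nat m %| b)%N.
Proof.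
elim/pfactor_ind: m / => [_|p e m pr e0 pm m0 IH]; first by rewrite /kernel_nat big_nil dvd1n.
move=> H; rewrite kernel_pfactor // Gauss_dvd.
  rewrite IH; last by apply: dvdn_trans H; apply: dvdn_mull.
  rewrite andbT; have : (p %| b ^ 2)%N by apply: dvdn_trans H; apply: dvdn_mulr; apply: dvdn_exp.
  by rewrite Euclid_dvdX // => /andP[].
rewrite prime_coprime //; apply: contra pm => H1; apply: dvdn_trans H1 _.
exact: kernel_dvd.
Qed.

Definition cofactor_nat (m : nat) := (m %/ kernel_nat m)%N.

Lemma cofactor_kernel m : (0 < m)%N -> (cofactor_nat m * kernel_nat m = m)%N.
Proof. by move=> m0; rewrite divnK // kernel_dvd. Qed.

Lemma cofactor_gt0 m : (0 < m)%N -> (0 < cofactor_nat m)%N.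
Proof. by move=> m0; rewrite divn_gt0 ?kernel_gt0 // dvdn_leq // kernel_dvd. Qed.

Lemma cofactor_pfactor p e m : prime p -> (0 < e)%N -> ~~ (p %| m)%N -> (0 < m)%N ->
  cofactor_nat (p ^ e * m) = (p ^ e.-1 * cofactor_nat m)%N.
Proof.
move=> pr e0 pm m0; have p0 := prime_gt0 pr.
apply/eqP; rewrite -(@eqn_pmul2r (kernel_nat (p ^ e * m))) ?kernel_gt0 //.
rewrite cofactor_kernel ?muln_gt0 ?expn_gt0 ?p0 // kernel_pfactor //.
by rewrite mulnACA cofactor_kernel // -expnSr prednK.
Qed.

(** Prime by prime: [p ^ e <= 2 * totient (p ^ e)], and a new prime at least doubles [tau]. *)
Lemma totient_tau m : (0 < m)%N -> (m <= totient m * tau m)%N.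
Proof.
elim/pfactor_ind: m / => // p e m pr e0 pm m0 IH; have p0 := prime_gt0 pr.
rewrite totient_coprime ?coprimeXl ?prime_coprime // totient_pfactor //.
have h : (p ^ e <= p.-1 * p ^ e.-1 * 2)%N.
  rewrite mulnAC -{1}(prednK e0) expnS leq_mul2r; have := prime_gt1 pr; lia.
apply: leq_trans (leq_mul h IH) _.
have := tau_pfactor_ge pr e0 pm m0.
move: (p.-1 * _)%N (totient m) (tau _) (tau m) => A B T T' hT.
by rewrite -mulnA [(2 * _)%N]mulnCA mulnA leq_mul2l hT orbT.
Qed.

Lemma succ_exp_bound k : exists2 D, (0 < D)%N & forall e, (e.+1 ^ k <= D * 2 ^ e)%N.
Proof.
case: k => [|k]; first by exists 1%N => // e; rewrite expn0 mul1n expn_gt0.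
exists ((2 * k.+1) ^ k.+1)%N => [|e]; first by rewrite expn_gt0.
have h : (e.+1 <= 2 * k.+1 * 2 ^ (e %/ k.+1))%N.
  have e1 := divn_eq e k.+1; have e2 := ltn_pmod e (ltn0Sn k).
  have e3 : ((e %/ k.+1).+1 <= 2 ^ (e %/ k.+1))%N by apply: ltn_expl.
  apply: (@leq_trans (k.+1 * (e %/ k.+1).+1)); first by rewrite mulnS; lia.
  rewrite [(2 * _)%N]mulnC -mulnA leq_mul2l /=.
  by apply: leq_trans e3 _; rewrite leq_pmull.
have : (e.+1 ^ k.+1 <= (2 * k.+1 * 2 ^ (e %/ k.+1)) ^ k.+1)%N by rewrite leq_exp2r.
move/leq_trans; apply; rewrite expnMn leq_mul2l -expnM leq_exp2l //.
by rewrite leq_trunc_div orbT.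
Qed.

(** A prime [p >= 2 ^ k] costs nothing, as [e.+1 ^ k <= (2 ^ k) ^ e <= p ^ e]. Each of the at most
    [2 ^ k] smaller primes costs a factor [D]. *)
Lemma tau_bound k : exists2 C, (0 < C)%N & forall n, (0 < n)%N -> (tau n ^ k <= C * n)%N.
Proof.
have [D D0 hD] := succ_exp_bound k.
pose w n := (\prod_(p <- primes n | (p < 2 ^ k)%N) D)%N.
exists (D ^ 2 ^ k)%N => [|n n0]; first by rewrite expn_gt0 D0.
have H : (tau n ^ k <= w n * n)%N.
  elim/pfactor_ind: n / n0 => [|p e m pr e0 pm m0 IH].
    by rewrite /w big_nil /tau exp1n.
  apply: (@leq_trans ((e.+1 * tau m) ^ k)).
    case: k {hD w IH} => [|k]; first by rewrite !expn0.
    by rewrite leq_exp2r // tau_pfactor_le.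
  have -> : w (p ^ e * m)%N = ((if (p < 2 ^ k)%N then D else 1) * w m)%N.
    rewrite /w (perm_big _ (perm_primes_pfactor pr e0 pm m0)) big_cons.
    by case: ifP => _; rewrite ?mul1n.
  rewrite expnMn mulnACA leq_mul //.
  have p1 := prime_gt1 pr.
  case: ltnP => pk.
    apply: leq_trans (hD e) _; rewrite leq_mul2l leq_exp2r ?p1 ?orbT //.
  rewrite mul1n; apply: leq_trans (_ : (2 ^ e) ^ k <= _)%N.
    case: k {hD w IH pk} => [|k]; first by rewrite !expn0.
    by rewrite leq_exp2r // ltn_expl.
  by rewrite -expnM mulnC expnM leq_exp2r.
apply: leq_trans H _; rewrite leq_mul2r; apply/orP; right.
rewrite /w big_const_seq iter_muln_1 leq_pexp2l // -size_filter.
rewrite -[X in (_ <= X)%N](size_iota 0); apply: uniq_leq_size.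
  by rewrite filter_uniq ?primes_uniq.
by move=> q; rewrite mem_filter mem_iota => /andP[].
Qed.

(** * Small points of the modular hyperbola in a box *)

Lemma eqn_modM2r m a x y : coprime a m ->
  (x * a == y * a %[mod m])%N = (x == y %[mod m])%N.
Proof.
move=> am; wlog le : x y / (y <= x)%N.
  move=> H; case/orP: (leq_total y x) => le; first exact: H.
  by rewrite eq_sym [RHS]eq_sym; apply: H.
by rewrite !eqn_mod_dvd ?leq_mul2r ?le ?orbT // -mulnBl Gauss_dvdl // coprime_sym.
Qed.

Lemma mulmod_inj m (y : nat) (m0 : (0 < m)%N) : coprime y m ->
  injective (fun x : 'I_m => Ordinal (ltn_pmod (x * y) m0)).
Proof.
move=> ym x x' /(congr1 val) /= /eqP; rewrite eqn_modM2r // !modn_small // => /eqP e.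
exact: val_inj.
Qed.

Arguments mulmod_inj [m y] m0.

Lemma card_mod_solutions m (y c : nat) : (0 < m)%N -> coprime c m ->
  #|[pred x : 'I_m | (x * y == c %[mod m])%N]| = coprime y m.
Proof.
move=> m0 cm; have [ym|ym] := boolP (coprime y m).
  have f_inj := mulmod_inj m0 ym; have cmm := ltn_pmod c m0.
  rewrite (@fintype.eq_card1 _ (invF f_inj (Ordinal cmm))) // => x; rewrite !inE.
  by rewrite -[RHS](inj_eq f_inj) (f_invF f_inj (Ordinal cmm)) -val_eqE.
apply: fintype.eq_card0 => x; rewrite !inE; apply: contraNF ym => /eqP e.
have : coprime (x * y) m by rewrite -coprime_modl e coprime_modl.
by rewrite coprimeMl => /andP[].
Qed.

Lemma mod_quotient_exists m (y c : nat) : (0 < m)%N -> coprime c m -> coprime y m ->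
  exists x : 'I_m, (x * y == c %[mod m])%N.
Proof.
move=> m0 cm ym; have := card_mod_solutions y m0 cm; rewrite ym.
by case: (pickP [pred x : 'I_m | (x * y == c %[mod m])%N]) => [x hx|h];
  [exists x | rewrite (fintype.eq_card0 h)].
Qed.

Lemma sum_prim_root m (z : algC) h : (0 < m)%N -> m.-primitive_root z ->
  \sum_(x < m) z ^+ (h * x) = if (m %| h)%N then m%:R else 0.
Proof.
move=> m0 zP; rewrite (eq_bigr (fun x : 'I_m => (z ^+ h) ^+ x)); last first.
  by move=> x _; rewrite exprM.
case: ifPn => mh.
  rewrite (eq_bigr (fun=> 1)) ?sumr_const ?card_ord // => x _.
  by rewrite -exprM -(prim_expr_mod zP) (eqP (dvdn_mulr _ mh)) expr0.
have z1 : z ^+ h - 1 != 0.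
  by rewrite subr_eq0 -(expr0 z) (eq_prim_root_expr zP) mod0n.
apply: (mulfI z1); rewrite -subrX1 -exprM mulnC exprM (prim_expr_order zP) expr1n.
by rewrite subrr mulr0.
Qed.

Lemma kloostermanC m z c h k : kloosterman m z c h k = kloosterman m z c k h.
Proof.
rewrite /kloosterman (exchange_big_dep xpredT) //=; apply: eq_bigr => y _.
by apply: eq_big => [x|x _]; [rewrite mulnC | rewrite addnC].
Qed.

Lemma kloosterman_modl m z c h h' k : (0 < m)%N -> m.-primitive_root z -> h = h' %[mod m] ->
  kloosterman m z c h k = kloosterman m z c h' k.
Proof.
move=> m0 zP e; apply: eq_bigr => x _; apply: eq_bigr => y _.
rewrite -(prim_expr_mod zP) -modnDml -modnMml e modnMml modnDml.
by rewrite (prim_expr_mod zP).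
Qed.

Lemma kloosterman_eq_totient m z c : (0 < m)%N -> coprime c m ->
  kloosterman m z c 0 0 = (totient m)%:R.
Proof.
move=> m0 cm; rewrite /kloosterman (exchange_big_dep xpredT) //=.
rewrite totient_count_coprime big_mkord natr_sum; apply: eq_bigr => y _.
rewrite (eq_bigr (fun=> 1)); last by move=> x _; rewrite !mul0n.
by rewrite sumr_const (card_mod_solutions _ m0 cm) coprime_sym.
Qed.

Lemma kloosterman_trivial m z c h k : (0 < m)%N -> m.-primitive_root z -> coprime c m ->
  `|kloosterman m z c h k| <= m%:R.
Proof.
move=> m0 zP cm; apply: le_trans (ler_norm_sum _ _ _) _.
apply: (@le_trans _ _ (\sum_(x < m) 1)); last by rewrite sumr_const card_ord.
apply: ler_sum => x _; apply: le_trans (ler_norm_sum _ _ _) _.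
rewrite (eq_bigr (fun=> 1)); last first.
  by move=> y _; rewrite normrX (norm_prim_root zP) expr1n.
rewrite sumr_const (eq_card (B := [pred y : 'I_m | (y * x == c %[mod m])%N])); last first.
  by move=> y; rewrite !inE mulnC.
by rewrite (card_mod_solutions _ m0 cm) lern1 leq_b1.
Qed.

(** If [h] and [k] are units, rescaling [x] and [y] reduces to [h = k = 1]. If [p] divides exactly
    one of them the sum is -1; if it divides both, the gcd absorbs the trivial bound. *)
Lemma kloosterman_prime p z c h k : prime p -> p.-primitive_root z -> coprime c p ->
  `|kloosterman p z c h k| ^+ 2 <= (4 * p * gcdn p (gcdn h k) ^ 2)%:R.
Proof.
move=> pr zP cp; have p0 := prime_gt0 pr.
have one_case h' k' : (p %| h')%N -> ~~ (p %| k')%N -> kloosterman p z c h' k' = -1.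
  move=> ph pk; rewrite (@kloosterman_modl _ _ _ _ 0%N) //; last by rewrite mod0n (eqP ph).
  rewrite /kloosterman (exchange_big_dep xpredT) //=.
  have := sum_prim_root k' p0 zP; rewrite (negPf pk) => /eqP.
  rewrite (bigD1 (Ordinal p0)) //= muln0 expr0 addrC addr_eq0 => /eqP <-.
  rewrite [LHS](bigD1 (Ordinal p0)) //= [X in X + _]big_pred0 ?add0r; last first.
    move=> x; rewrite muln0 mod0n eq_sym; apply/negbTE; rewrite -[_ == _]/(p %| c)%N.
    by rewrite -prime_coprime // coprime_sym.
  apply: eq_bigr => y y0; rewrite (eq_bigr (fun=> z ^+ (k' * y))) => [|x _]; last by rewrite mul0n.
  rewrite sumr_const (card_mod_solutions _ p0 cp) coprime_sym prime_coprime //.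
  rewrite gtnNdvd // lt0n; by apply: contraNneq y0 => e; apply/eqP/val_inj.
have small (w : algC) : w = -1 -> `|w| ^+ 2 <= (4 * p * gcdn p (gcdn h k) ^ 2)%:R.
  by move=> ->; rewrite normrN1 expr1n ler1n !muln_gt0 gcdn_gt0 p0.
have [ph|ph] := boolP (p %| h)%N; have [pk|pk] := boolP (p %| k)%N.
- have -> : gcdn p (gcdn h k) = p by apply/gcdn_idPl; rewrite dvdn_gcd ph.
  apply: (@le_trans _ _ (p%:R ^+ 2)).
    by rewrite ler_sqr ?nnegrE ?ler0n ?normr_ge0 // kloosterman_trivial.
  rewrite -natrX ler_nat leq_pmull // muln_gt0 /= p0 //.
- exact/small/one_case.
- by apply: small; rewrite kloostermanC one_case.
have g1 : gcdn p (gcdn h k) = 1%N.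
  apply/eqP; rewrite -[_ == _]/(coprime p (gcdn h k)) prime_coprime //.
  by apply: contra ph => /dvdn_trans; apply; apply: dvdn_gcdl.
rewrite g1 muln1.
have ch : coprime h p by rewrite coprime_sym prime_coprime.
have ck : coprime k p by rewrite coprime_sym prime_coprime.
suff -> : kloosterman p z c h k = kloosterman p z (h * k * c) 1 1.
  by apply: kloosterman_prime11 => //; rewrite !Euclid_dvdM // !negb_or ph pk -prime_coprime // coprime_sym.
rewrite /kloosterman [RHS](reindex_inj (mulmod_inj p0 ch)) /=.
apply: eq_bigr => x _; rewrite [RHS](reindex_inj (mulmod_inj p0 ck)) /=.
apply: eq_big => [y|y _].
  rewrite modnMml modnMmr mulnACA [(h * k * c)%N]mulnC eqn_modM2r //.
  by rewrite coprimeMl ch.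
by rewrite !mul1n -[RHS](prim_expr_mod zP) modnDm (prim_expr_mod zP) mulnC [(k * _)%N]mulnC.
Qed.

(** * Multiplicativity, and Kloosterman sums for composite moduli *)

Section ChineseRemainder.
Variables (q1 q2 : nat).
Hypotheses (q1_gt0 : (0 < q1)%N) (q2_gt0 : (0 < q2)%N) (co : coprime q1 q2).
Let q := (q1 * q2)%N.
Let q_gt0 : (0 < q)%N. Proof. by rewrite muln_gt0 q1_gt0. Qed.

(** With the weights [q2] and [q1] instead of idempotents, [z ^ crt u] factors as
    [(z ^ q2) ^ u.1 * (z ^ q1) ^ u.2]; the price is a factor [q2 ^ 2] or [q1 ^ 2] in the congruence
    for the product of two lifts. *)
Definition crt (u : 'I_q1 * 'I_q2) : 'I_q :=
  Ordinal (ltn_pmod (q2 * u.1 + q1 * u.2) q_gt0).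

Lemma crt_mod1 u n : (crt u * n = q2 * u.1 * n %[mod q1])%N.
Proof.
rewrite -modnMml /= (modn_dvdm _ (dvdn_mulr q2 (dvdnn q1))) modnMml.
by rewrite mulnDl -modnDmr -[(q1 * _ * n)%N]mulnA modnMr addn0.
Qed.

Lemma crt_mod2 u n : (crt u * n = q1 * u.2 * n %[mod q2])%N.
Proof.
rewrite -modnMml /= (modn_dvdm _ (dvdn_mull q1 (dvdnn q2))) modnMml.
by rewrite mulnDl -modnDml -[(q2 * _ * n)%N]mulnA modnMr add0n.
Qed.

Lemma crt_bij : bijective crt.
Proof.
apply: inj_card_bij; last by rewrite card_prod !card_ord.
move=> [a b] [a' b'] e; congr (_, _).
  have := crt_mod1 (a, b) 1; rewrite e crt_mod1 /= !muln1 ![(q2 * _)%N]mulnC => /eqP h.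
  have c21 : coprime q2 q1 by rewrite coprime_sym.
  apply: (mulmod_inj q1_gt0 c21); apply: val_inj => /=; by apply/esym/eqP.
have := crt_mod2 (a, b) 1; rewrite e crt_mod2 /= !muln1 ![(q1 * _)%N]mulnC => /eqP h.
apply: (mulmod_inj q2_gt0 co); apply: val_inj => /=; by apply/esym/eqP.
Qed.

Lemma eqn_mod_mul a b : (a == b %[mod q])%N = (a == b %[mod q1])%N && (a == b %[mod q2])%N.
Proof. exact: chinese_remainder. Qed.

Lemma kloosterman_mul z c h k : q.-primitive_root z -> coprime c q ->
  exists c1 c2, [/\ coprime c1 q1, coprime c2 q2 &
    kloosterman q z c h k
      = kloosterman q1 (z ^+ q2) c1 h k * kloosterman q2 (z ^+ q1) c2 h k].
Proof.
move=> zP; rewrite coprimeMr => /andP[cq1 cq2].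
have c21 : coprime (q2 * q2) q1 by rewrite coprimeMl coprime_sym co.
have c12 : coprime (q1 * q1) q2 by rewrite coprimeMl co.
have [c1 hc1] := mod_quotient_exists q1_gt0 cq1 c21.
have [c2 hc2] := mod_quotient_exists q2_gt0 cq2 c12.
exists c1, c2; split.
- have : coprime (c1 * (q2 * q2)) q1 by rewrite -coprime_modl (eqP hc1) coprime_modl.
  by rewrite coprimeMl => /andP[].
- have : coprime (c2 * (q1 * q1)) q2 by rewrite -coprime_modl (eqP hc2) coprime_modl.
  by rewrite coprimeMl => /andP[].
have cond u v : (crt u * crt v == c %[mod q])%N =
    (u.1 * v.1 == c1 %[mod q1])%N && (u.2 * v.2 == c2 %[mod q2])%N.
  rewrite eqn_mod_mul crt_mod1 crt_mod2; congr (_ && _).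
    rewrite mulnC crt_mod1 -(eqP hc1) -[RHS](eqn_modM2r _ _ c21).
    by congr (_ == _); congr (_ %% _)%N; ring.
  rewrite mulnC crt_mod2 -(eqP hc2) -[RHS](eqn_modM2r _ _ c12).
  by congr (_ == _); congr (_ %% _)%N; ring.
have crtE u v : z ^+ (h * crt u + k * crt v) =
    (z ^+ q2) ^+ (h * u.1 + k * v.1) * (z ^+ q1) ^+ (h * u.2 + k * v.2).
  rewrite -!exprM -exprD -(prim_expr_mod zP) /= -modnDm !modnMmr modnDm (prim_expr_mod zP).
  by congr (_ ^+ _); ring.
rewrite /kloosterman big_distrlr pair_big /= (reindex crt) /=; last exact: onW_bij crt_bij.
apply: eq_bigr => u _; rewrite big_distrlr pair_big /= (reindex crt) /=; last exact: onW_bij crt_bij.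
by apply: eq_big => [v|v _]; [exact: cond | exact: crtE].
Qed.

End ChineseRemainder.

Lemma prim_root_pow (F : nzRingType) (q1 q2 : nat) (z : F) : (0 < q1)%N -> (0 < q2)%N ->
  (q1 * q2).-primitive_root z -> q1.-primitive_root (z ^+ q2).
Proof.
move=> q10 q20 zP; have := exp_prim_root zP q2.
by rewrite (gcdn_idPl (dvdn_mull _ (dvdnn _))) mulnK.
Qed.

(** For [e >= 2] the trivial bound [p ^ e] is enough, thanks to the factor [p ^ e.-1], which is the
    cofactor of [p ^ e]. *)
Lemma kloosterman_pfactor p e z c h k : prime p -> (0 < e)%N ->
    (p ^ e).-primitive_root z -> coprime c (p ^ e) ->
  `|kloosterman (p ^ e) z c h k| ^+ 2
     <= ((2 * p ^ e.-1) ^ 2 * p ^ e * gcdn (p ^ e) (gcdn h k) ^ 2)%:R.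
Proof.
move=> pr; have p0 := prime_gt0 pr.
case: e => [|[|e]] // _; first by rewrite !expn1 expn0 muln1 => zP cp; apply: kloosterman_prime.
move=> zP cp; have pe0 : (0 < p ^ e.+2)%N by rewrite expn_gt0 p0.
apply: (@le_trans _ _ ((p ^ e.+2)%:R ^+ 2)).
  by rewrite ler_sqr ?nnegrE ?ler0n ?normr_ge0 // kloosterman_trivial.
rewrite -natrX ler_nat; apply: leq_trans (_ : (2 * p ^ e.+1) ^ 2 * p ^ e.+2 <= _)%N; last first.
  by rewrite leq_pmulr // expn_gt0 gcdn_gt0 pe0.
rewrite -[(_ ^ 2)%N]mulnn leq_mul2r; apply/orP; right.
rewrite expnMn [(p ^ e.+2)%N]expnS -[((p ^ e.+1) ^ 2)%N]mulnn.
apply: leq_trans (_ : p ^ e.+1 * p ^ e.+1 <= _)%N; last by rewrite leq_pmull.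
by rewrite leq_mul2r expnS leq_pmulr ?orbT // expn_gt0 p0.
Qed.

(** The factor 2 of each prime is paid for by [tau], the factor [p ^ e.-1] by the cofactor. *)
Theorem kloosterman_bound m z c h k : (0 < m)%N -> m.-primitive_root z -> coprime c m ->
  `|kloosterman m z c h k| ^+ 2
     <= ((tau m * cofactor_nat m) ^ 2 * m * gcdn m (gcdn h k) ^ 2)%:R.
Proof.
move=> m0; elim/pfactor_ind: m / m0 z c => [|p e m pr e0 pm m0 IH] z c zP cm.
  apply: (@le_trans _ _ (1 ^+ 2)).
    by rewrite ler_sqr ?nnegrE ?ler0n ?normr_ge0 // (le_trans (kloosterman_trivial _ _ _ zP _)).
  by rewrite expr1n ler1n gcd1n !muln1 expn_gt0 muln_gt0 tau_gt0 cofactor_gt0.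
have p0 := prime_gt0 pr; have pe0 : (0 < p ^ e)%N by rewrite expn_gt0 p0.
have co : coprime (p ^ e) m by rewrite coprimeXl // prime_coprime.
have [c1 [c2 [h1 h2 ->]]] := kloosterman_mul pe0 m0 co h k zP cm.
have zP1 := prim_root_pow pe0 m0 zP.
have zP2 : m.-primitive_root (z ^+ (p ^ e)).
  by apply: (prim_root_pow m0 pe0); rewrite mulnC.
rewrite normrM exprMn.
apply: le_trans (ler_pM _ _ (kloosterman_pfactor h k pr e0 zP1 h1) (IH _ _ zP2 h2)) _;
  rewrite ?exprn_ge0 ?normr_ge0 //.
rewrite -natrM ler_nat.
have gg : (gcdn (p ^ e) (gcdn h k) * gcdn m (gcdn h k) <= gcdn (p ^ e * m) (gcdn h k))%N.
  apply: dvdn_leq; first by rewrite gcdn_gt0 muln_gt0 pe0 m0.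
  rewrite dvdn_gcd dvdn_mul ?dvdn_gcdl //= Gauss_dvd ?dvdn_gcdr //.
  apply: coprime_dvdl (dvdn_gcdl _ _) _; exact: coprime_dvdr (dvdn_gcdl _ _) co.
have tt := tau_pfactor_ge pr e0 pm m0.
rewrite cofactor_pfactor //; move: gg tt.
move: (gcdn (p ^ e) _) (gcdn m _) (gcdn (p ^ e * m) _) (tau m) (tau (p ^ e * m)) => g1 g2 g t T'.
move: (cofactor_nat m) (p ^ e.-1)%N (p ^ e)%N => f pe1 pe gg tt.
have -> : ((2 * pe1) ^ 2 * pe * g1 ^ 2 * ((t * f) ^ 2 * m * g2 ^ 2) =
  (2 * t * (pe1 * f)) ^ 2 * (pe * m) * (g1 * g2) ^ 2)%N by ring.
by rewrite !leq_mul // leq_exp2r // leq_mul.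
Qed.

Lemma sum_unity (F : idomainType) m (w : F) : w ^+ m = 1 ->
  \sum_(h < m) w ^+ h = if w == 1 then m%:R else 0.
Proof.
move=> wm; case: eqP => [->|/eqP w1].
  by rewrite (eq_bigr (fun=> 1)) ?sumr_const ?card_ord // => h _; rewrite expr1n.
have w1' : w - 1 != 0 by rewrite subr_eq0.
by apply: (mulfI w1'); rewrite -subrX1 wm subrr mulr0.
Qed.

Lemma card_mod_class_le A M n : (0 < M)%N ->
  (#|[pred i : 'I_A | (i == n %[mod M])%N]| <= (A %/ M).+1)%N.
Proof.
move=> M0.
have h (i : 'I_A) : (i %/ M < (A %/ M).+1)%N by rewrite ltnS leq_div2r // ltnW.
rewrite -[X in (_ <= X)%N]card_ord -(card_in_imset (f := fun i => Ordinal (h i))) ?max_card //.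
move=> i j; rewrite !inE => /eqP ei /eqP ej /(congr1 val) /= e; apply: val_inj => /=.
by rewrite (divn_eq i M) (divn_eq j M) e ei ej.
Qed.

(** * Fourier analysis of the hyperbola in a box *)

Section BoxSums.
Variables (m : nat) (z : algC).
Hypothesis m_gt0 : (0 < m)%N.
Hypothesis zP : m.-primitive_root z.

Definition interval_sum (A h : nat) : algC := \sum_(i < A) z ^+ (h * i.+1).

Lemma z_neq0 : z != 0.
Proof. by rewrite -normr_eq0 (norm_prim_root zP) oner_eq0. Qed.

Lemma zexp_div_eq1 i j : (z ^+ i * z^-1 ^+ j == 1) = (i == j %[mod m])%N.
Proof.
rewrite -(eq_prim_root_expr zP) exprVn.
by rewrite -[RHS](inj_eq (mulIf (invr_neq0 (expf_neq0 j z_neq0)))) divff // expf_neq0 // z_neq0.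
Qed.

Lemma norm_interval_sum_sqr A h :
  `|interval_sum A h| ^+ 2 = \sum_(i < A) \sum_(j < A) (z ^+ i.+1 * z^-1 ^+ j.+1) ^+ h.
Proof.
rewrite normCK /interval_sum rmorph_sum /= big_distrlr /=.
apply: eq_bigr => i _; apply: eq_bigr => j _.
rewrite exprMn -!exprM ![(_.+1 * h)%N]mulnC rmorphXn /=; congr (_ * _ ^+ _).
by apply: (mulfI z_neq0); rewrite -normCK (norm_prim_root zP) expr1n divff ?z_neq0.
Qed.

(** Orthogonality over the multiples of [d] counts the pairs [i], [j] congruent modulo [M = m %/ d];
    each [i] has at most [A %/ M + 1] partners. *)
Lemma sum_norm_interval_dvd A d : (d %| m)%N ->
  \sum_(h < m | (d %| h)%N) `|interval_sum A h| ^+ 2 <= (A * (A + m %/ d))%:R.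
Proof.
move=> dm; have d0 := dvdn_gt0 m_gt0 dm; set M := (m %/ d)%N.
have eM : (M * d = m)%N by rewrite divnK.
have M0 : (0 < M)%N by rewrite divn_gt0 // dvdn_leq.
have zdP : M.-primitive_root (z ^+ d) by apply: (prim_root_pow M0 d0); rewrite eM.
have lt (h : 'I_M) : (h * d < m)%N by rewrite -eM ltn_pmul2r.
rewrite (reindex_onto (fun h : 'I_M => Ordinal (lt h))
          (fun h : 'I_m => insubd (Ordinal M0) (h %/ d)%N)) /=; last first.
  move=> h dh; apply: val_inj => /=; rewrite val_insubd ltn_divLR // eM ltn_ord.
  by rewrite divnK.
rewrite (eq_bigl xpredT); last first.
  move=> h; rewrite dvdn_mull //=; apply/eqP/val_inj => /=.
  by rewrite val_insubd mulnK // ltn_ord.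
under eq_bigr => h _ do rewrite norm_interval_sum_sqr.
rewrite exchange_big /=; under eq_bigr => i _ do rewrite exchange_big /=.
apply: (@le_trans _ _ (\sum_(i < A) (A + M)%:R)); last first.
  by rewrite sumr_const card_ord -[_ *+ A]mulr_natl -natrM.
apply: ler_sum => i _.
have inner (j : 'I_A) : \sum_(h < M) (z ^+ i.+1 * z^-1 ^+ j.+1) ^+ (h * d) =
    if (j == i %[mod M])%N then M%:R else 0.
  rewrite -[X in if X then _ else _](eqn_modDr 1) !addn1.
  rewrite (eq_bigr (fun h : 'I_M => ((z ^+ i.+1 * z^-1 ^+ j.+1) ^+ d) ^+ h)); last first.
    by move=> h _; rewrite mulnC exprM.
  rewrite sum_unity.
    rewrite exprMn -!exprM [(i.+1 * d)%N]mulnC [(j.+1 * d)%N]mulnC ![_ ^+ (d * _)]exprM exprVn.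
    rewrite eq_sym -(eq_prim_root_expr zdP) [in RHS]eq_sym exprVn.
    rewrite -[in RHS](inj_eq (mulIf (invr_neq0 (expf_neq0 j.+1 (expf_neq0 d z_neq0))))).
    by rewrite divff ?expf_neq0 ?z_neq0 // eq_sym.
  rewrite -exprM mulnC eM exprMn -!exprM ![(_.+1 * m)%N]mulnC !exprM (prim_expr_order zP).
  by rewrite exprVn (prim_expr_order zP) invr1 !expr1n mulr1.
under eq_bigr => j _ do rewrite inner.
rewrite -big_mkcond sumr_const -[M%:R *+ _]mulr_natl -natrM ler_nat.
apply: (@leq_trans ((A %/ M).+1 * M)); last by rewrite mulSnr leq_add2r leq_trunc_div.
rewrite leq_mul2r; apply/orP; right.
exact: card_mod_class_le.
Qed.

Lemma interval_sum0 A : interval_sum A 0 = A%:R.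
Proof.
by rewrite /interval_sum (eq_bigr (fun=> 1)) ?sumr_const ?card_ord.
Qed.

(** Fourier expansion of the number of solutions, which is 0. Using sums of two integers as
    coordinates squares the interval sums, so that their absolute values can be added up by
    orthogonality. *)
Lemma box_identity A B c : (forall i i' j j', (i < A)%N -> (i' < A)%N -> (j < B)%N -> (j' < B)%N ->
     ((i.+1 + i'.+1) * (j.+1 + j'.+1) != c %[mod m])%N) ->
  \sum_(h < m) \sum_(k < m) interval_sum A h ^+ 2 * interval_sum B k ^+ 2
     * kloosterman m z^-1 c h k = 0.
Proof.
move=> none.
pose n (C : nat) (u : 'I_C * 'I_C) := (u.1.+1 + u.2.+1)%N.
have sqr C h : interval_sum C h ^+ 2 = \sum_(u : 'I_C * 'I_C) (z ^+ n C u) ^+ h.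
  rewrite expr2 /interval_sum big_distrlr /= pair_big /=; apply: eq_bigr => u _.
  by rewrite -exprD -mulnDr mulnC exprM.
pose g (x : 'I_m) (y : 'I_m) u v (h k : nat) :=
  (z ^+ n A u * z^-1 ^+ x) ^+ h * (z ^+ n B v * z^-1 ^+ y) ^+ k.
transitivity (\sum_(h < m) \sum_(k < m) \sum_(x < m) \sum_(y < m | (x * y == c %[mod m])%N)
   \sum_u \sum_v g x y u v h k).
  apply: eq_bigr => h _; apply: eq_bigr => k _; rewrite mulr_sumr; apply: eq_bigr => x _.
  rewrite mulr_sumr; apply: eq_bigr => y _; rewrite !sqr !mulr_suml; apply: eq_bigr => u _.
  rewrite mulr_sumr mulr_suml; apply: eq_bigr => v _; rewrite /g !exprMn exprD -!exprM.
  by rewrite mulrACA [(h * x)%N]mulnC [(k * y)%N]mulnC.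
transitivity (\sum_(x < m) \sum_(y < m | (x * y == c %[mod m])%N) \sum_u \sum_v
   (\sum_(h < m) (z ^+ n A u * z^-1 ^+ x) ^+ h) * (\sum_(k < m) (z ^+ n B v * z^-1 ^+ y) ^+ k)).
  under eq_bigr => h _ do rewrite exchange_big /=.
  rewrite exchange_big /=; apply: eq_bigr => x _.
  under eq_bigr => h _ do rewrite exchange_big /=.
  rewrite exchange_big /=; apply: eq_bigr => y _.
  under eq_bigr => h _ do rewrite exchange_big /=.
  rewrite exchange_big /=; apply: eq_bigr => u _.
  under eq_bigr => h _ do rewrite exchange_big /=.
  rewrite exchange_big /=; apply: eq_bigr => v _.
  by rewrite big_distrlr.
apply: big1 => x _; apply: big1 => y /eqP xy; apply: big1 => u _; apply: big1 => v _.
have u1 k l : (z ^+ k * z^-1 ^+ l) ^+ m = 1.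
  rewrite exprMn -!exprM ![(_ * m)%N]mulnC !exprM exprVn (prim_expr_order zP).
  by rewrite invr1 !expr1n mulr1.
rewrite !sum_unity // !zexp_div_eq1.
case: eqP => [e1|_]; last by rewrite mul0r.
case: eqP => [e2|_]; last by rewrite mulr0.
have /eqP[] := none _ _ _ _ (ltn_ord u.1) (ltn_ord u.2) (ltn_ord v.1) (ltn_ord v.2).
by rewrite -modnMm e1 e2 modnMm.
Qed.

End BoxSums.

(** Without such a point, the term [h = k = 0] of [box_identity], of size
    [A ^ 2 * B ^ 2 * totient m], would have to be cancelled by the others, which [kloosterman_bound]
    makes too small. *)
Theorem modular_box m A B c : (0 < m)%N -> coprime c m -> (0 < A <= m)%N -> (0 < B <= m)%N ->
    (9 * tau m ^ 6 * cofactor_nat m ^ 2 * m ^ 3 < (A * B) ^ 2)%N ->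
  exists x y, [/\ (1 <= x <= 2 * A)%N, (1 <= y <= 2 * B)%N & x * y = c %[mod m]].
Proof.
move=> m0 cm /andP[A0 Am] /andP[B0 Bm] big.
have [[[[i i'] j] j'] /= /eqP h|none] := pickP [pred t : 'I_A * 'I_A * 'I_B * 'I_B |
    ((t.1.1.1.+1 + t.1.1.2.+1) * (t.1.2.+1 + t.2.+1) == c %[mod m])%N].
  exists (i.+1 + i'.+1)%N, (j.+1 + j'.+1)%N; split=> //.
    by have := ltn_ord i; have := ltn_ord i'; lia.
  by have := ltn_ord j; have := ltn_ord j'; lia.
exfalso; have [z zP] := C_prim_root_exists m0.
have ziP : m.-primitive_root z^-1.
  have -> : z^-1 = z^* by rewrite invC_norm (norm_prim_root zP) expr1n invr1 mul1r.
  by rewrite fmorph_primitive_root.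
have none' i i' j j' : (i < A)%N -> (i' < A)%N -> (j < B)%N -> (j' < B)%N ->
     ((i.+1 + i'.+1) * (j.+1 + j'.+1) != c %[mod m])%N.
  move=> h1 h2 h3 h4.
  by have /negbT := none (Ordinal h1, Ordinal h2, Ordinal h3, Ordinal h4).
have := box_identity zP none'.
set I := interval_sum z A; set J := interval_sum z B.
pose s := sqrtC (m%:R : algC).
pose kap : algC := (tau m * cofactor_nat m)%:R * s.
have s0 : 0 <= s by rewrite sqrtC_ge0 ler0n.
have kap0 : 0 <= kap by rewrite mulr_ge0 ?ler0n.
have kbound h k : `|kloosterman m z^-1 c h k| <= kap * (gcdn m (gcdn h k))%:R.
  rewrite -ler_sqr ?nnegrE ?normr_ge0 ?mulr_ge0 ?ler0n //.
  apply: le_trans (kloosterman_bound h k m0 ziP cm) _.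
  by rewrite !exprMn sqrtCK -!natrX -!natrM.
pose o : 'I_m := Ordinal m0.
pose a (h : 'I_m) := `|I h| ^+ 2; pose b (k : 'I_m) := `|J k| ^+ 2.
have a0 h : 0 <= a h by rewrite exprn_ge0.
have b0 k : 0 <= b k by rewrite exprn_ge0.
rewrite pair_big /= (bigD1 (o, o)) //= => /eqP; rewrite addr_eq0 => /eqP main.
have {}main : (A ^ 2 * B ^ 2 * totient m)%:R <= \sum_(u : 'I_m * 'I_m | u != (o, o))
    a u.1 * b u.2 * `|kloosterman m z^-1 c u.1 u.2|.
  have -> : (A ^ 2 * B ^ 2 * totient m)%:R = `|I 0%N ^+ 2 * J 0%N ^+ 2 * kloosterman m z^-1 c 0 0|.
    rewrite /I /J !interval_sum0 kloosterman_eq_totient // -!natrX -!natrM normr_nat.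
    by [].
  rewrite main normrN; apply: le_trans (ler_norm_sum _ _ _) _.
  by apply: ler_sum => u _; rewrite normrM [X in X * _]normrM !normrX.
(* With the gcd replaced by the sum of all common divisors [d], the double sum for each [d] factors
   into one over [h] and one over [k]. *)
have gcd_le (h k : nat) : (gcdn m (gcdn h k) <= \sum_(d <- divisors m | (d %| h) && (d %| k)) d)%N.
  rewrite -big_filter (bigD1_seq (gcdn m (gcdn h k))) ?filter_uniq ?divisors_uniq ?leq_addr //=.
  by rewrite mem_filter -dvdn_gcd dvdn_gcdr -dvdn_divisors // dvdn_gcdl.
have {}main : (A ^ 2 * B ^ 2 * totient m)%:R <= kap * \sum_(d <- divisors m) d%:R *
    \sum_(u : 'I_m * 'I_m | (u != (o, o)) && ((d %| u.1)%N && (d %| u.2)%N)) a u.1 * b u.2.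
  apply: le_trans main _.
  apply: (@le_trans _ _ (\sum_(u : 'I_m * 'I_m | u != (o, o))
     \sum_(d <- divisors m | (d %| u.1)%N && (d %| u.2)%N) kap * (d%:R * (a u.1 * b u.2)))).
    apply: ler_sum => u _; rewrite -mulr_sumr -mulr_suml mulrA [X in _ <= X]mulrC ler_wpM2l ?mulr_ge0 //.
    by apply: le_trans (kbound _ _) _; rewrite ler_wpM2l // -natr_sum ler_nat gcd_le.
  rewrite mulr_sumr (exchange_big_dep xpredT) //=; apply: ler_sum => d _.
  by rewrite !mulr_sumr.
have part d : d \in divisors m ->
    d%:R * \sum_(u : 'I_m * 'I_m | (u != (o, o)) && ((d %| u.1)%N && (d %| u.2)%N)) a u.1 * b u.2
      <= (3 * A * B * m ^ 2)%:R.
  rewrite -dvdn_divisors // => dm; set M := (m %/ d)%N.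
  have eM : (M * d = m)%N by rewrite divnK.
  have Mm : (M <= m)%N by apply: leq_div.
  set S := \sum_(u | _) _.
  (* Removing the term at the origin matters: it leaves [A B M (A + B + M)], and [d] times this is
     at most [3 A B m ^ 2]. *)
  have HS : (A ^ 2 * B ^ 2)%:R + S <= (A * (A + M) * (B * (B + M)))%:R.
    have -> : (A ^ 2 * B ^ 2)%:R + S = (\sum_(h < m | (d %| h)%N) a h) * (\sum_(k < m | (d %| k)%N) b k).
      rewrite big_distrlr pair_big /= [RHS](bigD1 (o, o)) /= ?dvdn0 //; congr (_ + _).
        by rewrite /a /b /I /J !interval_sum0 // !normr_nat -!natrX -natrM.
      by apply: eq_bigl => u; rewrite andbC.
    rewrite natrM; apply: ler_pM; rewrite ?sumr_ge0 //; exact: sum_norm_interval_dvd.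
  have {}HS : S <= (3 * A * B * m * M)%:R.
    rewrite -(lerD2l (A ^ 2 * B ^ 2)%:R); apply: le_trans HS _; rewrite -natrD ler_nat.
    have -> : (A * (A + M) * (B * (B + M)) = A ^ 2 * B ^ 2 + A * B * M * (A + B + M))%N by ring.
    rewrite leq_add2l; apply: leq_trans (_ : A * B * M * (3 * m) <= _)%N.
      by rewrite leq_mul2l; apply/orP; right; lia.
    by rewrite eq_leq //; ring.
  apply: le_trans (ler_wpM2l (ler0n _ _) HS) _; rewrite -natrM ler_nat.
  by rewrite eq_leq // -eM; ring.
have {part}main : (A ^ 2 * B ^ 2 * totient m)%:R <= kap * (tau m * (3 * A * B * m ^ 2))%:R.
  apply: le_trans main _; rewrite ler_wpM2l // big_seq.
  apply: le_trans (ler_sum _ part) _; rewrite -big_seq.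
  by rewrite big_const_seq count_predT iter_addr_0 -[_ *+ size _]mulr_natl -natrM.
have tot := totient_tau m0.
have AB0 : (0 < A * B)%N by rewrite muln_gt0 A0.
have {}main : (A * B * (A * B * m))%:R <= s * (A * B * (3 * tau m ^ 3 * cofactor_nat m * m ^ 2))%:R.
  apply: (@le_trans _ _ ((A ^ 2 * B ^ 2 * totient m)%:R * (tau m)%:R)).
    rewrite -natrM ler_nat -[(_ * totient m * _)%N]mulnA; apply: leq_trans (_ : A ^ 2 * B ^ 2 * m <= _)%N.
      by rewrite eq_leq //; ring.
    by rewrite leq_mul2l tot orbT.
  apply: le_trans (ler_wpM2r (ler0n _ _) main) _.
  rewrite le_eqVlt; apply/orP; left; apply/eqP.
  by rewrite /kap !natrM ?natrX; ring.
have {}main : (A * B)%:R <= s * (3 * tau m ^ 3 * cofactor_nat m * m)%:R.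
  have pos : 0 < (A * B * m)%:R :> algC by rewrite ltr0n muln_gt0 AB0.
  rewrite -(ler_pM2l pos); apply: le_trans (_ : (A * B * (A * B * m))%:R <= _).
    by rewrite -natrM ler_nat eq_leq //; ring.
  apply: le_trans main _; rewrite le_eqVlt; apply/orP; left; apply/eqP.
  by rewrite !natrM ?natrX; ring.
have : (A * B)%:R ^+ 2 <= (s * (3 * tau m ^ 3 * cofactor_nat m * m)%:R) ^+ 2.
  by rewrite ler_sqr ?nnegrE ?ler0n ?mulr_ge0 ?ler0n.
rewrite exprMn sqrtCK -!natrX -natrM ler_nat leqNgt => /negP; apply.
by apply: leq_trans big; rewrite ltnS eq_leq //; ring.
Qed.

(** * Pell equations and conics *)

Lemma size_le_classes (T I : eqType) (s : seq T) (f : T -> I) (cl : seq I) (k : nat) :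
    (forall x, x \in s -> f x \in cl) ->
    (forall i, i \in cl -> (size [seq x <- s | f x == i] <= k)%N) ->
  (size s <= size cl * k)%N.
Proof.
elim: cl s => [|i cl IH] s Hcl Hk.
  by case: s Hcl {Hk} => // x s /(_ x (mem_head _ _)).
rewrite -(count_predC (fun x => f x == i)) mulSn leq_add //.
  by rewrite -size_filter Hk ?mem_head.
rewrite -size_filter; apply: IH => [x|j jcl].
  by rewrite mem_filter /= => /andP[ne /Hcl]; rewrite inE (negPf ne).
apply: leq_trans (Hk j _); last by rewrite inE jcl orbT.
rewrite -filter_predI !size_filter; apply: sub_count => x /= /andP[].
by [].
Qed.

(** The values 1 and -1 qualify, so conics with rational asymptotes are not treated apart. *)
Definition squarefreez (D : int) := forall c : int, (c ^+ 2 %| D)%Z -> `|c|%N = 1%N.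

Lemma squarefree_part (D : int) : D != 0 ->
  exists f D0, [/\ f != 0, D = f ^+ 2 * D0 & squarefreez D0].
Proof.
have [k] := ubnP `|D|%N; elim: k D => // k IH D Dk D0.
have Dpos : (0 < `|D|)%N by rewrite absz_gt0.
have [/hasP[c]|/hasPn none] := boolP (has (fun c : nat => (c%:Z ^+ 2 %| D)%Z) (iota 2 `|D|)).
  rewrite mem_iota => /andP[c2 _] /dvdzP[D1 eD].
  have D10 : D1 != 0 by apply: contraNneq D0 => e; rewrite eD e mul0r.
  have [|f [D2 [f0 e sf]]] := IH D1 _ D10.
    have : (0 < `|D1|)%N by rewrite absz_gt0.
    rewrite eD abszM abszX /= in Dk => D1p; apply: leq_trans (_ : `|D1| * c ^ 2 <= k)%N; last by [].
    rewrite -[X in (X < _)%N]muln1 ltn_pmul2l // -(exp1n 2) ltn_exp2r //.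
  exists (f * c%:Z), D2; split => //.
    by rewrite mulf_neq0 //; case: (c) c2.
  by rewrite eD e; ring.
exists 1, D; split; rewrite ?expr1n ?mul1r // => c cD.
have cD' : (`|c| ^ 2 %| `|D|)%N by move: cD; rewrite dvdzE abszX.
have c0 : (0 < `|c|)%N by have := dvdn_gt0 Dpos cD'; rewrite expn_gt0 orbF.
apply/eqP; apply/negPn/negP => c1.
have cle : (`|c| <= `|D|)%N.
  by apply: leq_trans (dvdn_leq Dpos cD'); rewrite -mulnn leq_pmulr.
have /none : `|c|%N \in iota 2 `|D| by rewrite mem_iota; lia.
by rewrite dvdzE abszX cD'.
Qed.

Lemma coprime_pell (D n X Y : int) : Y ^+ 2 - D * X ^+ 2 = n -> coprimez X Y -> coprimez X n.
Proof.
move=> e co; have /coprimezP[[u v] /= uv] : coprimez X (Y ^+ 2) by rewrite coprimezXr.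
apply/coprimezP; exists (u + v * D * X, v) => /=; rewrite -uv -e; ring.
Qed.

Lemma dvdz_gcd_class (n d s : int) : (n %| d * s)%Z -> n != 0 ->
  exists n', n = gcdz n d * n' /\ (n' %| s)%Z.
Proof.
move=> h n0; have /dvdzP[n' en] := dvdz_gcdl n d.
have g0 : gcdz n d != 0 by rewrite gcdz_eq0 negb_and n0.
exists n'; split; first by rewrite mulrC.
have [u [v uv]] := Bezoutz n d.

have : (gcdz n d * n' %| gcdz n d * s)%Z.
  rewrite [gcdz n d * n']mulrC -en -uv mulrDl rpredD //; first by rewrite mulrAC dvdz_mull.
  by rewrite -mulrA dvdz_mull.
by rewrite dvdz_mul2l.
Qed.

(* The class of a primitive solution is the gcd of [n] with its determinant against
   [(X0, Y0)]; the quotient of two solutions of one class is (up to a factor 2) a unit. *)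
Section PellClass.
Variables (D n X0 Y0 X1 Y1 X2 Y2 : int).
Hypothesis sf : squarefreez D.
Hypothesis n0 : n != 0.
Hypothesis e0 : Y0 ^+ 2 - D * X0 ^+ 2 = n.
Hypothesis e1 : Y1 ^+ 2 - D * X1 ^+ 2 = n.
Hypothesis e2 : Y2 ^+ 2 - D * X2 ^+ 2 = n.
Hypothesis c0 : coprimez X0 Y0.
Hypothesis c1 : coprimez X1 Y1.

(** Write [n = g * n1], where [g] divides both determinants with [(X0, Y0)] and [n1] divides both
    expressions [X0 * Y + X * Y0]. As [X0] is prime to [n], both [g] and [n1] divide [W]. Their gcd
    [c] satisfies that [c ^ 2] divides [4 * D], so [c] divides 2, [D] being squarefree. *)
Lemma pell_same_class : gcdz n (X0 * Y1 - X1 * Y0) = gcdz n (X0 * Y2 - X2 * Y0) ->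
  (n %| 2%R * (X1 * Y2 - X2 * Y1))%Z.
Proof.
have dv (X Y : int) : Y ^+ 2 - D * X ^+ 2 = n -> (n %| (X0 * Y - X * Y0) * (X0 * Y + X * Y0))%Z.
  move=> e; have -> : (X0 * Y - X * Y0) * (X0 * Y + X * Y0) = n * (X0 ^+ 2 - X ^+ 2).
    have -> : (X0 * Y - X * Y0) * (X0 * Y + X * Y0) = X0 ^+ 2 * Y ^+ 2 - X ^+ 2 * Y0 ^+ 2 by ring.
    rewrite (_ : Y ^+ 2 = n + D * X ^+ 2); last by rewrite -e subrK.
    rewrite (_ : Y0 ^+ 2 = n + D * X0 ^+ 2); last by rewrite -e0 subrK.
    ring.
  exact: dvdz_mulr.
have [n1 [en1 n1s]] := dvdz_gcd_class (dv _ _ e1) n0.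
have [n2 [en2 n2s]] := dvdz_gcd_class (dv _ _ e2) n0.
move=> eg; rewrite -eg in en2; set g := gcdz n _ in en1 en2 eg.
have g0 : g != 0 by rewrite gcdz_eq0 negb_and n0.
have en12 : n2 = n1 by apply: (mulfI g0); rewrite -en1 -en2.
rewrite {}en12 {en2} in n2s.
set W := X1 * Y2 - X2 * Y1.
have gd1 : (g %| X0 * Y1 - X1 * Y0)%Z by apply: dvdz_gcdr.
have gd2 : (g %| X0 * Y2 - X2 * Y0)%Z by rewrite eg; apply: dvdz_gcdr.
have gn : (g %| n)%Z by apply: dvdz_gcdl.
have n1n : (n1 %| n)%Z by rewrite en1 dvdz_mull.
have coX0 k : (k %| n)%Z -> coprimez k X0.
  move=> kn; have /coprimezP[[u v] /= uv] := coprime_pell e0 c0.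
  have /dvdzP[k' ek] := kn; apply/coprimezP; exists (v * k', u) => /=.
  by rewrite -uv ek; ring.
have coX1 k : (k %| n)%Z -> coprimez k X1.
  move=> kn; have /coprimezP[[u v] /= uv] := coprime_pell e1 c1.
  have /dvdzP[k' ek] := kn; apply/coprimezP; exists (v * k', u) => /=.
  by rewrite -uv ek; ring.
have gW : (g %| W)%Z.
  rewrite -(Gauss_dvdzr _ (coX0 _ gn)).
  have -> : X0 * W = X1 * (X0 * Y2 - X2 * Y0) - X2 * (X0 * Y1 - X1 * Y0) by rewrite /W; ring.
  by rewrite rpredB // dvdz_mull.
have n1W : (n1 %| W)%Z.
  rewrite -(Gauss_dvdzr _ (coX0 _ n1n)).
  have -> : X0 * W = X1 * (X0 * Y2 + X2 * Y0) - X2 * (X0 * Y1 + X1 * Y0) by rewrite /W; ring.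
  by rewrite rpredB // dvdz_mull.
have [u [v uv]] := Bezoutz g n1; set c := gcdz g n1 in uv.
have ncW : (n %| c * W)%Z.
  rewrite -uv mulrDl rpredD //.
    by rewrite en1 -mulrA; apply: dvdz_mull; apply: dvdz_mul.
  by rewrite en1 [g * n1]mulrC -mulrA; apply: dvdz_mull; apply: dvdz_mul.
suff c2 : (c %| 2%R)%Z.
  have /dvdzP[q eq2] := c2; rewrite eq2 -mulrA dvdz_mull //.
have cg : (c %| g)%Z by apply: dvdz_gcdl.
have cn1 : (c %| n1)%Z by apply: dvdz_gcdr.
have ccn : (c ^+ 2 %| n)%Z by rewrite en1 expr2 dvdz_mul.
have cn : (c %| n)%Z by apply: dvdz_trans cg gn.
have c2Y : (c %| 2%R * Y1)%Z.
  rewrite -(Gauss_dvdzr _ (coX0 _ cn)).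
  have -> : X0 * (2 * Y1) = (X0 * Y1 - X1 * Y0) + (X0 * Y1 + X1 * Y0) by ring.
  by rewrite rpredD //; [apply: dvdz_trans cg gd1 | apply: dvdz_trans cn1 n1s].
have c4D : (c ^+ 2 %| 4%R * D)%Z.
  have co : coprimez (c ^+ 2) (X1 ^+ 2) by rewrite coprimezXl // coprimezXr // coX1.
  rewrite -(Gauss_dvdzl _ co).
  have -> : 4 * D * X1 ^+ 2 = (2 * Y1) ^+ 2 - 4 * n by rewrite -e1; ring.
  by apply: rpredB; [apply: dvdz_exp2r | apply: dvdz_mull].
have [/dvdzP[c' ec]|odd_c] := boolP (2%R %| c)%Z.
  have : (c' ^+ 2 %| D)%Z.
    have : (4%R * c' ^+ 2 %| 4%R * D)%Z by rewrite (_ : 4%R * c' ^+ 2 = c ^+ 2) // ec; ring.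
    by rewrite dvdz_mul2l.
  move/sf => c'1; rewrite dvdzE ec abszM c'1 mul1n //.
have co2 : coprimez c 2.
  move: odd_c; rewrite coprimezE dvdzE /= dvdn2 => oc.
  by rewrite coprimen2 -[odd _]negbK oc.
have : (c ^+ 2 %| D)%Z.
  move: c4D; rewrite (_ : 4 = 2 ^+ 2) // Gauss_dvdzr // coprimezXl // coprimezXr //.
by move/sf => c11; rewrite dvdzE c11 dvd1n.
Qed.

(** The quotient of the solutions is [(A + B sqrt D) / 2], of norm 1, up to conjugation. [A] is
    integral because [n ^ 2] divides the square of its numerator. *)
Lemma pell_quotient : (n %| 2%R * (X1 * Y2 - X2 * Y1))%Z -> exists A B : int,
  [/\ 2 * (Y1 * Y2 - D * X1 * X2) = n * A, 2 * (X1 * Y2 - X2 * Y1) = n * B &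
     A ^+ 2 - D * B ^+ 2 = 4].
Proof.
case/dvdzP => B eB.
have eA2 : (2 * (Y1 * Y2 - D * X1 * X2)) ^+ 2 = n ^+ 2 * (4 + D * B ^+ 2).
  have -> : n ^+ 2 * (4 + D * B ^+ 2) = 4 * n * n + D * (B * n) ^+ 2 by ring.
  by rewrite -eB -{1}e1 -e2; ring.
have /dvdzP[A eA] : (n %| 2%R * (Y1 * Y2 - D * X1 * X2))%Z.
  by rewrite -(@dvdz_pexp2r _ _ 2) // eA2 dvdz_mulr.
exists A, B; split; [by rewrite eA mulrC | by rewrite eB mulrC | ].
apply/eqP; rewrite subr_eq; apply/eqP; apply: (mulfI (expf_neq0 2 n0)).
have eA2' := eA2; rewrite eA in eA2'.
by rewrite -[RHS]eA2'; ring.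
Qed.

End PellClass.

Lemma size_le1 (T : eqType) (s : seq T) :
  uniq s -> {in s &, forall x y, x = y} -> (size s <= 1)%N.
Proof.
case: s => [|x [|y s]] //= /andP[xy _] H.
by have e := H x y; rewrite e ?inE ?eqxx ?orbT // in xy.
Qed.

Definition pell (D n : int) (P : int * int) := P.2 ^+ 2 - D * P.1 ^+ 2 == n.
Definition pell_det (P Q : int * int) : int := P.1 * Q.2 - Q.1 * P.2.

Section PellPositive.
Variables (R : rcfType) (D n : int).
Hypothesis D_gt0 : 0 < D.
Hypothesis n0 : n != 0.
Let r : R := Num.sqrt D%:~R.

Definition pell_val (P : int * int) : R := P.2%:~R + P.1%:~R * r.

Lemma sqr_r : r ^+ 2 = D%:~R.
Proof. by rewrite sqr_sqrtr // ler0z ltW. Qed.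

Lemma r_ge1 : 1 <= r.
Proof. by rewrite -sqrtr1 ler_wsqrtr // ler1z -gtz0_ge1. Qed.

Lemma pell_val_conj P : pell D n P -> pell_val P * (P.2%:~R - P.1%:~R * r) = n%:~R.
Proof.
move=> /eqP <-; rewrite /pell_val !(rmorphB, rmorphM, rmorphXn) /= -sqr_r; ring.
Qed.

Lemma pell_val_ge1 P : 0 <= P.1 -> 0 <= P.2 -> pell D n P -> 1 <= pell_val P.
Proof.
case: P => X Y /= X0 Y0 h.
have [Ypos|Yneg] := ltP 0 Y.
  rewrite /pell_val /= -[X in X <= _]addr0 lerD ?mulr_ge0 ?ler0z ?sqrtr_ge0 //.
  by rewrite ler1z -gtz0_ge1.
have Y00 : Y = 0 by apply/eqP; rewrite eq_le Yneg.
have X1 : 1 <= X.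
  rewrite -gtz0_ge1 lt_neqAle X0 andbT eq_sym; apply: contraNneq n0 => X00.
  by move: h; rewrite /pell /= Y00 X00 expr0n /= mulr0 subr0 eq_sym.
rewrite /pell_val /= Y00 add0r -[X in X <= _]mulr1 ler_pM ?ler01 ?r_ge1 //.
by rewrite ler1z.
Qed.

(** For the two values [u] and [v], the integer [A = u / v + v / u] is below 5/2, as they differ by
    less than a factor 2. [A = 1] would give [D * B ^ 2 = -3]; so [A = 2], [B = 0] and [u = v]. *)
Lemma pell_val_inj P Q : 0 <= P.1 -> 0 <= P.2 -> 0 <= Q.1 -> 0 <= Q.2 ->
    pell D n P -> pell D n Q -> (n %| 2%R * pell_det P Q)%Z ->
    pell_val P < 2 * pell_val Q -> pell_val Q < 2 * pell_val P -> P = Q.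
Proof.
move=> p1 p2 q1 q2 hP hQ dv PQ QP.
have vP := pell_val_ge1 p1 p2 hP; have vQ := pell_val_ge1 q1 q2 hQ.
have cP := pell_val_conj hP; have cQ := pell_val_conj hQ.
move: dv; rewrite /pell_det => dv.
have [A [B [eA eB eAB]]] := pell_quotient n0 (eqP hP) (eqP hQ) dv.
have nR : n%:~R != 0 :> R by rewrite intr_eq0.
have lin1 : 2 * pell_val P = pell_val Q * (A%:~R + B%:~R * r).
  apply: (mulfI nR).
  have -> : n%:~R * (pell_val Q * (A%:~R + B%:~R * r)) =
     pell_val Q * ((n * A)%:~R + (n * B)%:~R * r) by rewrite !intrM; ring.
  rewrite -eA -eB -{1}cQ /pell_val !(rmorphB, rmorphM) /= -sqr_r; ring.
have lin2 : 2 * pell_val Q = pell_val P * (A%:~R - B%:~R * r).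
  apply: (mulfI nR).
  have -> : n%:~R * (pell_val P * (A%:~R - B%:~R * r)) =
     pell_val P * ((n * A)%:~R - (n * B)%:~R * r) by rewrite !intrM; ring.
  rewrite -eA -eB -{1}cP /pell_val !(rmorphB, rmorphM) /= -sqr_r; ring.
set u := pell_val P in vP PQ QP lin1 lin2 cP *; set v := pell_val Q in vQ PQ QP lin1 lin2 cQ *.
have uv : A%:~R * (u * v) = u ^+ 2 + v ^+ 2.
  have h1 : 2 * u * u = u * v * (A%:~R + B%:~R * r) by rewrite lin1; ring.
  have h2 : 2 * v * v = u * v * (A%:~R - B%:~R * r) by rewrite lin2; ring.
  by nra.
have uvp : 0 < u * v by rewrite mulr_gt0 // (lt_le_trans ltr01).
have A3 : A < 3.
  rewrite -(ltr_int R) ltNge; apply/negP => hA.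
  have h3 : 0 < (2 * v - u) * (2 * u - v) by rewrite mulr_gt0 // subr_gt0.
  have : 3%:~R * (u * v) <= A%:~R * (u * v) by rewrite ler_wpM2r // ltW.
  by rewrite uv; lra.
have A0 : 0 < A.
  rewrite -(ltr_int R) -(pmulr_lgt0 _ uvp) uv.
  by rewrite addr_gt0 // exprn_gt0 // (lt_le_trans ltr01).
have B0 : B = 0 by nia.
have A2 : A = 2 by rewrite B0 in eAB; nia.
have euv : u = v by rewrite A2 in uv; nra.
have cc : P.2%:~R - P.1%:~R * r = Q.2%:~R - Q.1%:~R * r.
  have u0 : u != 0 by rewrite gt_eqF //; lra.
  by apply: (mulfI u0); rewrite cP euv cQ.
have r0 : r != 0 by rewrite gt_eqF // (lt_le_trans ltr01 r_ge1).
have s2 : P.2%:~R = Q.2%:~R :> R by move: euv cc; rewrite /u /v /pell_val; lra.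
have s1 : P.1%:~R = Q.1%:~R :> R.
  by apply: (mulIf r0); move: euv cc; rewrite /u /v /pell_val; lra.
case: P Q {p1 p2 q1 q2 hP hQ vP vQ cP cQ dv eA eB PQ QP u v lin1 lin2 uv uvp euv cc} s1 s2 => X Y [X' Y'] /=.
by move=> /intr_inj -> /intr_inj ->.
Qed.

Lemma pell_positive_count (s : seq (int * int)) T : uniq s ->
    {in s, forall P, [/\ 0 <= P.1, 0 <= P.2, pell D n P & pell_val P < 2 ^+ T]} ->
    {in s &, forall P Q, (n %| 2%R * pell_det P Q)%Z} -> (size s <= T)%N.
Proof.
move=> us Hs Hdet.
pose f P := find (fun i => pell_val P < 2 ^+ i.+1) (iota 0 T).
have hasP_ P : P \in s -> has (fun i => pell_val P < 2 ^+ i.+1) (iota 0 T).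
  move=> /Hs[h1 h2 h3 h4]; apply/hasP; exists T.-1.
    rewrite mem_iota /= add0n; case: (T) h4 => // h4.
    by have := pell_val_ge1 h1 h2 h3; rewrite expr0 in h4; move/le_lt_trans/(_ h4); rewrite ltxx.
  by case: (T) h4 => //= h4; apply: lt_trans h4 _; rewrite expr0 expr1 ltr1n.
have fP P : P \in s -> 2 ^+ f P <= pell_val P < 2 ^+ (f P).+1.
  move=> Ps; have hP := hasP_ P Ps; have [h1 h2 h3 _] := Hs P Ps.
  have fT : (f P < T)%N by rewrite -[X in (_ < X)%N](size_iota 0) -has_find.
  apply/andP; split; last by have := nth_find 0%N hP; rewrite -/(f P) nth_iota.
  case e : (f P) => [|i]; first by rewrite expr0; apply: pell_val_ge1.
  have ii : (i < f P)%N by rewrite e.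
  have := before_find 0%N ii; rewrite nth_iota ?add0n; last exact: ltn_trans ii fT.
  by move/negbT; rewrite -leNgt.
rewrite -[T](size_iota 0) -[size (iota 0 T)]muln1.
apply: (@size_le_classes _ _ s f) => [P Ps|i _].
  by rewrite mem_iota add0n /= -[X in (_ < X)%N](size_iota 0) -has_find; apply: hasP_.
apply: size_le1; first exact: filter_uniq.
move=> P Q; rewrite !mem_filter => /andP[/eqP fi Ps] /andP[/eqP fj Qs].
have [p1 p2 hP _] := Hs P Ps; have [q1 q2 hQ _] := Hs Q Qs.
have /andP[] := fP P Ps; have /andP[] := fP Q Qs; rewrite fi fj => l1 u1 l2 u2.
apply: pell_val_inj => //; first exact: Hdet.
  by apply: lt_le_trans u2 _; rewrite exprS ler_pM2l.
by apply: lt_le_trans u1 _; rewrite exprS ler_pM2l.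
Qed.

End PellPositive.

(** For negative [D], [A ^ 2 - D * B ^ 2 = 4] confines [A] and [B] to -2 .. 2, and the quotient by
    [P0] determines the solution. *)
Lemma pell_negative_count (D n : int) (s : seq (int * int)) : D < 0 -> n != 0 -> uniq s ->
    {in s, forall P, pell D n P} ->
    {in s &, forall P Q, (n %| 2%R * pell_det P Q)%Z} -> (size s <= 25)%N.
Proof.
move=> D0 n0 us Hs Hdet; case es : s => [//|P0 s'].
rewrite -es; have P0s : P0 \in s by rewrite es mem_head.
pose five : seq int := [:: -2; -1; 0; 1; 2].
pose f (Q : int * int) := ((2 * (P0.2 * Q.2 - D * P0.1 * Q.1) %/ n)%Z, (2 * pell_det P0 Q %/ n)%Z).
have -> : 25%N = (size [seq (a, b) | a <- five, b <- five] * 1)%N by [].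
apply: (@size_le_classes _ _ s f) => [Q Qs|i _].
  have [A [B [eA eB eAB]]] := pell_quotient n0 (eqP (Hs _ P0s)) (eqP (Hs _ Qs)) (Hdet _ _ P0s Qs).
  rewrite /f eA /pell_det eB !mulKz //.
  have hB : (B == -2) || (B == -1) || (B == 0) || (B == 1) || (B == 2) by nia.
  have hA : (A == -2) || (A == -1) || (A == 0) || (A == 1) || (A == 2) by nia.
  by apply/allpairsP; exists (A, B); split => //=; rewrite !inE /= -!orbA in hA hB *.
apply: size_le1; first exact: filter_uniq.
move=> P Q; rewrite !mem_filter => /andP[/eqP fi Ps] /andP[/eqP fj Qs].
have [A [B [eA eB eAB]]] := pell_quotient n0 (eqP (Hs _ P0s)) (eqP (Hs _ Ps)) (Hdet _ _ P0s Ps).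
have [A' [B' [eA' eB' _]]] := pell_quotient n0 (eqP (Hs _ P0s)) (eqP (Hs _ Qs)) (Hdet _ _ P0s Qs).
have : f P = f Q by rewrite fi fj.
rewrite /f /pell_det eA eB eA' eB' !mulKz // => -[eAA eBB].
have h0 := eqP (Hs _ P0s).
rewrite -eAA in eA'; rewrite -eBB in eB'; rewrite -eA' in eA; rewrite -eB' in eB.
case: P Q {Ps Qs fi fj eA' eB'} eA eB => X Y [X' Y'] /= eA eB.
have eX : n * X = n * X'.
  rewrite -h0; apply: (mulfI (_ : 2 != 0 :> int)) => //.
  have -> : 2 * ((P0.2 ^+ 2 - D * P0.1 ^+ 2) * X) =
    P0.1 * (2 * (P0.2 * Y - D * P0.1 * X)) - P0.2 * (2 * (P0.1 * Y - X * P0.2)) by ring.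
  by rewrite eA eB; ring.
have eY : n * Y = n * Y'.
  rewrite -h0; apply: (mulfI (_ : 2 != 0 :> int)) => //.
  have -> : 2 * ((P0.2 ^+ 2 - D * P0.1 ^+ 2) * Y) =
    P0.2 * (2 * (P0.2 * Y - D * P0.1 * X)) - D * P0.1 * (2 * (P0.1 * Y - X * P0.2)) by ring.
  by rewrite eA eB; ring.
by rewrite (mulfI n0 eX) (mulfI n0 eY).
Qed.

Lemma tau_dvd d n : (0 < n)%N -> (d %| n)%N -> (tau d <= tau n)%N.
Proof.
move=> n0 dn; apply: uniq_leq_size (divisors_uniq _) _ => k.
have d0 := dvdn_gt0 n0 dn; rewrite -!dvdn_divisors // => kd; exact: dvdn_trans kd dn.
Qed.

(** The gcd labels at most [tau] classes. For positive [D] each class is split by the signs of the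
    coordinates, since size separates only solutions with nonnegative coordinates. *)
Lemma pell_prim_count (R : rcfType) (D n : int) (s : seq (int * int)) T :
    squarefreez D -> D != 0 -> n != 0 -> uniq s ->
    {in s, forall P, [/\ pell D n P, coprimez P.1 P.2 & (`|P.2| + `|P.1| * `|D| < 2 ^ T)%N]} ->
  (size s <= tau `|n| * (4 * T + 25))%N.
Proof.
move=> sf D0 n0 us Hs; case es : s => [//|P0 s']; rewrite -es.
have P0s : P0 \in s by rewrite es mem_head.
have [h0 c0 _] := Hs _ P0s; have nn0 : (0 < `|n|)%N by rewrite absz_gt0.
pose g (P : int * int) := `|gcdz n (P0.1 * P.2 - P.1 * P0.2)|%N.
apply: (@size_le_classes _ _ s g) => [P Ps|i _].
  by rewrite -dvdn_divisors // dvdn_gcdl.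
set s1 := seq.filter _ _.
have us1 : uniq s1 by apply: filter_uniq.
have Hs1 : {in s1, forall P, [/\ pell D n P, coprimez P.1 P.2 & (`|P.2| + `|P.1| * `|D| < 2 ^ T)%N]}.
  by move=> P; rewrite mem_filter => /andP[_ /Hs].
have Hdet : {in s1 &, forall P Q, (n %| 2%R * pell_det P Q)%Z}.
  move=> P Q; rewrite !mem_filter => /andP[/eqP gP Ps] /andP[/eqP gQ Qs].
  have [hP cP _] := Hs _ Ps; have [hQ cQ _] := Hs _ Qs.
  apply: (pell_same_class sf n0 (eqP h0) (eqP hP) (eqP hQ) c0 cP).
  by rewrite /gcdz; congr Posz; move: gP gQ; rewrite /g /= => -> ->.
have [Dneg|Dpos|De] := ltgtP D 0; last by rewrite De eqxx in D0.
  apply: leq_trans (pell_negative_count Dneg n0 us1 _ Hdet) _; last by rewrite leq_addl.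
  by move=> P /Hs1[].
apply: leq_trans (_ : 4 * T <= _)%N; last by rewrite leq_addr.
pose b (P : int * int) := (0 <= P.1, 0 <= P.2).
apply: (@size_le_classes _ _ s1 b [:: (true, true); (true, false); (false, true); (false, false)]) => [P _|[b1 b2] _].
  by rewrite /b !inE; case: (0 <= P.1); case: (0 <= P.2).
set s2 := seq.filter _ _.
have H2 P : P \in s2 -> [/\ P \in s1, (0 <= P.1) = b1 & (0 <= P.2) = b2].
  by rewrite mem_filter => /andP[/eqP[<- <-]].
pose ab (P : int * int) : int * int := (`|P.1|, `|P.2|).
have sgnE (x : int) (c : bool) : (0 <= x) = c -> x = (if c then 1 else -1) * `|x|.
  by move=> <-; case: ltP => h; rewrite ?mul1r ?mulN1r; [rewrite ltr0_norm ?opprK | rewrite ger0_norm].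
rewrite -(size_map ab); apply: (@pell_positive_count R D n) => //.
- rewrite map_inj_in_uniq ?filter_uniq // => P Q /H2[_ p1 p2] /H2[_ q1 q2] eab.
  apply: injective_projections.
    by rewrite (sgnE _ _ p1) (sgnE _ _ q1) (congr1 fst eab : `|P.1| = `|Q.1|).
  by rewrite (sgnE _ _ p2) (sgnE _ _ q2) (congr1 snd eab : `|P.2| = `|Q.2|).
- move=> _ /mapP[P /H2[Ps _ _] ->]; have [hP _ bP] := Hs1 _ Ps.
  split; rewrite ?normr_ge0 //; first by move: hP; rewrite /pell /= !real_normK ?num_real.
  have r1 := r_ge1 R Dpos; have rr := sqr_r R Dpos.
  rewrite /pell_val /=; set r := Num.sqrt _ in r1 rr *.
  apply: (@le_lt_trans _ _ ((`|P.2| + `|P.1| * `|D|)%:~R)); last first.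
    by rewrite -!abszE -[_ + _]/((_ + _)%N%:Z) -natrX ltr_nat.
  rewrite rmorphD rmorphM /= lerD // ler_wpM2l ?ler0z //.
  by rewrite gtr0_norm // -rr expr2 -[X in X <= _]mulr1 ler_wpM2l // (le_trans ler01).
move=> _ _ /mapP[P /H2[Ps p1 p2] ->] /mapP[Q /H2[Qs q1 q2] ->].
pose sg (c : bool) : int := if c then 1 else -1.
have sgsg c : sg c * sg c = 1 by case: c.
have -> : 2%R * pell_det (ab P) (ab Q) = sg b1 * sg b2 * (2%R * pell_det P Q).
  rewrite /pell_det /= (sgnE _ _ p1) (sgnE _ _ q2) (sgnE _ _ p2) (sgnE _ _ q1) -!/(sg _).
  rewrite !normrM !normr_id.
  have ns c : `|sg c| = 1 by case: c.
  rewrite !ns !mul1r; move: (`|P.1|) (`|P.2|) (`|Q.1|) (`|Q.2|) => x y x' y'.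
  transitivity ((sg b1 * sg b1) * (sg b2 * sg b2) * (2%R * (x * y' - x' * y))); last by ring.
  by rewrite !sgsg !mul1r.
by rewrite dvdz_mull // Hdet.
Qed.

(** The square part of [D] is absorbed into [X]. One factor [tau] counts the possible gcds of the
    coordinates, whose squares divide [n]; the other counts classes. *)
Theorem pell_count (R : rcfType) (D n : int) (s : seq (int * int)) T :
    D != 0 -> n != 0 -> uniq s ->
    {in s, forall P, pell D n P /\ (`|P.2| + `|P.1| * `|D| < 2 ^ T)%N} ->
  (size s <= tau `|n| ^ 2 * (4 * T + 25))%N.
Proof.
move=> D0 n0 us Hs; have nn0 : (0 < `|n|)%N by rewrite absz_gt0.
have [f [D1 [f0 eD sf]]] := squarefree_part D0.
have D10 : D1 != 0 by apply: contraNneq D0 => e; rewrite eD e mulr0.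
pose fs (P : int * int) := (f * P.1, P.2).
rewrite -(size_map fs); set s1 := map fs s.
have us1 : uniq s1.
  by rewrite map_inj_uniq // => -[x y] [x' y'] [/(mulfI f0) -> ->].
have {us}Hs1 : {in s1, forall P, pell D1 n P /\ (`|P.2| + `|P.1| * `|D1| < 2 ^ T)%N}.
  move=> _ /mapP[[x y] /Hs[/= hP bP] ->]; split.
    rewrite -(eqP hP) /pell /= eD; apply/eqP; ring.
  apply: leq_ltn_trans bP; rewrite leq_add2l eD expr2 !abszM.
  have f1 : (0 < `|f|)%N by rewrite absz_gt0.
  by rewrite (_ : (`|x| * _ = `|f| * `|x| * `|D1| * `|f|)%N) ?leq_pmulr //; ring.
pose e (P : int * int) := `|gcdz P.1 P.2|%N.
have e_dvd P : pell D1 n P -> (((e P)%:Z) ^+ 2 %| n)%Z.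
  move=> /eqP <-; have h1 : (((e P)%:Z) %| P.1)%Z by apply: dvdz_gcdl.
  have h2 : (((e P)%:Z) %| P.2)%Z by apply: dvdz_gcdr.
  by apply: rpredB; [apply: dvdz_exp2r | apply: dvdz_mull; apply: dvdz_exp2r].
rewrite -mulnn -mulnA.
apply: (@size_le_classes _ _ s1 e) => [P /Hs1[hP _]|i idv].
  rewrite -dvdn_divisors //; have := e_dvd P hP; rewrite dvdzE abszX /=.
  by apply: dvdn_trans; rewrite dvdn_exp.
rewrite -dvdn_divisors // in idv; have i0 := dvdn_gt0 nn0 idv.
have iz : i%:Z != 0 by case: (i) i0.
set s2 := seq.filter _ _.
case es2 : s2 => [//|P0 s2']; rewrite -es2.
have : P0 \in s2 by rewrite es2 mem_head.
rewrite mem_filter => /andP[/eqP eP0 /Hs1[hP0 _]].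
have := e_dvd _ hP0; rewrite eP0 => /dvdzP[n1 en1].
have n10 : n1 != 0 by apply: contraNneq n0 => h; rewrite en1 h mul0r.
pose dv (P : int * int) := ((P.1 %/ i)%Z, (P.2 %/ i)%Z).
have H2 P : P \in s2 -> [/\ P \in s1, P.1 = (dv P).1 * i%:Z, P.2 = (dv P).2 * i%:Z & coprimez (dv P).1 (dv P).2].
  rewrite mem_filter => /andP[/eqP eP Ps].
  have d1 : (i%:Z %| P.1)%Z by rewrite -eP; apply: dvdz_gcdl.
  have d2 : (i%:Z %| P.2)%Z by rewrite -eP; apply: dvdz_gcdr.
  have e1 : P.1 = (dv P).1 * i%:Z by rewrite /dv /= divzK.
  have e2 : P.2 = (dv P).2 * i%:Z by rewrite /dv /= divzK.
  split=> //; have : e P = i by []. 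
  rewrite /e e1 e2.
  rewrite /coprimez /gcdz !abszM /= -muln_gcdl => h; apply/eqP; congr Posz.
  by apply/eqP; rewrite -(eqn_pmul2r i0) h mul1n.
rewrite -(size_map dv).
apply: leq_trans (_ : tau `|n1| * (4 * T + 25) <= _)%N; last first.
  rewrite leq_mul2r; apply/orP; right; apply: tau_dvd => //.
  by rewrite en1 abszM dvdn_mulr.
apply: (@pell_prim_count R D1) => //.
- rewrite map_inj_in_uniq ?filter_uniq // => P Q /H2[_ p1 p2 _] /H2[_ q1 q2 _] ePQ.
  by rewrite [P]surjective_pairing [Q]surjective_pairing p1 p2 q1 q2 ePQ.
move=> _ /mapP[P /H2[Ps p1 p2 cP] ->]; have [/eqP hP bP] := Hs1 _ Ps; split => //.
  apply/eqP; apply: (mulIf (expf_neq0 2 iz)); rewrite -en1 -hP.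
  by rewrite [in RHS]p1 [in RHS]p2; ring.
apply: leq_ltn_trans bP; rewrite [in X in (_ <= X)%N]p1 [in X in (_ <= X)%N]p2 !abszM /=.
by rewrite leq_add ?leq_pmulr // leq_mul2r leq_pmulr ?orbT.
Qed.

(** * From conics to Pell equations *)

Definition bracket (R : pzRingType) (P Q S : R * R) : R :=
  (Q.1 - P.1) * (S.2 - P.2) - (S.1 - P.1) * (Q.2 - P.2).

Definition no_three_collinear (s : seq (int * int)) :=
  {in s & &, forall P Q S, P != Q -> P != S -> Q != S -> bracket P Q S != 0}.

Definition conic (c : int * int * int * (int * int * int)) (P : int * int) : int :=
  let: (al, be, ga, (de, ep, ze)) := c in
  al * P.1 ^+ 2 + be * P.1 * P.2 + ga * P.2 ^+ 2 + de * P.1 + ep * P.2 + ze.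

Lemma size_le2 (T : eqType) (s : seq T) : uniq s ->
  (forall x y z, x \in s -> y \in s -> z \in s -> x != y -> x != z -> y != z -> False) ->
  (size s <= 2)%N.
Proof.
case: s => [|x [|y [|z s]]] //= /and3P[]; rewrite !inE !negb_or => /and3P[xy xz _] /andP[yz _] _ H.
by exfalso; apply: (H x y z) => //; rewrite !inE eqxx ?orbT.
Qed.

Lemma size_collinear_le2 (s : seq (int * int)) (a b c : int) : uniq s -> no_three_collinear s ->
  (a != 0) -> {in s, forall P, a * P.1 + b * P.2 = c} -> (size s <= 2)%N.
Proof.
move=> us ncol a0 H; apply: size_le2 => // P Q S Ps Qs Ss PQ PS QS.
have := ncol _ _ _ Ps Qs Ss PQ PS QS; apply/negP/negPn.
rewrite -(inj_eq (mulfI a0)) mulr0 /bracket; apply/eqP.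
have hP := H _ Ps; have hQ := H _ Qs; have hS := H _ Ss.
transitivity ((a * Q.1 + b * Q.2 - (a * P.1 + b * P.2)) * (S.2 - P.2)
   - (a * S.1 + b * S.2 - (a * P.1 + b * P.2)) * (Q.2 - P.2)); first by ring.
by rewrite hP hQ hS subrr !mul0r subrr.
Qed.

Lemma sub_no_three (s s' : seq (int * int)) : {subset s' <= s} ->
  no_three_collinear s -> no_three_collinear s'.
Proof. by move=> sub H P Q S /sub Ps /sub Qs /sub Ss; apply: H. Qed.

Lemma normM_le (x y a b : int) : `|x| <= a -> `|y| <= b -> `|x * y| <= a * b.
Proof. by move=> hx hy; rewrite normrM ler_pM. Qed.

Lemma normD_le (x y a b : int) : `|x| <= a -> `|y| <= b -> `|x + y| <= a + b.
Proof. by move=> hx hy; apply: le_trans (ler_normD _ _) _; apply: lerD. Qed.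

Lemma normB_le (x y a b : int) : `|x| <= a -> `|y| <= b -> `|x - y| <= a + b.
Proof. by move=> hx hy; apply: normD_le; rewrite ?normrN. Qed.

(** Completing squares turns the conic into [v ^ 2 - D * u ^ 2 = n]. For [n = 0] the points lie on
    two lines [v = c * u] and [v = - c * u], or all map to the origin, and a line carries at most
    two of them. *)
Lemma conic_count_main (R : rcfType) (al be ga de ep ze : int) (s : seq (int * int)) (B T : nat) :
    al != 0 -> be ^+ 2 - 4 * al * ga != 0 -> uniq s -> no_three_collinear s ->
    {in s, forall P, conic (al, be, ga, (de, ep, ze)) P = 0} ->
    {in s, forall P, `|P.1| <= B%:Z /\ `|P.2| <= B%:Z} ->
    (0 < B)%N -> all (fun c => `|c| <= B%:Z) [:: al; be; ga; de; ep; ze] ->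
    (28 * B ^ 4 < 2 ^ T)%N ->
  exists2 n, (0 < n <= 34 * B ^ 4)%N & (size s <= 4 + tau n ^ 2 * (4 * T + 25))%N.
Proof.
move=> al0 D0 us ncol Hs Hb B0 Hc BT.
set D := be ^+ 2 - 4 * al * ga in D0.
pose e := 2 * al * ep - be * de.
pose n := e ^+ 2 + D * (4 * al * ze - de ^+ 2).
pose h (P : int * int) := (2 * al * P.1 + be * P.2 + de, D * P.2 - e).
have hn P : P \in s -> (h P).2 ^+ 2 - D * (h P).1 ^+ 2 = n.
  move=> /Hs /= F0; rewrite /h /= /n.
  apply/eqP; rewrite -subr_eq0; apply/eqP.
  transitivity (- 4 * al * D * (al * P.1 ^+ 2 + be * P.1 * P.2 + ga * P.2 ^+ 2 + de * P.1 + ep * P.2 + ze)).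
    by rewrite /D /e; ring.
  by rewrite F0 mulr0.
have h_inj : {in s &, injective h}.
  move=> [x y] [x' y'] _ _; rewrite /h /= => -[e1 e2].
  have ey : y = y' by apply: (mulfI D0); apply: (addIr (- e)).
  rewrite ey in e1; congr (_, _) => //; apply: (mulfI (_ : 2 * al != 0)).
    by rewrite mulf_neq0.
  by move/addIr/addIr: e1.
have uh : uniq (map h s) by rewrite map_inj_in_uniq.
have /and5P[al_le be_le ga_le de_le /and3P[ep_le ze_le _]] := Hc.
set b : int := B%:Z in Hb al_le be_le ga_le de_le ep_le ze_le.
have eB4 : (B ^ 4)%N%:Z = b ^+ 4 by rewrite -[LHS]natz natrX natz.
have b1 : 1 <= b by rewrite lez_nat.
have c2 : `|2 : int| <= 2 by []. have c4 : `|4 : int| <= 4 by [].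
have D_le : `|D| <= 5 * b ^+ 2.
  apply: le_trans (normB_le (normM_le be_le be_le) (normM_le (normM_le c4 al_le) ga_le)) _.
  by rewrite le_eqVlt; apply/orP; left; apply/eqP; ring.
have e_le : `|e| <= 3 * b ^+ 2.
  apply: le_trans (normB_le (normM_le (normM_le c2 al_le) ep_le) (normM_le be_le de_le)) _.
  by rewrite le_eqVlt; apply/orP; left; apply/eqP; ring.
have n_le : (`|n| <= 34 * B ^ 4)%N.
  rewrite -lez_nat abszE; apply: le_trans (normD_le (normM_le e_le e_le) (normM_le D_le
    (normB_le (normM_le (normM_le c4 al_le) ze_le) (normM_le de_le de_le)))) _.
  rewrite PoszM eB4 le_eqVlt; apply/orP; left; apply/eqP; ring.
have val_le P : P \in s -> (`|(h P).2| + `|(h P).1| * `|D| <= 28 * B ^ 4)%N.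
  move=> /Hb[x_le y_le]; rewrite -lez_nat PoszD PoszM !abszE /h /=.
  have h1 : `|2 * al * P.1 + be * P.2 + de| <= 4 * b ^+ 2.
    apply: le_trans (normD_le (normD_le (normM_le (normM_le c2 al_le) x_le) (normM_le be_le y_le)) de_le) _.
    have -> : 4 * b ^+ 2 = 2 * b * b + b * b + b * b by ring.
    by rewrite lerD2l ler_peMl // (le_trans _ b1).
  have h2 : `|D * P.2 - e| <= 8 * b ^+ 3.
    by apply: le_trans (normB_le (normM_le D_le y_le) e_le) _;
       rewrite -subr_ge0 (_ : _ - _ = 3 * b ^+ 2 * (b - 1)); [rewrite !mulr_ge0 ?exprn_ge0 ?subr_ge0 ?(le_trans _ b1) | ring].
  apply: le_trans (lerD h2 (ler_pM (normr_ge0 _) (normr_ge0 _) h1 D_le)) _.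
  rewrite PoszM eB4.
  have : b ^+ 3 * 1 <= b ^+ 3 * b by rewrite ler_wpM2l // exprn_ge0 // (le_trans _ b1).
  rewrite mulr1 -exprSr => h3.
  have -> : 4 * b ^+ 2 * (5 * b ^+ 2) = 20 * b ^+ 4 by ring.
  by move: h3; move: (b ^+ 3) (b ^+ 4) => u v; clear; lia.
have [nn|nn] := eqVneq n 0; last first.
  exists `|n|%N; first by rewrite absz_gt0 nn.
  apply: leq_trans (leq_addl _ _); rewrite -(size_map h).
  apply: (@pell_count R D) => // _ /mapP[P Ps ->]; split; first by rewrite /pell hn.
  by apply: leq_ltn_trans BT; apply: val_le.
exists 1%N; first by rewrite muln_gt0 expn_gt0 B0.
apply: leq_trans (leq_addr _ _).
have [/hasP[P0 P0s X0]|/hasPn none] := boolP (has (fun P => (h P).1 != 0) s); last first.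
  apply: leq_trans (_ : 1 <= 4)%N => //; apply: size_le1 => // P Q Ps Qs.
  have zero S : S \in s -> h S = (0, 0).
    move=> Ss; have := none S Ss; rewrite negbK => /eqP h1; have := hn S Ss.
    rewrite h1 nn expr0n /= mulr0 subr0 => /eqP; rewrite sqrf_eq0 => /eqP h2.
    by apply: injective_projections; [exact: h1 | exact: h2].
  by apply: h_inj => //; rewrite !zero.
have e0 := hn _ P0s.
set X0v := (h P0).1 in X0 e0; set Y0v := (h P0).2 in e0.
have Y0n : Y0v != 0.
  apply: contraNneq X0 => Y0e; move: e0; rewrite Y0e nn expr0n /= sub0r => /eqP.
  by rewrite oppr_eq0 mulf_eq0 (negPf D0) /= sqrf_eq0.
pose cl P := (h P).2 * X0v == (h P).1 * Y0v.
rewrite (_ : 4 = size [:: true; false] * 2)%N //.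
apply: (@size_le_classes _ _ s cl) => [P _|bl _]; first by rewrite !inE; case: (cl P).
set s1 := seq.filter _ _.
have sub1 : {subset s1 <= s} by move=> P; rewrite mem_filter => /andP[].
pose sg : int := if bl then 1 else -1.
have line P : P \in s1 -> (h P).2 * X0v = sg * ((h P).1 * Y0v).
  rewrite mem_filter => /andP[/eqP cP Ps].
  have := hn P Ps; rewrite nn => /eqP; rewrite subr_eq0 => /eqP hP.
  move: e0; rewrite nn => /eqP; rewrite subr_eq0 => /eqP h0.
  have : ((h P).2 * X0v) ^+ 2 == ((h P).1 * Y0v) ^+ 2.
    by rewrite !exprMn hP h0; apply/eqP; ring.
  rewrite eqf_sqr -/(cl P) cP /sg; case: (bl) cP => /= [/eqP -> _|_ /eqP ->]; first by rewrite mul1r.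
  by rewrite mulN1r.
apply: (@size_collinear_le2 s1 (sg * 2 * al * Y0v) (sg * be * Y0v - D * X0v) (- e * X0v - sg * de * Y0v)).
- exact: filter_uniq.
- exact: sub_no_three sub1 ncol.
- by rewrite !mulf_neq0 // /sg; case: (bl).
move=> P /line; rewrite /h /= => hl; apply/eqP; rewrite -subr_eq0; apply/eqP.
transitivity (sg * ((2 * al * P.1 + be * P.2 + de) * Y0v) - (D * P.2 - e) * X0v); first by ring.
by rewrite hl subrr.
Qed.

Lemma no_three_map (f : int * int -> int * int) (s : seq (int * int)) : injective f ->
    (forall P Q S, bracket P Q S != 0 -> bracket (f P) (f Q) (f S) != 0) ->
  no_three_collinear s -> no_three_collinear (map f s).
Proof.
move=> f_inj fb H _ _ _ /mapP[P Ps ->] /mapP[Q Qs ->] /mapP[S Ss ->].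
by rewrite !(inj_eq f_inj) => PQ PS QS; apply: fb; apply: H.
Qed.

(** If [al = 0], the coordinates are exchanged or, if [ga = 0] too, sheared by [(x, y - x)]. The
    shear doubles the height, whence [448 = 28 * 2 ^ 4] and [544 = 34 * 2 ^ 4]. *)
Lemma conic_count (R : rcfType) (al be ga de ep ze : int) (s : seq (int * int)) (B T : nat) :
    be ^+ 2 - 4 * al * ga != 0 -> uniq s -> no_three_collinear s ->
    {in s, forall P, conic (al, be, ga, (de, ep, ze)) P = 0} ->
    {in s, forall P, `|P.1| <= B%:Z /\ `|P.2| <= B%:Z} ->
    (0 < B)%N -> all (fun c => `|c| <= B%:Z) [:: al; be; ga; de; ep; ze] ->
    (448 * B ^ 4 < 2 ^ T)%N ->
  exists2 n, (0 < n <= 544 * B ^ 4)%N & (size s <= 4 + tau n ^ 2 * (4 * T + 25))%N.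
Proof.
move=> D0 us ncol Hs Hb B0 Hc BT.
have /and5P[al_le be_le ga_le de_le /and3P[ep_le ze_le _]] := Hc.
have weak n : (0 < n <= 34 * B ^ 4)%N -> (0 < n <= 544 * B ^ 4)%N.
  by move=> /andP[-> h] /=; apply: leq_trans h _; rewrite leq_mul2r orbT.
have BT' : (28 * B ^ 4 < 2 ^ T)%N by apply: leq_ltn_trans BT; rewrite leq_mul2r orbT.
have [al0|al0] := eqVneq al 0; last first.
  have [n /weak hn sn] := conic_count_main R al0 D0 us ncol Hs Hb B0 Hc BT'.
  by exists n.
have [ga0|ga0] := eqVneq ga 0; last first.
  pose sw (P : int * int) := (P.2, P.1).
  have sw_inj : injective sw by move=> [x y] [x' y'] [-> ->].
  have [||||||n /weak hn] := @conic_count_main R ga be al ep de ze (map sw s) B T ga0 _ _ _ _ _ B0 _ BT'.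
  - by rewrite mulrAC.
  - by rewrite map_inj_uniq.
  - apply: no_three_map ncol => // P Q S; rewrite /bracket /= => h.
    rewrite (_ : _ - _ = - ((Q.1 - P.1) * (S.2 - P.2) - (S.1 - P.1) * (Q.2 - P.2))) ?oppr_eq0 //.
    ring.
  - move=> _ /mapP[P /Hs /= hP ->]; rewrite /= -[RHS]hP; ring.
  - by move=> _ /mapP[P /Hb[h1 h2] ->].
  - by rewrite /= ga_le be_le al_le ep_le de_le ze_le.
  by rewrite size_map => sn; exists n.
have be0 : be != 0.
  by apply: contraNneq D0 => ->; rewrite al0 expr0n /= mulr0 mul0r subrr.
pose sh (P : int * int) := (P.1, P.2 - P.1).
have sh_inj : injective sh by move=> [x y] [x' y'] [-> /addIr ->].
have B2 : (0 < 2 * B)%N by rewrite muln_gt0.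
have le2 (x y : int) : `|x| <= B%:Z -> `|y| <= B%:Z -> `|x + y| <= (2 * B)%N%:Z.
  by move=> hx hy; rewrite mul2n -addnn PoszD; apply: normD_le.
have le1 (x : int) : `|x| <= B%:Z -> `|x| <= (2 * B)%N%:Z.
  by move=> hx; apply: le_trans hx _; rewrite lez_nat leq_pmull.
have BT2 : (28 * (2 * B) ^ 4 < 2 ^ T)%N by rewrite expnMn mulnA.
have [||||||n hn] := @conic_count_main R be be 0 (de + ep) ep ze (map sh s) (2 * B) T be0 _ _ _ _ _ B2 _ BT2.
- by rewrite mulr0 subr0 expf_neq0.
- by rewrite map_inj_uniq.
- apply: no_three_map ncol => // P Q S; rewrite /bracket /= => h.
  by rewrite (_ : _ - _ = (Q.1 - P.1) * (S.2 - P.2) - (S.1 - P.1) * (Q.2 - P.2)) //; ring.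
- move=> _ /mapP[P /Hs /= hP ->]; rewrite /= -[RHS]hP al0 ga0; ring.
- move=> _ /mapP[P /Hb[h1 h2] ->] /=; split; first exact: le1.
  by apply: le2; rewrite ?normrN.
- by rewrite /= le2 // !le1.
rewrite size_map => sn; exists n => //; move: hn; rewrite expnMn mulnA; exact.
Qed.

(** * The conic through five points of the hyperbola *)

Lemma zmod_eq0 (m : nat) (x : int) : (1 < m)%N -> (x%:~R == 0 :> 'Z_m) = (m%:Z %| x)%Z.
Proof.
move=> m1; have nat_case (n : nat) : (n%:R == 0 :> 'Z_m) = (m %| n)%N.
  by rewrite -val_eqE /= (val_Zp_nat m1) /dvdn.
rewrite dvdzE /= -nat_case; case: x => n //=.
by rewrite NegzE rmorphN /= oppr_eq0.
Qed.

Section FivePointConic.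
Variable R : comPzRingType.
Implicit Types P Q S : R * R.

(* The conic through [P1, ..., P5]. *)
Definition five_conic (P1 P2 P3 P4 P5 Q : R * R) : R :=
  bracket P1 P2 P3 * bracket P1 P4 P5 * bracket P2 P4 Q * bracket P3 P5 Q
  - bracket P1 P2 P4 * bracket P1 P3 P5 * bracket P2 P3 Q * bracket P4 P5 Q.

(** Each linear factor is [bracket P Q X = u P Q * X.2 - v P Q * X.1 + w P Q]. *)
Definition five_coefs (P1 P2 P3 P4 P5 : R * R) : R * R * R * (R * R * R) :=
  let c1 := bracket P1 P2 P3 * bracket P1 P4 P5 in
  let c2 := bracket P1 P2 P4 * bracket P1 P3 P5 in
  let u P Q := Q.1 - P.1 in let v P Q := Q.2 - P.2 in
  let w P Q := v P Q * P.1 - u P Q * P.2 in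
  (c1 * v P2 P4 * v P3 P5 - c2 * v P2 P3 * v P4 P5,
   c2 * (u P2 P3 * v P4 P5 + v P2 P3 * u P4 P5) - c1 * (u P2 P4 * v P3 P5 + v P2 P4 * u P3 P5),
   c1 * u P2 P4 * u P3 P5 - c2 * u P2 P3 * u P4 P5,
   (c2 * (v P2 P3 * w P4 P5 + w P2 P3 * v P4 P5) - c1 * (v P2 P4 * w P3 P5 + w P2 P4 * v P3 P5),
    c1 * (u P2 P4 * w P3 P5 + w P2 P4 * u P3 P5) - c2 * (u P2 P3 * w P4 P5 + w P2 P3 * u P4 P5),
    c1 * w P2 P4 * w P3 P5 - c2 * w P2 P3 * w P4 P5)).

Variables (A U : R).
Hypothesis AU : A * U = 1.
Variable hyp : R * R -> Prop.
Hypothesis hypP : forall P, hyp P -> P.1 * P.2 = A.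

Let inv P := P.2 * U.

Lemma snd_hyp P : hyp P -> P.2 = A * inv P.
Proof. by move=> h; rewrite /inv mulrCA AU mulr1. Qed.

Lemma fst_hyp P : hyp P -> P.1 * inv P = 1.
Proof. by move=> h; rewrite /inv mulrA hypP. Qed.

Lemma diff_hyp P Q : hyp P -> hyp Q -> Q.2 - P.2 = A * (P.1 - Q.1) * (inv P * inv Q).
Proof.
move=> hP hQ; rewrite (snd_hyp hP) (snd_hyp hQ).
transitivity (A * (P.1 * inv P * inv Q - Q.1 * inv Q * inv P)); last by ring.
by rewrite !fst_hyp // !mul1r mulrBr.
Qed.

(** Up to a unit, a bracket on [x * y = A] is the Vandermonde product of the abscissas. The two
    products in [five_conic] then consist of the same differences. *)
Lemma bracket_hyp P Q S : hyp P -> hyp Q -> hyp S -> bracket P Q S =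
  A * ((Q.1 - P.1) * (P.1 - S.1) * (Q.1 - S.1)) * (inv P * inv Q * inv S).
Proof.
move=> hP hQ hS; rewrite /bracket (diff_hyp hP hS) (diff_hyp hP hQ).
have e : inv S - inv Q = (Q.1 - S.1) * (inv Q * inv S).
  transitivity (Q.1 * inv Q * inv S - S.1 * inv S * inv Q); last by ring.
  by rewrite !fst_hyp // !mul1r.
transitivity (A * (Q.1 - P.1) * (P.1 - S.1) * inv P * (inv S - inv Q)); first by ring.
by rewrite e; ring.
Qed.

Lemma five_conic_hyp P1 P2 P3 P4 P5 Q :
  hyp P1 -> hyp P2 -> hyp P3 -> hyp P4 -> hyp P5 -> hyp Q -> five_conic P1 P2 P3 P4 P5 Q = 0.
Proof.
move=> h1 h2 h3 h4 h5 hQ; rewrite /five_conic.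
rewrite (bracket_hyp h1 h2 h3) (bracket_hyp h1 h4 h5) (bracket_hyp h2 h4 hQ) (bracket_hyp h3 h5 hQ).
rewrite (bracket_hyp h1 h2 h4) (bracket_hyp h1 h3 h5) (bracket_hyp h2 h3 hQ) (bracket_hyp h4 h5 hQ).
ring.
Qed.

Lemma five_coef_xx_hyp P1 P2 P3 P4 P5 : hyp P1 -> hyp P2 -> hyp P3 -> hyp P4 -> hyp P5 ->
  (five_coefs P1 P2 P3 P4 P5).1.1.1 = 0.
Proof.
move=> h1 h2 h3 h4 h5; rewrite /=.
rewrite (bracket_hyp h1 h2 h3) (bracket_hyp h1 h4 h5) (bracket_hyp h1 h2 h4) (bracket_hyp h1 h3 h5).
rewrite (diff_hyp h2 h4) (diff_hyp h3 h5) (diff_hyp h2 h3) (diff_hyp h4 h5); ring.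
Qed.

Lemma five_coef_yy_hyp P1 P2 P3 P4 P5 : hyp P1 -> hyp P2 -> hyp P3 -> hyp P4 -> hyp P5 ->
  (five_coefs P1 P2 P3 P4 P5).1.2 = 0.
Proof.
move=> h1 h2 h3 h4 h5; rewrite /=.
rewrite (bracket_hyp h1 h2 h3) (bracket_hyp h1 h4 h5) (bracket_hyp h1 h2 h4) (bracket_hyp h1 h3 h5).
ring.
Qed.

End FivePointConic.

Lemma five_conicE (P1 P2 P3 P4 P5 Q : int * int) :
  five_conic P1 P2 P3 P4 P5 Q = conic (five_coefs P1 P2 P3 P4 P5) Q.
Proof. rewrite /five_conic /conic /five_coefs /bracket; ring. Qed.

Lemma five_coefs_le (P1 P2 P3 P4 P5 : int * int) (b : int) : 1 <= b ->
    {in [:: P1; P2; P3; P4; P5], forall P, 0 <= P.1 <= b /\ 0 <= P.2 <= b} ->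
  let: (al, be, ga, (de, ep, ze)) := five_coefs P1 P2 P3 P4 P5 in
  all (fun c => `|c| <= 32 * b ^+ 8) [:: al; be; ga; de; ep; ze].
Proof.
move=> b1 H.
have b0 : 0 <= b by apply: le_trans b1.
have dl (x y : int) : 0 <= x <= b -> 0 <= y <= b -> `|x - y| <= b by rewrite ler_norml; lia.
have cl (x : int) : 0 <= x <= b -> `|x| <= b by move=> /andP[x0 xb]; rewrite ger0_norm.
have [/= [x1 y1] [x2 y2] [x3 y3] [x4 y4] [x5 y5]] :
    [/\ (0 <= P1.1 <= b /\ 0 <= P1.2 <= b), (0 <= P2.1 <= b /\ 0 <= P2.2 <= b),
        (0 <= P3.1 <= b /\ 0 <= P3.2 <= b), (0 <= P4.1 <= b /\ 0 <= P4.2 <= b)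
      & (0 <= P5.1 <= b /\ 0 <= P5.2 <= b)].
  by split; apply: H; rewrite !inE eqxx ?orbT.
have br_le P Q S : 0 <= P.1 <= b -> 0 <= P.2 <= b -> 0 <= Q.1 <= b -> 0 <= Q.2 <= b ->
    0 <= S.1 <= b -> 0 <= S.2 <= b -> `|bracket P Q S| <= 2 * b ^+ 2.
  move=> *; rewrite /bracket; apply: le_trans (normB_le (normM_le (dl _ _ _ _) (dl _ _ _ _))
    (normM_le (dl _ _ _ _) (dl _ _ _ _))) _ => //.
  by rewrite le_eqVlt; apply/orP; left; apply/eqP; ring.
have w_le P Q : 0 <= P.1 <= b -> 0 <= P.2 <= b -> 0 <= Q.1 <= b -> 0 <= Q.2 <= b ->
    `|(Q.2 - P.2) * P.1 - (Q.1 - P.1) * P.2| <= 2 * b ^+ 2.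
  move=> *; apply: le_trans (normB_le (normM_le (dl _ _ _ _) (cl _ _))
    (normM_le (dl _ _ _ _) (cl _ _))) _ => //.
  by rewrite le_eqVlt; apply/orP; left; apply/eqP; ring.
rewrite /five_coefs.
have c1_le : `|bracket P1 P2 P3 * bracket P1 P4 P5| <= (2 * b ^+ 2) * (2 * b ^+ 2).
  by apply: normM_le; apply: br_le.
have c2_le : `|bracket P1 P2 P4 * bracket P1 P3 P5| <= (2 * b ^+ 2) * (2 * b ^+ 2).
  by apply: normM_le; apply: br_le.
have up k j : (k <= j)%N -> b ^+ k <= b ^+ j by move=> ?; apply: ler_weXn2l.
have u24 := dl _ _ x4 x2; have u35 := dl _ _ x5 x3; have u23 := dl _ _ x3 x2; have u45 := dl _ _ x5 x4.
have v24 := dl _ _ y4 y2; have v35 := dl _ _ y5 y3; have v23 := dl _ _ y3 y2; have v45 := dl _ _ y5 y4.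
have w24 := w_le _ _ x2 y2 x4 y4; have w35 := w_le _ _ x3 y3 x5 y5.
have w23 := w_le _ _ x2 y2 x3 y3; have w45 := w_le _ _ x4 y4 x5 y5.
move: (bracket P1 P2 P3 * _) (bracket P1 P2 P4 * _) c1_le c2_le => c1 c2 c1_le c2_le.
have fin (k : nat) (c x : int) : (k <= 8)%N -> 0 <= c <= 32 -> `|x| <= c * b ^+ k -> `|x| <= 32 * b ^+ 8.
  move=> k8 /andP[c0 c32] h; apply: le_trans h _.
  by apply: ler_pM => //; [rewrite exprn_ge0 | apply: up].
apply/and5P; split; [apply: (fin 6%N 8) | apply: (fin 6%N 16) | apply: (fin 6%N 8) |
  apply: (fin 7%N 32) | rewrite /= andbT; apply/andP; split; [apply: (fin 7%N 32) | apply: (fin 8%N 32)]] => //.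
- apply: le_trans (normB_le (normM_le (normM_le c1_le v24) v35) (normM_le (normM_le c2_le v23) v45)) _.
  by rewrite le_eqVlt; apply/orP; left; apply/eqP; ring.
- apply: le_trans (normB_le (normM_le c2_le (normD_le (normM_le u23 v45) (normM_le v23 u45)))
    (normM_le c1_le (normD_le (normM_le u24 v35) (normM_le v24 u35)))) _.
  by rewrite le_eqVlt; apply/orP; left; apply/eqP; ring.
- apply: le_trans (normB_le (normM_le (normM_le c1_le u24) u35) (normM_le (normM_le c2_le u23) u45)) _.
  by rewrite le_eqVlt; apply/orP; left; apply/eqP; ring.
- apply: le_trans (normB_le (normM_le c2_le (normD_le (normM_le v23 w45) (normM_le w23 v45)))
    (normM_le c1_le (normD_le (normM_le v24 w35) (normM_le w24 v35)))) _.
  by rewrite le_eqVlt; apply/orP; left; apply/eqP; ring.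
- apply: le_trans (normB_le (normM_le c1_le (normD_le (normM_le u24 w35) (normM_le w24 u35)))
    (normM_le c2_le (normD_le (normM_le u23 w45) (normM_le w23 u45)))) _.
  by rewrite le_eqVlt; apply/orP; left; apply/eqP; ring.
- apply: le_trans (normB_le (normM_le (normM_le c1_le w24) w35) (normM_le (normM_le c2_le w23) w45)) _.
  by rewrite le_eqVlt; apply/orP; left; apply/eqP; ring.
Qed.

Theorem cell_count (R : rcfType) (m : nat) (a : int) (s : seq (int * int)) (Dl T : nat) :
    (1 < m)%N -> coprimez a m%:Z -> uniq s -> no_three_collinear s ->
    {in s, forall P, [/\ 0 <= P.1 <= m%:Z, 0 <= P.2 <= m%:Z & (m%:Z %| P.1 * P.2 - a)%Z]} ->
    {in s & &, forall P Q S, `|bracket P Q S| <= Dl%:Z} ->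
    (2 * Dl ^ 4 < kernel_nat m)%N -> (448 * (32 * m ^ 8) ^ 4 < 2 ^ T)%N ->
  exists2 n, (0 < n <= 544 * (32 * m ^ 8) ^ 4)%N & (size s <= 4 + tau n ^ 2 * (4 * T + 25))%N.
Proof.
move=> m1 co us ncol Hs Hbr Dlm mT; have m0 := ltnW m1.
have [s4|s5] := leqP (size s) 4.
  exists 1%N; last by apply: leq_trans s4 (leq_addr _ _).
  by rewrite /= muln_gt0 !expn_gt0 muln_gt0 expn_gt0 m0.
case es : s s5 => [|P1 [|P2 [|P3 [|P4 [|P5 s']]]]] // _; rewrite -es.
have [i1 i2 i3 i4 i5] : [/\ P1 \in s, P2 \in s, P3 \in s, P4 \in s & P5 \in s].
  by rewrite es !inE !eqxx ?orbT.
have [/and5P[n12 n13 n14 n15 _] /and4P[n23 n24 n25 _] /and3P[n34 n35 _] /andP[n45 _]] :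
    [/\ [&& P1 != P2, P1 != P3, P1 != P4, P1 != P5 & P1 \notin s'],
        [&& P2 != P3, P2 != P4, P2 != P5 & P2 \notin s'],
        [&& P3 != P4, P3 != P5 & P3 \notin s'] & (P4 != P5) && (P4 \notin s')].
  move: us; rewrite es /= !inE !negb_or => /andP[h1 /andP[h2 /andP[h3 /andP[h4 _]]]].
  by split.
pose phi (P : int * int) : 'Z_m * 'Z_m := (P.1%:~R, P.2%:~R).
have /coprimezP[[u v] /= uv] := co.
have AU : a%:~R * u%:~R = 1 :> 'Z_m.
  rewrite -intrM -[RHS]/(1%:~R); apply/eqP; rewrite -subr_eq0 -intrB zmod_eq0 //.
  by rewrite -uv (_ : a * u - (u * a + v * m%:Z) = - v * m%:Z) ?dvdz_mull //; ring.
pose hyp (P : 'Z_m * 'Z_m) := P.1 * P.2 = a%:~R.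
have phi_hyp P : P \in s -> hyp (phi P).
  move=> /Hs[_ _ d]; rewrite /hyp /phi /= -intrM; apply/eqP.
  by rewrite -subr_eq0 -intrB zmod_eq0.
have brk P Q S : bracket (phi P) (phi Q) (phi S) = (bracket P Q S)%:~R.
  by rewrite /bracket /= !(intrB, intrM).
have kle : (kernel_nat m <= m)%N by apply: dvdn_leq (kernel_dvd m0).
have small (k : nat) (x : int) : (k%:Z %| x)%Z -> (`|x| < k)%N -> x = 0.
  move=> d lt; apply/eqP; rewrite -absz_eq0; apply: contraTT d; rewrite -lt0n dvdzE => x0.
  by rewrite /= gtnNdvd.
have F0 : {in s, forall P, conic (five_coefs P1 P2 P3 P4 P5) P = 0}.
  move=> P Ps; rewrite -five_conicE; apply: (small m).
    rewrite -zmod_eq0 //.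
    have <- : five_conic (phi P1) (phi P2) (phi P3) (phi P4) (phi P5) (phi P)
       = (five_conic P1 P2 P3 P4 P5 P)%:~R.
      by rewrite /five_conic !brk !(intrB, intrM).
    by rewrite (five_conic_hyp AU (hyp := hyp)) //; apply: phi_hyp.
  apply: leq_trans kle; apply: leq_ltn_trans Dlm; rewrite -lez_nat abszE.
  apply: le_trans (normB_le (normM_le (normM_le (normM_le (Hbr _ _ _ i1 i2 i3) (Hbr _ _ _ i1 i4 i5))
     (Hbr _ _ _ i2 i4 Ps)) (Hbr _ _ _ i3 i5 Ps)) (normM_le (normM_le (normM_le (Hbr _ _ _ i1 i2 i4)
     (Hbr _ _ _ i1 i3 i5)) (Hbr _ _ _ i2 i3 Ps)) (Hbr _ _ _ i4 i5 Ps))) _.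
  by rewrite -!PoszM -PoszD lez_nat eq_leq //; ring.
have xx0 : (m%:Z %| (five_coefs P1 P2 P3 P4 P5).1.1.1)%Z.
  rewrite -zmod_eq0 //.
  have <- : (five_coefs (phi P1) (phi P2) (phi P3) (phi P4) (phi P5)).1.1.1
     = (five_coefs P1 P2 P3 P4 P5).1.1.1%:~R.
    by rewrite /five_coefs /= !brk !(intrB, intrM).
  by rewrite (five_coef_xx_hyp AU (hyp := hyp)) //; apply: phi_hyp.
have yy0 : (m%:Z %| (five_coefs P1 P2 P3 P4 P5).1.2)%Z.
  rewrite -zmod_eq0 //.
  have <- : (five_coefs (phi P1) (phi P2) (phi P3) (phi P4) (phi P5)).1.2
     = (five_coefs P1 P2 P3 P4 P5).1.2%:~R.
    by rewrite /five_coefs /= !brk !(intrB, intrM).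
  by rewrite (five_coef_yy_hyp AU (hyp := hyp)) //; apply: phi_hyp.
(* In the direction from [P2] to [P4] the quadratic part of the first product vanishes, and that of
   the second is a product of brackets. *)
have top : (five_coefs P1 P2 P3 P4 P5).1.1.1 * (P4.1 - P2.1) ^+ 2
     + (five_coefs P1 P2 P3 P4 P5).1.1.2 * (P4.1 - P2.1) * (P4.2 - P2.2)
     + (five_coefs P1 P2 P3 P4 P5).1.2 * (P4.2 - P2.2) ^+ 2
   = bracket P1 P2 P4 * bracket P1 P3 P5 * bracket P2 P3 P4 * bracket P4 P5 P2.
  rewrite /five_coefs /bracket /=; ring.
have b1 : 1 <= m%:Z by rewrite lez_nat.
have coef_le : let: (al, be, ga, (de, ep, ze)) := five_coefs P1 P2 P3 P4 P5 in
    all (fun c => `|c| <= (32 * m ^ 8)%N%:Z) [:: al; be; ga; de; ep; ze].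
  have -> : (32 * m ^ 8)%N%:Z = 32 * m%:Z ^+ 8 by rewrite PoszM -[Posz (m ^ 8)]natz natrX natz.
  apply: five_coefs_le => // P Pin.
  have /Hs[] // : P \in s.
  by rewrite es -[P1 :: _]/([:: P1; P2; P3; P4; P5] ++ s') mem_cat Pin.
case: (five_coefs P1 P2 P3 P4 P5) F0 xx0 yy0 top coef_le => [[[al be] ga] [[de ep] ze]] /=.
move=> F0 xx0 yy0 top coef_le.
(* Otherwise [m] divides [be ^ 2], so the kernel divides [be] and with it the value in [top], which
   is nonzero and at most [Dl ^ 4] in absolute value. *)
have D0 : be ^+ 2 - 4 * al * ga != 0.
  apply/eqP => /eqP; rewrite subr_eq0 => /eqP ebe.
  have kdm : ((kernel_nat m)%:Z %| m%:Z)%Z by rewrite dvdzE /= kernel_dvd.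
  have kbe : ((kernel_nat m)%:Z %| be)%Z.
    rewrite dvdzE /=; apply: kernel_dvd_sqr => //; rewrite -abszX ebe.
    by have : (m%:Z %| 4 * al * ga)%Z by rewrite -mulrA mulrCA dvdz_mulr.
  have := small (kernel_nat m) _ _ _; move/(_ (al * (P4.1 - P2.1) ^+ 2
     + be * (P4.1 - P2.1) * (P4.2 - P2.2) + ga * (P4.2 - P2.2) ^+ 2)) => sm.
  have : bracket P1 P2 P4 * bracket P1 P3 P5 * bracket P2 P3 P4 * bracket P4 P5 P2 != 0.
    have ne P Q S : P \in s -> Q \in s -> S \in s -> P != Q -> P != S -> Q != S -> bracket P Q S != 0.
      by move=> *; apply: ncol.
    by rewrite !mulf_neq0 // ne // eq_sym.
  case/eqP; rewrite -top; apply: sm.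
    rewrite !rpredD //; first by rewrite dvdz_mulr // (dvdz_trans kdm).
      by rewrite -mulrA dvdz_mulr.
    by rewrite dvdz_mulr // (dvdz_trans kdm).
  rewrite top; apply: leq_ltn_trans Dlm; rewrite -lez_nat abszE.
  apply: le_trans (normM_le (normM_le (normM_le (Hbr _ _ _ i1 i2 i4) (Hbr _ _ _ i1 i3 i5))
     (Hbr _ _ _ i2 i3 i4)) (Hbr _ _ _ i4 i5 i2)) _.
  by rewrite -!PoszM lez_nat (_ : (Dl * Dl * Dl * Dl = Dl ^ 4)%N) ?leq_pmull //; ring.
have m80 : (0 < 32 * m ^ 8)%N by rewrite muln_gt0 expn_gt0 m0.
apply: (conic_count R D0 us ncol F0 _ m80 coef_le mT) => P /Hs[/andP[x0 xm] /andP[y0 ym] _].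
have m8 : m%:Z <= (32 * m ^ 8)%N%:Z.
  by rewrite lez_nat expnS mulnCA leq_pmulr // muln_gt0 expn_gt0 m0.
by rewrite !ger0_norm // (le_trans xm) // (le_trans ym).
Qed.

(** * Counting and geometry of the hull *)

Section SlopeClasses.
Variable R : archiRealFieldType.
Implicit Types (s : seq (int * int)) (P Q S : int * int).

Let dx P Q : R := Q.1%:~R - P.1%:~R.
Let dy P Q : R := Q.2%:~R - P.2%:~R.

Lemma bracket_real P Q S : (bracket P Q S)%:~R = dx P Q * dy P S - dx P S * dy P Q :> R.
Proof. by rewrite /bracket /dx /dy !(rmorphB, rmorphM). Qed.

(* The cell indices of the abscissa and of the supporting slope are comonotone, so
   their sum determines both. *)
Lemma slope_classes s (sl : int * int -> R) (x0 sl0 h w : R) (J Dl K : nat) :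
    uniq s -> 0 < h -> 0 < w ->
    {in s, forall P, 0 <= (P.1%:~R - x0) / h <= J%:R} ->
    {in s, forall P, 0 <= (sl P - sl0) / w <= J%:R} ->
    {in s &, forall P Q, sl P * dx P Q <= dy P Q} ->
    2 * w * h ^+ 2 <= Dl%:R ->
    (forall s', uniq s' -> {subset s' <= s} ->
       {in s' & &, forall P Q S, `|bracket P Q S| <= Dl%:Z} -> (size s' <= K)%N) ->
  (size s <= (2 * J).+1 * K)%N.
Proof.
move=> us h0 w0 Hx Hsl Hsup HDl HK.
pose ix P := Num.truncn ((P.1%:~R - x0) / h).
pose ik P := Num.truncn ((sl P - sl0) / w).
have ixP P : P \in s -> (ix P)%:R * h <= P.1%:~R - x0 < (ix P).+1%:R * h.
  move=> /Hx/andP[h1 _]; have /andP[] := truncn_itv h1.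
  by rewrite ler_pdivlMr // ltr_pdivrMr // => -> ->.
have ikP P : P \in s -> (ik P)%:R * w <= sl P - sl0 < (ik P).+1%:R * w.
  move=> /Hsl/andP[h1 _]; have /andP[] := truncn_itv h1.
  by rewrite ler_pdivlMr // ltr_pdivrMr // => -> ->.
have sup2 P Q : P \in s -> Q \in s -> dy P Q <= sl Q * dx P Q.
  by move=> Ps Qs; have := Hsup Q P Qs Ps; rewrite /dx /dy; lra.
have mono P Q : P \in s -> Q \in s -> P.1 < Q.1 -> (ix P <= ix Q)%N /\ (ik P <= ik Q)%N.
  move=> Ps Qs; rewrite -(ltr_int R) => xx.
  have d0 : 0 < dx P Q by rewrite subr_gt0.
  have ss : sl P <= sl Q.
    by rewrite -(ler_pM2r d0); apply: le_trans (Hsup P Q Ps Qs) (sup2 P Q Ps Qs).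
  by split; apply: le_truncn; rewrite ler_pM2r ?invr_gt0 //; lra.
rewrite -[(2 * J).+1](size_iota 0).
apply: (@size_le_classes _ _ s (fun P => ix P + ik P)%N) => [P Ps|c _].
  rewrite mem_iota add0n /= ltnS mul2n -addnn leq_add // truncn_le_nat.
    by have /andP[_ h1] := Hx P Ps; apply: le_lt_trans h1 _; rewrite ltr_nat.
  by have /andP[_ h1] := Hsl P Ps; apply: le_lt_trans h1 _; rewrite ltr_nat.
have memf P : P \in [seq x <- s | (ix x + ik x == c)%N] -> P \in s /\ (ix P + ik P = c)%N.
  by rewrite mem_filter => /andP[/eqP].
apply: HK => [|P|]; [exact: filter_uniq | by move/memf => [] | ].
have same P Q : P \in [seq x <- s | (ix x + ik x == c)%N] ->
    Q \in [seq x <- s | (ix x + ik x == c)%N] -> ix P = ix Q /\ ik P = ik Q.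
  move=> /memf[Ps eP] /memf[Qs eQ]; have [xx|xx|xx] := ltgtP P.1 Q.1.
  - by have [] := mono P Q Ps Qs xx; lia.
  - by have [] := mono Q P Qs Ps xx; lia.
  have e : ix P = ix Q by rewrite /ix xx.
  by split => //; lia.
have dxle P Q : P \in [seq x <- s | (ix x + ik x == c)%N] ->
    Q \in [seq x <- s | (ix x + ik x == c)%N] -> `|dx P Q| <= h.
  move=> Pf Qf; have [Ps _] := memf _ Pf; have [Qs _] := memf _ Qf.
  have [e _] := same _ _ Pf Qf; have := ixP P Ps; have := ixP Q Qs; rewrite e -natr1 /dx ler_norml.
  move=> /andP[? ?] /andP[? ?]; apply/andP; split; lra.
have slle P Q : P \in [seq x <- s | (ix x + ik x == c)%N] ->
    Q \in [seq x <- s | (ix x + ik x == c)%N] -> `|sl Q - sl P| <= w.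
  move=> Pf Qf; have [Ps _] := memf _ Pf; have [Qs _] := memf _ Qf.
  have [_ e] := same _ _ Pf Qf; have := ikP P Ps; have := ikP Q Qs; rewrite e -natr1 ler_norml.
  move=> /andP[? ?] /andP[? ?]; apply/andP; split; lra.
(* The supporting lines at [P] and [Q] trap [dy P Q - sl P * dx P Q] between 0 and
   [(sl Q - sl P) * dx P Q]. *)
have zle P Q : P \in [seq x <- s | (ix x + ik x == c)%N] ->
    Q \in [seq x <- s | (ix x + ik x == c)%N] -> `|dy P Q - sl P * dx P Q| <= w * h.
  move=> Pf Qf; have [Ps _] := memf _ Pf; have [Qs _] := memf _ Qf.
  rewrite ger0_norm ?subr_ge0 ?Hsup //.
  apply: (@le_trans _ _ ((sl Q - sl P) * dx P Q)).
    by rewrite mulrBl lerD2r sup2.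
  apply: le_trans (ler_norm _) _; rewrite normrM ler_pM //; [exact: slle | exact: dxle].
move=> P Q S Pf Qf Sf.
rewrite -(ler_int R) intr_norm bracket_real; apply: le_trans HDl.
have -> : dx P Q * dy P S - dx P S * dy P Q =
   dx P Q * (dy P S - sl P * dx P S) - dx P S * (dy P Q - sl P * dx P Q) by ring.
apply: le_trans (ler_normB _ _) _; rewrite !normrM.
have -> : 2 * w * h ^+ 2 = h * (w * h) + h * (w * h) by ring.
by apply: lerD; apply: ler_pM => //; [exact: dxle | exact: zle | exact: dxle | exact: zle].
Qed.

(** Slopes lie between [- V / U] and [V / U]. Cells of width [U / J] and slope range [2 V / (U J)]
    bound the brackets by [4 U V / J ^ 3]. *)
Lemma rect_count_lower s (nu : int * int -> R * R) (x0 U V : R) (J Dl K : nat) :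
    uniq s -> 0 < U -> 0 < V -> (0 < J)%N -> 4 * U * V <= Dl%:R * J%:R ^+ 3 ->
    {in s, forall P, x0 <= P.1%:~R <= x0 + U} ->
    {in s, forall P, `|(nu P).1| * U <= (nu P).2 * V /\ 0 < (nu P).2} ->
    {in s &, forall P Q, 0 <= (nu P).1 * dx P Q + (nu P).2 * dy P Q} ->
    (forall s', uniq s' -> {subset s' <= s} ->
       {in s' & &, forall P Q S, `|bracket P Q S| <= Dl%:Z} -> (size s' <= K)%N) ->
  (size s <= (2 * J).+1 * K)%N.
Proof.
move=> us U0 V0 J0 HD Hx Hnu Hsup HK.
have JR : 0 < J%:R :> R by rewrite ltr0n.
pose sl P := - (nu P).1 / (nu P).2.
have sl_le P : P \in s -> - (V / U) <= sl P <= V / U.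
  move=> /Hnu[h1 h2]; rewrite -ler_norml /sl normrM normrN normfV (gtr0_norm h2).
  by rewrite ler_pdivrMr // mulrAC ler_pdivlMr // mulrC [V * _]mulrC; rewrite mulrC in h1.
apply: (@slope_classes s sl x0 (- (V / U)) (U / J%:R) (2 * V / (U * J%:R)) J Dl K) => //.
- by rewrite divr_gt0.
- by rewrite divr_gt0 // mulr_gt0.
- move=> P /Hx/andP[h1 h2]; rewrite invf_div; apply/andP; split.
    by rewrite mulr_ge0 ?subr_ge0 // divr_ge0 // ltW.
  rewrite mulrA ler_pdivrMr // mulrC ler_pM2l //; lra.
- move=> P /sl_le/andP[h1 h2]; rewrite opprK invf_div; apply/andP; split.
    by rewrite mulr_ge0 ?divr_ge0 ?mulr_ge0 ?(ltW U0) ?(ltW V0) ?(ltW JR) //; lra.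
  rewrite [X in _ <= X](_ : _ = (V / U + V / U) * (U * J%:R / (2 * V))); last first.
    by field; rewrite !gt_eqF.
  by rewrite ler_pM2r ?divr_gt0 ?mulr_gt0 //; lra.
- move=> P Q Ps Qs; have [_ n2] := Hnu P Ps; have := Hsup P Q Ps Qs.
  rewrite -(pmulr_rge0 _ (_ : 0 < (nu P).2^-1)) ?invr_gt0 // => hs.
  rewrite -subr_ge0; apply: le_trans hs _; rewrite le_eqVlt; apply/orP; left; apply/eqP.
  by rewrite /sl; field; rewrite gt_eqF.
have -> : 2 * (2 * V / (U * J%:R)) * (U / J%:R) ^+ 2 = 4 * U * V / J%:R ^+ 3.
  by field; rewrite !gt_eqF.
by rewrite ler_pdivrMr // exprn_gt0.
Qed.

(** Four cases, by the coordinate of the normal that dominates in the proportions of the rectangle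
    and by its sign; reflections and the exchange of coordinates bring each to
    [rect_count_lower]. *)
Lemma rect_count s (nu : int * int -> R * R) (x0 y0 U V : R) (J Dl K : nat) :
    uniq s -> 0 < U -> 0 < V -> (0 < J)%N -> 4 * U * V <= Dl%:R * J%:R ^+ 3 ->
    {in s, forall P, x0 <= P.1%:~R <= x0 + U /\ y0 <= P.2%:~R <= y0 + V} ->
    {in s, forall P, nu P != (0, 0)} ->
    {in s &, forall P Q, 0 <= (nu P).1 * dx P Q + (nu P).2 * dy P Q} ->
    (forall s', uniq s' -> {subset s' <= s} ->
       {in s' & &, forall P Q S, `|bracket P Q S| <= Dl%:Z} -> (size s' <= K)%N) ->
  (size s <= 4 * ((2 * J).+1 * K))%N.
Proof.
move=> us U0 V0 J0 HD Hbox Hnz Hsup HK.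
pose f P := (`|(nu P).1| * U <= `|(nu P).2| * V, (if `|(nu P).1| * U <= `|(nu P).2| * V then 0 < (nu P).2 else 0 < (nu P).1)).
apply: (@size_le_classes _ _ s f [:: (true, true); (true, false); (false, true); (false, false)]) => [P _|[b1 b2] _].
  by rewrite /f !inE; case: ifP; case: ltP.
set s1 := seq.filter _ _.
have us1 : uniq s1 by apply: filter_uniq.
have mem1 P : P \in s1 -> P \in s /\ f P = (b1, b2).
  by rewrite mem_filter => /andP[/eqP].
have D' : 4 * V * U <= Dl%:R * J%:R ^+ 3 by rewrite mulrAC.
have gen (g : int * int -> int * int) (nu' : int * int -> R * R) (x0' U' V' : R) :
    involutive g -> 0 < U' -> 0 < V' -> 4 * U' * V' <= Dl%:R * J%:R ^+ 3 ->
    (forall P Q S, `|bracket (g P) (g Q) (g S)| = `|bracket P Q S|) ->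
    {in s1, forall P, x0' <= (g P).1%:~R <= x0' + U'} ->
    {in s1, forall P, `|(nu' (g P)).1| * U' <= (nu' (g P)).2 * V' /\ 0 < (nu' (g P)).2} ->
    {in s1 &, forall P Q, 0 <= (nu' (g P)).1 * dx (g P) (g Q) + (nu' (g P)).2 * dy (g P) (g Q)} ->
    (size s1 <= (2 * J).+1 * K)%N.
  move=> gK U'0 V'0 HD' gbr h1 h2 h3; rewrite -(size_map g).
  apply: (@rect_count_lower (map g s1) nu' x0' U' V' J Dl K) => //.
  - by rewrite map_inj_uniq //; apply: inv_inj.
  - by move=> _ /mapP[P Ps ->]; apply: h1.
  - by move=> _ /mapP[P Ps ->]; apply: h2.
  - by move=> _ _ /mapP[P Ps ->] /mapP[Q Qs ->]; apply: h3.
  move=> s' us' sub br; rewrite -(size_map g); apply: HK.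
  - by rewrite map_inj_uniq //; apply: inv_inj.
  - move=> _ /mapP[Q /sub/mapP[P /mem1[Ps _] ->] ->]; by rewrite gK.
  move=> _ _ _ /mapP[P Ps ->] /mapP[Q Qs ->] /mapP[S Ss ->].
  by rewrite gbr; apply: br.
have fE P : P \in s1 -> (`|(nu P).1| * U <= `|(nu P).2| * V) = b1 /\
    (if b1 then 0 < (nu P).2 else 0 < (nu P).1) = b2.
  by move=> /mem1[_ [<- <-]].
have nz P : P \in s1 -> ((nu P).1 == 0) && ((nu P).2 == 0) = false.
  by move=> /mem1[/Hnz h _]; move: h; rewrite -pair_eqE => /negbTE.
have n2_neq0 P : P \in s1 -> b1 -> (nu P).2 != 0.
  move=> Ps hb; have [h1 _] := fE P Ps; rewrite hb in h1.
  have := nz P Ps; apply: contraFneq => n2; rewrite n2 eqxx andbT.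
  move: h1; rewrite n2 normr0 mul0r => h1.
  by rewrite -normr_le0 -(pmulr_lle0 _ U0).
have n1_neq0 P : P \in s1 -> b1 = false -> (nu P).1 != 0.
  move=> Ps hb; have [h1 _] := fE P Ps; rewrite hb in h1.
  apply: contraFneq h1 => ->; by rewrite normr0 mul0r mulr_ge0 // ltW.
have intN (x : int) : (- x)%:~R = - x%:~R :> R by rewrite rmorphN.
clearbody s1.
case: b1 b2 fE mem1 n2_neq0 n1_neq0 => -[] fE mem1 n2_neq0 n1_neq0.
- apply: (gen id nu x0 U V) => // P.
  + by move=> /mem1[/Hbox[]].
  + by move=> Ps; have [h1 h2] := fE P Ps; rewrite (gtr0_norm h2) in h1.
  + by move=> Q /mem1[Ps _] /mem1[Qs _]; apply: Hsup.
- apply: (gen (fun P => (P.1, - P.2)) (fun P => let n := nu (P.1, - P.2) in (n.1, - n.2)) x0 U V) => //.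
  + by move=> [x y] /=; rewrite opprK.
  + by move=> P Q S; rewrite -normrN /bracket /=; congr (`|_|); ring.
  + by move=> P /mem1[/Hbox[]].
  + move=> P Ps /=; rewrite opprK -surjective_pairing; have [h1 h2] := fE P Ps.
    have n2 : (nu P).2 < 0 by rewrite lt_neqAle n2_neq0 //= leNgt h2.
    by rewrite (ltr0_norm n2) in h1; rewrite oppr_gt0.
  + move=> P Q /mem1[Ps _] /mem1[Qs _] /=; rewrite opprK -surjective_pairing.
    apply: le_trans (Hsup P Q Ps Qs) _; rewrite /dx /dy /= !intN.
    by rewrite le_eqVlt; apply/orP; left; apply/eqP; ring.
- apply: (gen (fun P => (P.2, P.1)) (fun P => let n := nu (P.2, P.1) in (n.2, n.1)) y0 V U) => //.
  + by move=> [x y].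
  + by move=> P Q S; rewrite -normrN /bracket /=; congr (`|_|); ring.
  + by move=> P /mem1[/Hbox[]].
  + move=> P Ps /=; rewrite -surjective_pairing; have [h1 h2] := fE P Ps.
    by move/negbT: h1; rewrite -ltNge (gtr0_norm h2) => /ltW.
  + move=> P Q /mem1[Ps _] /mem1[Qs _] /=; rewrite -surjective_pairing.
    apply: le_trans (Hsup P Q Ps Qs) _; rewrite /dx /dy /=.
    by rewrite le_eqVlt; apply/orP; left; apply/eqP; ring.
apply: (gen (fun P => (- P.2, - P.1)) (fun P => let n := nu (- P.2, - P.1) in (- n.2, - n.1)) (- y0 - V) V U) => //.
- by move=> [x y] /=; rewrite !opprK.
- by move=> P Q S; rewrite -normrN /bracket /=; congr (`|_|); ring.
- by move=> P /mem1[/Hbox[_ /andP[h1 h2]] _] /=; rewrite intN; apply/andP; split; lra.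
- move=> P Ps /=; rewrite !opprK -surjective_pairing; have [h1 h2] := fE P Ps.
  have n1 : (nu P).1 < 0 by rewrite lt_neqAle n1_neq0 //= leNgt h2.
  by move/negbT: h1; rewrite -ltNge (ltr0_norm n1) normrN oppr_gt0 => /ltW.
move=> P Q /mem1[Ps _] /mem1[Qs _] /=; rewrite !opprK -surjective_pairing.
apply: le_trans (Hsup P Q Ps Qs) _; rewrite /dx /dy /= !intN.
by rewrite le_eqVlt; apply/orP; left; apply/eqP; ring.
Qed.

End SlopeClasses.

(** * Supporting lines at extreme points *)

Lemma seq_max_exists (R : realDomainType) (x : R) (s : seq R) :
  exists2 y, y \in x :: s & {in x :: s, forall z, z <= y}.
Proof.
elim: s x => [|a s IH] x; first by exists x; rewrite ?mem_head // => z; rewrite inE => /eqP ->.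
have [y ys hy] := IH a; have [xy|yx] := leP x y.
  by exists y => [|z]; rewrite inE ?ys ?orbT // => /orP[/eqP->|/hy].
exists x => [|z]; first exact: mem_head.
by rewrite inE => /orP[/eqP->//|/hy zy]; apply: le_trans zy (ltW yx).
Qed.

Lemma separating_exists (R : realDomainType) (lo hi : seq R) :
  {in lo & hi, forall l h, l <= h} ->
  exists x, {in lo, forall l, l <= x} /\ {in hi, forall h, x <= h}.
Proof.
move=> H; case: lo H => [|l0 lo] H.
  case: hi H => [|h0 hi] _; first by exists 0.
  have [y _ hy] := seq_max_exists (- h0) (map (@GRing.opp R) hi).
  exists (- y); split => // h hh; rewrite lerNl; apply: hy.
  by rewrite -[_ :: _]/(map (@GRing.opp R) (h0 :: hi)) map_f.
have [y ylo hy] := seq_max_exists l0 lo.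
by exists y; split => // h hh; apply: H.
Qed.

(** Helly in dimension one: a vector with nonzero abscissa bounds [n] on one side. If a lower bound
    exceeds an upper bound, the segment between the two vectors crosses the negative vertical
    axis. *)
Lemma lower_support_or_below (R : realFieldType) (v : seq (R * R)) :
  (exists n, {in v, forall w, 0 <= n * w.1 + w.2}) \/
  (exists a b t, [/\ a \in v, b \in v, 0 <= t <= 1, t * a.1 + (1 - t) * b.1 = 0
     & t * a.2 + (1 - t) * b.2 < 0]).
Proof.
have [/hasP[w wv /andP[/eqP w1 w2]]|/hasPn none] := boolP (has (fun w : R * R => (w.1 == 0) && (w.2 < 0)) v).
  by right; exists w, w, 1; rewrite w1 subrr !mul0r !mulr0 !addr0 mul1r lexx ler01.
pose lo := [seq - w.2 / w.1 | w <- v & 0 < w.1].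
pose hi := [seq - w.2 / w.1 | w <- v & w.1 < 0].
have [/allrelP H|] := boolP (allrel <=%R lo hi).
  have [n [hlo hhi]] := separating_exists H; left; exists n => w wv.
  have [w1|w1|w1] := ltgtP w.1 0.
  - have : n <= - w.2 / w.1 by apply: hhi; apply: map_f; rewrite mem_filter w1.
    by rewrite ler_ndivlMr // -subr_ge0 opprK addrC.
  - have : - w.2 / w.1 <= n by apply: hlo; apply: map_f; rewrite mem_filter w1.
    by rewrite ler_pdivrMr // -subr_ge0 opprK.
  by have := none w wv; rewrite w1 eqxx /= -leNgt mulr0 add0r.
case/allPn => x /mapP[w]; rewrite mem_filter => /andP[w1 wv] ->.
case/allPn => y /mapP[u]; rewrite mem_filter => /andP[u1 uv] ->; rewrite -ltNge => lt.
have d0 : 0 < w.1 - u.1 by rewrite subr_gt0; apply: lt_trans u1 w1.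
have dn : w.1 - u.1 != 0 by rewrite gt_eqF.
have e1 : 1 - (- u.1 / (w.1 - u.1)) = w.1 / (w.1 - u.1) by field.
right; exists w, u, (- u.1 / (w.1 - u.1)); rewrite e1; split => //.
- apply/andP; split; first by rewrite divr_ge0 ?oppr_ge0 // ltW.
  by rewrite ler_pdivrMr // mul1r; lra.
- by field.
have -> : - u.1 / (w.1 - u.1) * w.2 + w.1 / (w.1 - u.1) * u.2
    = (w.1 * u.2 - u.1 * w.2) / (w.1 - u.1) by field.
rewrite pmulr_llt0 ?invr_gt0 // subr_lt0.
move: lt; rewrite ltr_ndivrMr // mulrAC ltr_pdivrMr //; lra.
Qed.

Section ExtremePoints.
Variables (R : realType) (A : set (plane R)).
Implicit Types x y p : plane R.

Lemma hull_sub x : A x -> convex_hull A x.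
Proof. by move=> Ax C [_]; apply. Qed.

Lemma hull_convex x y (t : R) : 0 <= t <= 1 -> convex_hull A x -> convex_hull A y ->
  convex_hull A (t * x.1 + (1 - t) * y.1, t * x.2 + (1 - t) * y.2).
Proof.
move=> /andP[t0 t1] hx hy C [cC AC].
have := cC x y (Itv01 t0 t1) (mem_set (hx C (conj cC AC))) (mem_set (hy C (conj cC AC))).
by move/set_mem.
Qed.

Lemma extreme_not_between p x y (t : R) : extreme_points (convex_hull A) p ->
  convex_hull A x -> convex_hull A y -> 0 < t < 1 ->
  p = (t * x.1 + (1 - t) * y.1, t * x.2 + (1 - t) * y.2) -> x = p /\ y = p.
Proof.
move=> [_ H] hx hy /andP[t0 t1] e.
by apply: (H x y (Itv01 (ltW t0) (ltW t1))) => //; rewrite ?t0 ?t1.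
Qed.

End ExtremePoints.

Section HyperbolaVertices.
Variables (R : realType) (a : int) (m : nat).
Let H := modular_hyperbola a m.

(** If [P] had no supporting line from below and none from above, the hull would contain points
    strictly below and strictly above [P] on one vertical line. *)
Lemma extreme_support (P : int * int) : hull_vertices R a m (int_point R P) ->
  exists nu : R * R, nu != (0, 0) /\ forall Q, H Q ->
    0 <= nu.1 * (Q.1%:~R - P.1%:~R) + nu.2 * (Q.2%:~R - P.2%:~R).
Proof.
move=> ext; have [l Hl] : exists l : seq (int * int), forall Q, (Q \in l) <-> H Q.
  by have /finite_seqP[l el] := finite_modular_hyperbola a m; exists l => Q; rewrite /H el.
pose vec (sg : R) (Q : int * int) : R * R := (Q.1%:~R - P.1%:~R, sg * (Q.2%:~R - P.2%:~R)).
have [[n hn]|[q1 [q2 [t [/mapP[Q1 /Hl h1 ->] /mapP[Q2 /Hl h2 ->] t01 ex ey]]]]] := lower_support_or_below (map (vec 1) l).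
  exists (n, 1); split; first by rewrite -pair_eqE /pair_eq /= oner_eq0 andbF.
  by move=> Q /Hl Ql; apply: hn (map_f (vec 1) Ql).
have [[n hn]|[q3 [q4 [t' [/mapP[Q3 /Hl h3 ->] /mapP[Q4 /Hl h4 ->] t01' ex' ey']]]]] := lower_support_or_below (map (vec (-1)) l).
  exists (n, -1); split; first by rewrite -pair_eqE /pair_eq /= oppr_eq0 oner_eq0 andbF.
  by move=> Q /Hl Ql; apply: hn (map_f (vec (-1)) Ql).
exfalso; rewrite /vec /= in ex ey ex' ey'.
have hull Q : H Q -> hyperbola_hull R a m (int_point R Q).
  by move=> HQ; apply: hull_sub; exists Q.
have B := hull_convex t01 (hull _ h1) (hull _ h2).
have C := hull_convex t01' (hull _ h3) (hull _ h4).
rewrite /int_point /= in B C.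
set b2 := t * Q1.2%:~R + (1 - t) * Q2.2%:~R in B.
set c2 := t' * Q3.2%:~R + (1 - t') * Q4.2%:~R in C.
have eb1 : t * Q1.1%:~R + (1 - t) * Q2.1%:~R = P.1%:~R by lra.
have ec1 : t' * Q3.1%:~R + (1 - t') * Q4.1%:~R = P.1%:~R by lra.
rewrite eb1 in B; rewrite ec1 in C.
have b2lt : b2 < P.2%:~R by rewrite /b2; lra.
have c2gt : P.2%:~R < c2 by rewrite /c2; lra.
have d0 : 0 < c2 - b2 by lra.
have dn : c2 - b2 != 0 by rewrite gt_eqF.
have [||e _] := @extreme_not_between R _ _ _ _ ((c2 - P.2%:~R) / (c2 - b2)) ext B C.
- apply/andP; split; first by rewrite divr_gt0 // subr_gt0.
  by rewrite ltr_pdivrMr // mul1r; lra.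
- by rewrite /int_point /=; congr (_, _); field.
by move: e => /(congr1 snd) /= e; move: b2lt; rewrite e ltxx.
Qed.

(** The parameter [lam] of [S] on the line from [P] to [Q] tells which point would lie strictly
    between the other two. *)
Lemma vertices_not_collinear (P Q S : int * int) :
    hull_vertices R a m (int_point R P) -> hull_vertices R a m (int_point R Q) ->
    hull_vertices R a m (int_point R S) -> P != Q -> P != S -> Q != S ->
  bracket P Q S != 0.
Proof.
move=> eP eQ eS PQ PS QS; apply/negP => /eqP br.
have ip_inj : injective (int_point R).
  by move=> [x y] [x' y'] [/intr_inj -> /intr_inj ->].
have between (A B C : int * int) (t : R) : hull_vertices R a m (int_point R A) ->
    hull_vertices R a m (int_point R B) -> hull_vertices R a m (int_point R C) -> A != B ->
    0 < t < 1 -> A.1%:~R = t * B.1%:~R + (1 - t) * C.1%:~R ->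
    A.2%:~R = t * B.2%:~R + (1 - t) * C.2%:~R -> False.
  move=> eA [hB _] [hC _] AB t01 e1 e2.
  have [|e _] := @extreme_not_between R _ _ _ _ t eA hB hC t01.
    by rewrite /int_point /= e1 e2.
  by move/eqP: AB; apply; apply: ip_inj.
have [lam e1 e2] : exists2 lam : R, S.1%:~R - P.1%:~R = lam * (Q.1%:~R - P.1%:~R) &
     S.2%:~R - P.2%:~R = lam * (Q.2%:~R - P.2%:~R).
  have brR : (Q.1%:~R - P.1%:~R) * (S.2%:~R - P.2%:~R) = (S.1%:~R - P.1%:~R) * (Q.2%:~R - P.2%:~R) :> R.
    by rewrite -!intrB -!intrM; congr (_%:~R); apply/eqP; rewrite -subr_eq0; apply/eqP.
  have [u1|u1] := eqVneq (Q.1%:~R - P.1%:~R) (0 : R); last first.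
    exists ((S.1%:~R - P.1%:~R) / (Q.1%:~R - P.1%:~R)); first by rewrite divfK.
    by apply: (mulfI u1); rewrite brR; field.
  have u2 : Q.2%:~R - P.2%:~R != 0 :> R.
    apply: contraNneq PQ => u2; rewrite [P]surjective_pairing [Q]surjective_pairing.
    move/eqP: u1; move/eqP: u2; rewrite !subr_eq0 !eqr_int => /eqP -> /eqP ->.
    by rewrite eqxx.
  exists ((S.2%:~R - P.2%:~R) / (Q.2%:~R - P.2%:~R)); last by rewrite divfK.
  move: brR; rewrite u1 mul0r mulr0 => /esym/eqP; rewrite mulf_eq0 (negPf u2) orbF => /eqP.
  by [].
have [l0|l0|l0] := ltgtP lam 0.
- have nz : 1 - lam != 0 by rewrite gt_eqF //; lra.
  apply: (between P Q S (- lam / (1 - lam))) => //.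
  + by rewrite divr_gt0 ?oppr_gt0 //=; [rewrite ltr_pdivrMr; lra | lra].
  + by rewrite (_ : S.1%:~R = P.1%:~R + lam * (Q.1%:~R - P.1%:~R)); [field; exact: nz | lra].
  by rewrite (_ : S.2%:~R = P.2%:~R + lam * (Q.2%:~R - P.2%:~R)); [field; exact: nz | lra].
- have [l1|l1|l1] := ltgtP lam 1.
  + by apply: (between S Q P lam) => //; rewrite ?l0 ?l1 // 1?eq_sym //; lra.
  + have nz : lam != 0 by rewrite gt_eqF.
    apply: (between Q S P lam^-1) => //.
    * by rewrite invr_gt0 l0 invf_lt1.
    * by rewrite (_ : S.1%:~R = P.1%:~R + lam * (Q.1%:~R - P.1%:~R)); [field; exact: nz | lra].
    by rewrite (_ : S.2%:~R = P.2%:~R + lam * (Q.2%:~R - P.2%:~R)); [field; exact: nz | lra].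
  case/eqP: QS; rewrite l1 !mul1r in e1 e2.
  rewrite [S]surjective_pairing [Q]surjective_pairing.
  by congr (_, _); apply: (@intr_inj R); lra.
case/eqP: PS; rewrite l0 !mul0r in e1 e2.
rewrite [S]surjective_pairing [P]surjective_pairing.
by congr (_, _); apply: (@intr_inj R); lra.
Qed.

Lemma vertex_list : exists s : seq (int * int), [/\ uniq s, size s = num_hull_vertices R a m &
  {in s, forall P, H P /\ hull_vertices R a m (int_point R P)}].
Proof.
pose l := enum_fset (fset_set (hull_vertices R a m)).
have ul : uniq l := fset_uniq _.
have hl x : x \in l -> hull_vertices R a m x.
  by move=> xl; have : x \in fset_set (hull_vertices R a m) by []; rewrite in_fset_set ?inE //; apply: finite_hull_vertices.
have pre x : exists P, x \in l -> H P /\ int_point R P = x.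
  have [xl|nx] := boolP (x \in l); last by exists (0, 0).
  by have [P HP e] := extreme_points_convex_hull (hl x xl); exists P.
have [g Hg] := choice pre.
exists (map g l); split; last 1 first.
- by move=> _ /mapP[x xl ->]; have [h e] := Hg x xl; split=> //; rewrite e; apply: hl.
- rewrite map_inj_in_uniq // => x y xl yl e.
  by have [_ <-] := Hg x xl; have [_ <-] := Hg y yl; rewrite e.
by rewrite size_map.
Qed.

End HyperbolaVertices.

(** * Vertices close to a corner of the square *)

Section VertexCount.
Variables (R : realType) (a : int) (m : nat).
Hypothesis m_gt1 : (1 < m)%N.
Hypothesis co : coprimez a m%:Z.
Let H := modular_hyperbola a m.

Definition corner_coord (b : bool) (x : int) : int := if b then x else m%:Z - x.

Definition box_threshold := (9 * tau m ^ 6 * cofactor_nat m ^ 2 * m ^ 3)%N.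

(** Replacing a coordinate [x] by [m - x] changes the sign of the product modulo [m], so the four
    corners reduce to the residues [a] and [- a]. *)
Lemma box_point (b1 b2 : bool) (A B : nat) : (A <= m)%N -> (B <= m)%N ->
    (box_threshold < (A * B) ^ 2)%N ->
  exists x y : nat, [/\ (1 <= x <= 2 * A)%N, (1 <= y <= 2 * B)%N &
    (m%:Z %| corner_coord b1 x%:Z * corner_coord b2 y%:Z - a)%Z].
Proof.
move=> Am Bm big; have m0 : (0 < m)%N := ltnW m_gt1.
pose ac := if b1 == b2 then a else - a.
pose c := `|(ac %% m%:Z)%Z|%N.
have mz : m%:Z != 0 by case: (m) m0.
have ec : c%:Z = (ac %% m%:Z)%Z by rewrite /c gez0_abs // modz_ge0.
have AB0 : (0 < A * B)%N by move: big; case: (A * B)%N => //; rewrite ltn0.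
have [A0 B0] : (0 < A)%N /\ (0 < B)%N by move: AB0; rewrite muln_gt0 => /andP[].
have cm : coprime c m.
  have : coprimez (ac %% m%:Z)%Z m%:Z.
    rewrite /coprimez gcdz_modl -/(coprimez _ _) /ac; case: ifP => _ //.
    by rewrite coprimeNz.
  by rewrite -ec coprimezE.
have [||x [y [hx hy exy]]] := @modular_box m A B c m0 cm _ _ big; rewrite ?A0 ?B0 //.
exists x, y; split => //.
have dxy : (m%:Z %| x%:Z * y%:Z - ac)%Z.
  rewrite -eqz_mod_dvd -[X in _ == X]modz_mod -ec -PoszM !modz_nat.
  by rewrite exy.
have -> : corner_coord b1 x%:Z * corner_coord b2 y%:Z - a =
    (if b1 == b2 then 1 else -1) * (x%:Z * y%:Z - ac)
    + m%:Z * (if b1 then (if b2 then 0 else x%:Z) else (if b2 then y%:Z else m%:Z - x%:Z - y%:Z)).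
  by rewrite /ac; case: (b1); case: (b2) => /=; ring.
by apply: rpredD; [apply: dvdz_mull | apply: dvdz_mulr].
Qed.

Lemma corner_coord_range b (z : int) :
  1 <= z <= m%:Z - 1 -> 1 <= corner_coord b z <= m%:Z - 1.
Proof. by move=> /andP[z1 z2]; rewrite /corner_coord; case: b; apply/andP; split; lia. Qed.

(** For [x >= 1], the largest [A] with [2 * A < x]: the points given by [box_point] are then
    strictly closer to the corner. *)
Definition half_pred (x : int) : nat := (`|x|.-1)./2.

(** Otherwise some point of the hyperbola is strictly closer to the corner in both coordinates, and
    the supporting functional is smaller there than at [P]. *)
Lemma corner_small (P : int * int) (nu : R * R) : H P -> nu != (0, 0) ->
    (forall Q, H Q -> 0 <= nu.1 * (Q.1%:~R - P.1%:~R) + nu.2 * (Q.2%:~R - P.2%:~R)) ->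
  ((half_pred (corner_coord (0 <= nu.1)%R P.1) * half_pred (corner_coord (0 <= nu.2)%R P.2)) ^ 2
     <= box_threshold)%N.
Proof.
move=> [_ x12 y12] nz sup; rewrite leqNgt; apply/negP => big.
set b1 := 0 <= nu.1 in big; set b2 := 0 <= nu.2 in big.
set x' := corner_coord b1 P.1 in big; set y' := corner_coord b2 P.2 in big.
have hx' : 1 <= x' <= m%:Z - 1 by apply: corner_coord_range.
have hy' : 1 <= y' <= m%:Z - 1 by apply: corner_coord_range.
have half_le (x : int) : 1 <= x <= m%:Z - 1 -> (half_pred x <= m)%N /\ (2 * half_pred x)%N%:Z < x.
  move=> /andP[xx1 xx2]; rewrite /half_pred.
  have := odd_double_half `|x|.-1; rewrite -mul2n; lia.
have [hA hA2] := half_le _ hx'; have [hB hB2] := half_le _ hy'.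
have [x [y [/andP[px1 px2] /andP[py1 py2] d]]] := box_point b1 b2 hA hB big.
have xx : 1 <= x%:Z < x' by lia.
have yy : 1 <= y%:Z < y' by lia.
pose Q := (corner_coord b1 x%:Z, corner_coord b2 y%:Z).
have HQ : H Q.
  split; first by apply/eqP; rewrite eqz_mod_dvd.
    by rewrite /Q /=; move: hx' xx; rewrite /corner_coord; case: (b1) => /=; lia.
  by rewrite /Q /=; move: hy' yy; rewrite /corner_coord; case: (b2) => /=; lia.
have := sup Q HQ; rewrite leNgt => /negP; apply.
have part (n : R) (z z' w : int) : z' = corner_coord (0 <= n) w -> 1 <= z < z' ->
    n * ((corner_coord (0 <= n) z)%:~R - w%:~R) <= 0 /\
    (n != 0 -> n * ((corner_coord (0 <= n) z)%:~R - w%:~R) < 0).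
  rewrite /corner_coord; have [n0|n0] := leP 0 n => ez zz.
    have dz : z%:~R - w%:~R < 0 :> R by rewrite subr_lt0 ltr_int -ez; case/andP: zz.
    split; first by rewrite mulr_ge0_le0 // ltW.
    by move=> nn0; rewrite pmulr_rlt0 // lt_neqAle eq_sym nn0.
  have dz : 0 < (m%:Z - z)%:~R - w%:~R :> R by rewrite subr_gt0 ltr_int; lia.
  by split; rewrite ?nmulr_rlt0 // ltW // nmulr_rlt0.
have [l1 s1] := part nu.1 x%:Z x' P.1 erefl xx.
have [l2 s2] := part nu.2 y%:Z y' P.2 erefl yy.
rewrite /Q /=; have [n1|n1] := eqVneq nu.1 0; last by rewrite -[X in _ < X]addr0 ltr_leD // s1.
rewrite -[X in _ < X]add0r ler_ltD // s2 //.
by apply: contraNneq nz => n2; rewrite [nu]surjective_pairing n1 n2.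
Qed.

(** For each corner and each range [2 ^ i <= X < 2 ^ i.+1] of the halved distance, the vertices lie
    in a rectangle with sides [U = 2 ^ i.+2] and [V = 4 sW / 2 ^ i], for which [4 U V = 64 sW]. *)
Theorem vertex_count_le (sW : R) (J Dl K : nat) : 0 < sW -> sW ^+ 2 = box_threshold%:R ->
    (0 < J)%N -> 64 * sW <= Dl%:R * J%:R ^+ 3 ->
    (forall s : seq (int * int), uniq s -> no_three_collinear s -> {in s, forall P, H P} ->
       {in s & &, forall P Q S, `|bracket P Q S| <= Dl%:Z} -> (size s <= K)%N) ->
  (num_hull_vertices R a m <= 4 * ((trunc_log 2 m).+1 * (4 * ((2 * J).+1 * K))))%N.
Proof.
move=> sW0 sWE J0 HD HK; have m0 : (0 < m)%N := ltnW m_gt1.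
have [s [us <- Hs]] := vertex_list R a m.
have nus P : exists nu : R * R, P \in s -> nu != (0, 0) /\ forall Q, H Q ->
    0 <= nu.1 * (Q.1%:~R - P.1%:~R) + nu.2 * (Q.2%:~R - P.2%:~R).
  have [Ps|nPs] := boolP (P \in s); last by exists (0, 0).
  have [_ eP] := Hs P Ps; have [nu hnu] := extreme_support eP; by exists nu.
have [nu Hnu] := choice nus.
have ncol : no_three_collinear s.
  by move=> P Q S /Hs[_ eP] /Hs[_ eQ] /Hs[_ eS]; apply: (vertices_not_collinear eP eQ eS).
pose f P := (0 <= (nu P).1, 0 <= (nu P).2).
apply: (@size_le_classes _ _ s f [:: (true, true); (true, false); (false, true); (false, false)]) => [P _|[b1 b2] _].
  by rewrite /f !inE; case: (0 <= (nu P).1); case: (0 <= (nu P).2).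
set s1 := seq.filter _ _.
have mem1 P : P \in s1 -> [/\ P \in s, (0 <= (nu P).1) = b1 & (0 <= (nu P).2) = b2].
  by rewrite mem_filter => /andP[/eqP[<- <-]].
pose X (P : int * int) := (half_pred (corner_coord b1 P.1)).+1.
pose Y (P : int * int) := (half_pred (corner_coord b2 P.2)).+1.

have halfP (x : int) : 1 <= x <= m%:Z - 1 ->
    x <= (2 * (half_pred x).+1)%N%:Z /\ (2 * (half_pred x).+1 <= m)%N.
  move=> /andP[xx1 xx2]; rewrite /half_pred.
  have := odd_double_half `|x|.-1; rewrite -mul2n; case: (odd _) => /=; lia.
have boxP (P : int * int) : P \in s1 -> [/\ 0 <= corner_coord b1 P.1 <= (2 * X P)%N%:Z,
    0 <= corner_coord b2 P.2 <= (2 * Y P)%N%:Z, (X P <= m)%N & (X P)%:R * (Y P)%:R <= 2 * sW].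
  move=> /mem1[Ps e1 e2]; have [HP _] := Hs P Ps; have [nz sup] := Hnu P Ps.
  have := corner_small HP nz sup; rewrite e1 e2.
  have [_ x12 y12] := HP.
  have hx' := corner_coord_range b1 x12; have hy' := corner_coord_range b2 y12.
  have [hX hXm] := halfP _ hx'; have [hY hYm] := halfP _ hy'.
  rewrite -/(X P) -/(Y P) in hX hXm hY hYm.
  move=> small; split.
  - by rewrite hX andbT; case/andP: hx' => h _; apply: le_trans h.
  - by rewrite hY andbT; case/andP: hy' => h _; apply: le_trans h.
  - by apply: leq_trans hXm; rewrite leq_pmull.
  rewrite -natrM -(@ler_sqr R) ?nnegrE ?ler0n ?mulr_ge0 ?ler0n ?(ltW sW0) //.
  rewrite exprMn sWE -natrX -natrX -natrM ler_nat.
  (* Passing from [half_pred] to its successor costs at most [m], and [m ^ 2 <= box_threshold]; so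
     the bound at most doubles. *)
  have XY : (X P * Y P <= (X P).-1 * (Y P).-1 + m)%N by rewrite /X /Y /= in hXm hYm *; lia.
  have mW : (m ^ 2 <= box_threshold)%N.
    rewrite /box_threshold -[(m ^ 2)%N]mul1n leq_mul //; last by rewrite leq_pexp2l.
    by rewrite !(expn_gt0, muln_gt0) tau_gt0 cofactor_gt0 ?m0.
  have : ((X P * Y P) ^ 2 <= ((X P).-1 * (Y P).-1 + m) ^ 2)%N by rewrite leq_exp2r.
  move/leq_trans; apply; rewrite /X /Y /=.
  move: small mW; move: (half_pred _ * half_pred _)%N => u; move: box_threshold => W.
  have : (2 * (u * m) <= u ^ 2 + m ^ 2)%N by apply: nat_Cauchy.
  rewrite sqrnD (_ : 2 ^ 2 = 4)%N //; lia.
pose ix (P : int * int) := trunc_log 2 (X P).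
rewrite -[(trunc_log 2 m).+1](size_iota 0).
apply: (@size_le_classes _ _ s1 ix) => [P /boxP[_ _ Xm _]|i _].
  by rewrite mem_iota add0n ltnS /= leq_trunc_log.
set s2 := seq.filter _ _.
have mem2 P : P \in s2 -> P \in s1 /\ ix P = i by rewrite mem_filter => /andP[/eqP].
pose U : R := 2 ^+ i.+2; pose V : R := 4 * sW / 2 ^+ i.
have p2 : 0 < 2 ^+ i :> R by rewrite exprn_gt0.
have U0 : 0 < U by rewrite exprn_gt0.
have V0 : 0 < V by rewrite divr_gt0 // mulr_gt0.
pose x0 : R := if b1 then 0 else m%:R - U.
pose y0 : R := if b2 then 0 else m%:R - V.
apply: (@rect_count R s2 nu x0 y0 U V J Dl K) => //.
- by rewrite !filter_uniq.
- rewrite (_ : 4 * U * V = 64 * sW) // /U /V !exprS.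
  by field; rewrite gt_eqF.
- move=> P /mem2[Ps1 iP]; have [hX hY Xm XY] := boxP P Ps1.
  have /andP[lo hi] : (2 ^ i <= X P < 2 ^ i.+1)%N.
    by have := @trunc_log_bounds 2 (X P) erefl erefl; rewrite -/(ix P) iP.
  have hXU : (2 * X P)%:R <= U by rewrite /U -natrX ler_nat expnS leq_mul2l ltnW.
  have hYV : (2 * Y P)%:R <= V.
    rewrite /V ler_pdivlMr // natrM -mulrA (_ : 4 * sW = 2 * (2 * sW)); last by ring.
    rewrite ler_pM2l //; apply: le_trans XY; rewrite mulrC ler_wpM2r // -natrX ler_nat //.
  have conv (b : bool) (z : int) (W : R) (n : nat) : 0 <= corner_coord b z <= n%:Z -> n%:R <= W ->
      let o : R := if b then 0 else m%:R - W in o <= z%:~R <= o + W.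
    move=> /andP[z1 z2] nW /=; have z1' : 0 <= (corner_coord b z)%:~R :> R by rewrite ler0z.
    have z2' : (corner_coord b z)%:~R <= W by apply: le_trans nW; rewrite -[n%:R]/(n%:Z%:~R) ler_int.
    move: z1' z2'; rewrite /corner_coord; case: (b) => h1 h2; first by rewrite h1 add0r.
    rewrite intrB in h1 h2; rewrite -[m%:R]/(m%:Z%:~R); apply/andP; split; lra.
  by split; [apply: conv hX hXU | apply: conv hY hYV].
- by move=> P /mem2[/mem1[Ps _ _] _]; have [] := Hnu P Ps.
- move=> P Q /mem2[/mem1[Ps _ _] _] /mem2[/mem1[Qs _ _] _]; have [_] := Hnu P Ps; apply.
  by have [] := Hs Q Qs.
move=> s' us' sub; have sub' : {subset s' <= s} by move=> P /sub/mem2[/mem1[]].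
apply: HK => //; first exact: sub_no_three sub' ncol.
by move=> P /sub'/Hs[].
Qed.

End VertexCount.

(** * Subpolynomial factors and the choice of parameters *)

Lemma max_tau_expn (C k N : nat) : (0 < k)%N -> (forall n, (0 < n)%N -> (tau n ^ k <= C * n)%N) ->
  ((\max_(n < N) tau n.+1) ^ k <= C * N)%N.
Proof.
move=> k0 HC; case: N => [|N]; first by rewrite big_ord0 exp0n.
have [|i ->] := @bigop.eq_bigmax 'I_N.+1 (fun n => tau n.+1); first by rewrite card_ord.
by apply: leq_trans (HC _ _) _ => //; rewrite leq_mul2l ltn_ord orbT.
Qed.

(** Lets the divisor bound absorb logarithms too. *)
Lemma trunc_log_lt_tau (L : nat) : (L < tau (2 ^ L))%N.
Proof.
rewrite /tau -(size_iota 0 L.+1) -(size_map (fun i => 2 ^ i)%N).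
apply: uniq_leq_size => [|d /mapP[i]].
  by rewrite map_inj_uniq ?iota_uniq // => i j /eqP; rewrite eqn_exp2l // => /eqP.
by rewrite mem_iota add0n ltnS => iL ->; rewrite -dvdn_divisors ?expn_gt0 // dvdn_exp2l.
Qed.

Definition conic_height (m : nat) : nat := (544 * (32 * m ^ 8) ^ 4)%N.

Definition max_tau (m : nat) : nat := \max_(n < conic_height m) tau n.+1.

(** One logarithm counts dyadic rectangles, the other comes from the Pell equations. [tau m] enters
    through [box_threshold]; [336 = 16 * 21] and 273 are collected in [vertex_count_subpoly]. *)
Definition subpoly_factor (m : nat) : nat :=
  (336 * 273 * ((trunc_log 2 m).+1 ^ 2 * (tau m * max_tau m ^ 2)))%N.

(** [67 = 2 + 1 + 64]: two logarithms, [tau m], and twice the exponent 32 of [m] in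
    [conic_height]. *)
Lemma subpoly_factor_expn (C k m : nat) : (0 < k)%N -> (0 < m)%N ->
    (forall n, (0 < n)%N -> (tau n ^ k <= C * n)%N) ->
  (subpoly_factor m ^ k <= (336 * 273) ^ k * (C ^ 5 * (544 * 32 ^ 4) ^ 2) * m ^ 67)%N.
Proof.
move=> k0 m0 HC; rewrite /subpoly_factor.
have hL : ((trunc_log 2 m).+1 ^ k <= C * m)%N.
  have [|lo _] := andP (@trunc_log_bounds 2 m _ m0) => //.
  apply: leq_trans (_ : tau (2 ^ trunc_log 2 m) ^ k <= _)%N.
    by rewrite leq_exp2r // trunc_log_lt_tau.
  apply: leq_trans (HC _ _) _; first by rewrite expn_gt0.
  by rewrite leq_mul2l lo orbT.
have hM := max_tau_expn (conic_height m) k0 HC; rewrite -/(max_tau m) in hM.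
have ht := HC _ m0.
move: hL hM ht; set u := (_.+1); set v := max_tau m; set w := tau m => hL hM ht.
rewrite expnMn -[X in (_ <= X)%N]mulnA leq_mul //.
rewrite 2!expnMn -[((u ^ 2) ^ k)%N]expnAC -[((v ^ 2) ^ k)%N]expnAC.
apply: (@leq_trans ((C * m) ^ 2 * ((C * m) * (C * conic_height m) ^ 2))%N).
  by rewrite !leq_mul // leq_exp2r.
have e c d : ((C * m) ^ 2 * (C * m * (C * (c * (d * m ^ 8) ^ 4)) ^ 2) =
    C ^ 5 * (c * d ^ 4) ^ 2 * m ^ 67)%N by ring.
by rewrite e.
Qed.

Lemma subpoly_factor_le (R : realType) (eps : R) : 0 < eps ->
  exists m0, forall m, (m0 <= m)%N -> (subpoly_factor m)%:R <= m%:R `^ eps :> R.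
Proof.
(* 68 is one more than 67: the extra power of [m] absorbs the constant. *)
move=> e0; pose k := (Num.truncn (68 / eps)).+1.
have ke : 68 <= eps * k%:R.
  rewrite mulrC -ler_pdivrMr //; apply: ltW.
  by apply: truncnS_gt.
have [C _ HC] := tau_bound k.
exists (maxn 1 ((336 * 273) ^ k * (C ^ 5 * (544 * 32 ^ 4) ^ 2)))%N => m.
rewrite geq_max => /andP[m0 mC].
have m1 : 1 <= m%:R :> R by rewrite ler1n.
rewrite -(@ler_pXn2r _ k) ?nnegrE ?powR_ge0 ?ler0n //.
apply: (@le_trans _ _ (m%:R `^ 68)).
  rewrite -natrX (powR_mulrn 68) ?ler0n // -natrX ler_nat.
  apply: leq_trans (subpoly_factor_expn _ m0 HC) _ => //.
  by rewrite [X in (_ <= X)%N]expnS leq_mul2r mC orbT.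
rewrite -powR_mulrn ?powR_ge0 // -powRrM.
by apply: ler_powR.
Qed.

(** 29 comes from [448 < 2 ^ 9] and [32 ^ 4 = 2 ^ 20]. *)
Lemma two_expn_conic_height m : (0 < m)%N ->
  (448 * (32 * m ^ 8) ^ 4 < 2 ^ (29 + 32 * (trunc_log 2 m).+1))%N.
Proof.
move=> m0; have /andP[_ hi] := @trunc_log_bounds 2 m isT m0.
have -> : ((32 * m ^ 8) ^ 4 = 2 ^ 20 * m ^ 32)%N.
  by rewrite expnMn -[32%N in X in X = _]/(2 ^ 5)%N -!expnM.
set e := (32 * _.+1)%N; have he : (m ^ 32 < 2 ^ e)%N by rewrite /e mulnC expnM ltn_exp2r.
have -> : (2 ^ (29 + e) = 2 ^ 9 * (2 ^ 20 * 2 ^ e))%N.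
  by move: e {he} => e; rewrite -!expnD; congr (2 ^ _)%N; lia.
move: (2 ^ 20)%N (expn_gt0 2 20) (m ^ 32)%N (2 ^ e)%N he => u u0 v w vw.
apply: (@leq_ltn_trans (2 ^ 9 * (u * v))); first by rewrite leq_mul2r orbT.
by rewrite !ltn_pmul2l // u0.
Qed.

(** The largest [d] is at least 1 because [2 < n]; then [d.+1 <= 2 * d] costs a factor 16. *)
Lemma quartic_root_nat (n : nat) : (2 < n)%N ->
  exists2 d : nat, (2 * d ^ 4 < n)%N & (n <= 32 * d ^ 4)%N.
Proof.
move=> n2; have ex : exists d, (2 * d ^ 4 < n)%N by exists 1%N; rewrite exp1n.
have bd d : (2 * d ^ 4 < n)%N -> (d <= n)%N.
  move=> /ltnW; apply: leq_trans; case: d => // d.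
  by apply: (@leq_trans (d.+1 ^ 4)); [rewrite -[X in (X <= _)%N]expn1 leq_pexp2l | rewrite leq_pmull].
case: (ex_maxnP ex bd) => d hd dmax; exists d => //.
have d1 : (1 <= d)%N by apply: dmax; rewrite exp1n.
have : (n <= 2 * d.+1 ^ 4)%N by rewrite leqNgt; apply/negP => /dmax; rewrite ltnn.
move/leq_trans; apply.
apply: (@leq_trans (2 * (2 * d) ^ 4)); last by rewrite expnMn mulnA.
by rewrite leq_mul2l leq_exp2r //; lia.
Qed.

Theorem vertex_count_subpoly (R : realType) (a : int) (m : nat) : (1 < m)%N ->
    coprimez a m%:Z -> (2 < kernel_nat m)%N ->
  (num_hull_vertices R a m)%:R <=
    (cofactor_nat m)%:R * (m%:R `^ (1 / 12)) ^+ 5 * (subpoly_factor m)%:R :> R.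
Proof.
move=> m1 co k2; have m0 := ltnW m1.
set q := m%:R `^ (1 / 12); set t := cofactor_nat m; set ta := tau m.
have m1R : 1 <= m%:R :> R by rewrite ler1n.
have q1 : 1 <= q by rewrite -(powRr0 m%:R) ler_powR // divr_ge0.
have q0 : 0 < q by apply: lt_le_trans q1.
have qE : q ^+ 12 = m%:R.
  by rewrite -powR_mulrn ?powR_ge0 // -powRrM mul1r mulVf ?pnatr_eq0 // powRr1 // ler0n.
have t1 : 1 <= t%:R :> R by rewrite ler1n cofactor_gt0.
have ta1 : 1 <= ta%:R :> R by rewrite ler1n tau_gt0.
have [t0 ta0] : 0 < t%:R :> R /\ 0 < ta%:R :> R by split; apply: lt_le_trans ltr01 _.
(* The square root of [box_threshold], with [m ^ (3/2) = q ^ 18]. *)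
pose sW : R := 3 * ta%:R ^+ 3 * t%:R * q ^+ 18.
have sW0 : 0 < sW by rewrite !mulr_gt0 // exprn_gt0.
have sWE : sW ^+ 2 = (box_threshold m)%:R.
  by rewrite /box_threshold -/t -/ta !(natrX, natrM) -qE /sW; ring.
pose x : R := ta%:R * t%:R * q ^+ 5.
have x1 : 1 <= x by rewrite !mulr_ege1 // exprn_ege1.
have x0 : 0 < x by apply: lt_le_trans ltr01 _.
(* 9 is the least integer whose cube reaches [64 * 3 * 3]: the 64 of [vertex_count_le], the 3 in
   [sW] and the 3 in [hD]. *)
pose J := (Num.truncn (9 * x)).+1.
have [J1 J2] : 9 * x <= J%:R /\ J%:R <= 9 * x + 1.
  have /andP[lo hi] := truncn_itv (ltW (mulr_gt0 (ltr0n R 9) x0)).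
  by rewrite /J; split; [apply: ltW | rewrite -natr1 lerD2r].
have [Dl Dlo Dhi] := quartic_root_nat k2.
(* In fourth powers: [m = t * kernel_nat m <= 32 * t * Dl ^ 4], and [32 * t <= 3 ^ 4 * t ^ 4]. *)
have hD : q ^+ 3 <= 3 * (Dl%:R * t%:R).
  rewrite -(@ler_pXn2r _ 4) ?nnegrE ?exprn_ge0 ?mulr_ge0 ?ler0n ?(ltW q0) //.
  rewrite -exprM qE -(cofactor_kernel m0) -/t !exprMn.
    apply: (@le_trans _ _ (32 * Dl%:R ^+ 4 * t%:R ^+ 4)).
    rewrite natrM mulrC ler_pM ?ler0n //.
      by rewrite -natrX -natrM ler_nat.
    by rewrite ler_eXnr.
  rewrite -mulrA ler_wpM2r ?mulr_ge0 ?exprn_ge0 ?ler0n //.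
  by rewrite -natrX ler_nat.
have HD : 64 * sW <= Dl%:R * J%:R ^+ 3.
  apply: (@le_trans _ _ (Dl%:R * (9 * x) ^+ 3)); last first.
    apply: ler_wpM2l; first exact: ler0n.
    by apply: lerXn2r => //; rewrite nnegrE ?ler0n // mulr_ge0 ?ler0n // ltW.
  have -> : Dl%:R * (9 * x) ^+ 3 = 243 * (ta%:R ^+ 3 * t%:R * q ^+ 15) * t%:R * (3 * (Dl%:R * t%:R)).
    by rewrite /x; ring.
  apply: (@le_trans _ _ (243 * (ta%:R ^+ 3 * t%:R * q ^+ 15) * t%:R * q ^+ 3)); last first.
    by apply: ler_wpM2l hD; rewrite !mulr_ge0 ?exprn_ge0 ?ler0n ?(ltW q0).
  have -> : 243 * (ta%:R ^+ 3 * t%:R * q ^+ 15) * t%:R * q ^+ 3 =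
      81 * sW * t%:R by rewrite /sW; ring.
  apply: (@le_trans _ _ (81 * sW)); first by rewrite ler_pM2r // ler_nat.
  by rewrite ler_peMr // mulr_ge0 // ltW.
set L := (trunc_log 2 m).+1.
pose M := max_tau m; pose T := (29 + 32 * L)%N.
pose K := (4 + M ^ 2 * (4 * T + 25))%N.
have h := vertex_count_le m1 co sW0 sWE (ltn0Sn _) HD _.
have {h} : (num_hull_vertices R a m <= 4 * (L * (4 * ((2 * J).+1 * K))))%N.
  apply: h => s us ncs sH sD.
  have [||n /andP[n0 nN] hs] := @cell_count R m a s Dl T m1 co us ncs _ sD Dlo.
  - have le_m (z : int) : 1 <= z <= m%:Z - 1 -> 0 <= z <= m%:Z.
      by case/andP=> z1 z2; rewrite (le_trans _ z1) // (le_trans z2) // gerBl.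
    by move=> P /sH[/eqP]; rewrite eqz_mod_dvd => d /le_m p1 /le_m p2.
  - exact: two_expn_conic_height.
  apply: leq_trans hs _; rewrite leq_add2l leq_mul2r leq_exp2r //.
  apply/orP; right; rewrite -(prednK n0).
  have nN' : (n.-1 < conic_height m)%N by rewrite prednK.
  exact: (@leq_bigmax _ (fun n : 'I_(conic_height m) => tau n.+1) (Ordinal nN')).
have M1 : (1 <= M)%N.
  have N0 : (0 < conic_height m)%N by rewrite /conic_height !(muln_gt0, expn_gt0) m0.
  apply: leq_trans (@leq_bigmax _ (fun n : 'I_(conic_height m) => tau n.+1) (Ordinal N0)).
  exact: tau_gt0.
(* [K = 4 + M ^ 2 * (141 + 128 * L)], and [4 + 141 + 128 = 273]. *)
have hK : (K <= 273 * (L * M ^ 2))%N.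
  have : (1 <= M ^ 2)%N by rewrite expn_gt0 M1.
  rewrite /K /T; have : (1 <= L)%N by [].
  by move: (M ^ 2)%N (L) => u v; clear; nia.
move=> num; apply: (@le_trans _ _ (4 * (L * (4 * ((2 * J).+1 * (273 * (L * M ^ 2))))))%N%:R).
  by rewrite ler_nat; apply: leq_trans num _; rewrite !leq_mul2l hK !orbT.
have hJ : (2 * J).+1%:R <= 21 * x by rewrite -addn1 natrD natrM; lra.
have -> : (4 * (L * (4 * ((2 * J).+1 * (273 * (L * M ^ 2))))))%N%:R =
    (2 * J).+1%:R * (16 * 273 * (L%:R ^+ 2 * M%:R ^+ 2)) :> R.
  by rewrite !(natrX, natrM); ring.
have -> : t%:R * q ^+ 5 * (subpoly_factor m)%:R = 21 * x * (16 * 273 * (L%:R ^+ 2 * M%:R ^+ 2)).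
  by rewrite /subpoly_factor -/L -/M -/ta !(natrX, natrM) /x; ring.
by apply: ler_wpM2r hJ; rewrite !mulr_ge0 ?exprn_ge0 ?ler0n.
Qed.

(** A vertical line carries at most two vertices. This settles kernels at most 2, for which
    [quartic_root_nat] gives no cell size. *)
Lemma vertex_count_le_double (R : realType) (a : int) (m : nat) : (1 < m)%N ->
  (num_hull_vertices R a m <= 2 * m)%N.
Proof.
move=> m1; have [s [us <- Hs]] := vertex_list R a m.
have ncol : no_three_collinear s.
  by move=> P Q S /Hs[_ eP] /Hs[_ eQ] /Hs[_ eS]; apply: (vertices_not_collinear eP eQ eS).
rewrite -{1}(size_iota 0 m) mulnC.
apply: (@size_le_classes _ _ s (fun P => `|P.1|%N)) => [P /Hs[[_ /andP[p1 p2] _] _]|i _].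
  rewrite mem_iota add0n leq0n -ltz_nat gez0_abs; last by apply: le_trans p1.
  by rewrite (le_lt_trans p2) // gtrBl.
apply: (@size_collinear_le2 _ 1 0 i%:Z).
- by rewrite filter_uniq.
- by apply: sub_no_three ncol => P; rewrite mem_filter => /andP[].
- by [].
move=> P; rewrite mem_filter => /andP[/eqP <-] /Hs[[_ /andP[p1 p2] _] _].
by rewrite mul1r mul0r addr0 gez0_abs // (le_trans _ p1).
Qed.

Theorem theorem2 (R : realType) (eps : R) (heps : 0 < eps) :
  exists m0 : nat, forall (m : nat) (a : int),
    (m0 <= m)%N -> coprimez a m%:Z ->
    let t : R := m%:R / (kernel_nat m)%:R in
    (num_hull_vertices R a m)%:R <= t * m%:R `^ (5%:R / 12%:R + eps).
Proof.
have [m0 Hm0] := subpoly_factor_le heps.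
(* [4 ^ 12] ensures [4 <= m ^ (5/12)]. With kernel at most 2, the crude bound [2 * m] is at most
   [4 * t]. *)
exists (maxn (4 ^ 12) m0)%N => m a; rewrite geq_max => /andP[m4 mm0] co; cbv zeta.
have m1 : (1 < m)%N by apply: leq_trans m4; rewrite -[X in (X < _)%N](expn0 4) ltn_exp2l.
have mpos := ltnW m1; have m1R : 1 <= m%:R :> R by rewrite ler1n.
have tE : m%:R / (kernel_nat m)%:R = (cofactor_nat m)%:R :> R.
  by rewrite -{1}(cofactor_kernel mpos) natrM mulfK // pnatr_eq0 -lt0n kernel_gt0.
have mR : m%:R != 0 :> R by rewrite pnatr_eq0 -lt0n.
rewrite powRD; last by rewrite mR implybT.
rewrite tE; have [k2|k2] := ltnP 2 (kernel_nat m).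
  apply: le_trans (vertex_count_subpoly _ m1 co k2) _.
  rewrite -powR_mulrn ?powR_ge0 // -powRrM mulrA [1 / 12 * _]mulrC mulrA mulr1.
  by apply: ler_wpM2l; [rewrite mulr_ge0 ?powR_ge0 | exact: Hm0].
apply: (@le_trans _ _ ((cofactor_nat m)%:R * 4)).
  rewrite -natrM ler_nat; apply: leq_trans (vertex_count_le_double R a m1) _.
  by rewrite -{1}(cofactor_kernel mpos) mulnCA leq_mul2l; apply/orP; right; exact: leq_mul (leqnn 2) k2.
apply: ler_wpM2l; first exact: ler0n.
rewrite -[4]mulr1; apply: ler_pM => //; last first.
  by apply: le_trans (_ : m%:R `^ 0 <= _); [rewrite powRr0 | apply: ler_powR => //; apply: ltW].
rewrite -(@ler_pXn2r _ 12) ?nnegrE ?powR_ge0 ?ler0n //.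
rewrite -[leRHS]powR_mulrn ?powR_ge0 // -powRrM divfK ?pnatr_eq0 // powR_mulrn ?ler0n //.
apply: le_trans (_ : m%:R <= _); first by rewrite -natrX ler_nat.
by rewrite -natrX ler_nat -[X in (X <= _)%N]expn1 leq_pexp2l.
Qed.
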